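(* Let $m \in \{62, 67, 71\}$ and let $K_m = \mathbb{Q}(\sqrt{m})$. Then there is no elliptic curve $E$ defined over $K_m$ such that $E$ has everywhere good reduction over $K_m$ and the discriminant $\Delta(E)$ is a cube in $K_m$.
   Context: For a squarefree positive integer $m$, $K_m$ denotes the real quadratic field $\mathbb{Q}(\sqrt{m})$. An elliptic curve over $K_m$ has everywhere good reduction if it has good reduction at every finite prime of $K_m$. $\Delta(E)$ denotes the discriminant of a (global minimal) Weierstrass equation of $E$ over $K_m$. Changing the Weierstrass equation multiplies the discriminant by a 12th power in $K_m^\times$, so whether $\Delta(E)$ is a cube in $K_m$ does not depend on the equation chosen. ''Cubic discriminant'' means that $\Delta(E)$ is a cube in $K_m$. *)

(* Defs.v *)
From HB Require Import structures.
From mathcomp Require Import all_boot all_order all_algebra all_field.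

Set Implicit Arguments.
Unset Strict Implicit.
Unset Printing Implicit Defensive.

Import GRing.Theory.
Local Open Scope ring_scope.

(* Characterises Q(sqrt m) up to isomorphism: K is generated over rat by a
   square root of m. *)
Definition is_Q_sqrt (m : nat) (K : fieldExtType rat) : Prop :=
  exists2 s : K, s ^+ 2 = m%:R & <<1; s>>%VS = {:K}%VS.

Section Weierstrass.

Variable K : fieldType.

(* y^2 + a1 x y + a3 y = x^3 + a2 x^2 + a4 x + a6 *)
Record weierstrass := Weierstrass {a1 : K; a2 : K; a3 : K; a4 : K; a6 : K}.

Implicit Type W : weierstrass.

Definition b2 W : K := a1 W ^+ 2 + 4%:R * a2 W.
Definition b4 W : K := 2%:R * a4 W + a1 W * a3 W.
Definition b6 W : K := a3 W ^+ 2 + 4%:R * a6 W.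
Definition b8 W : K :=
  a1 W ^+ 2 * a6 W + 4%:R * a2 W * a6 W - a1 W * a3 W * a4 W
  + a2 W * a3 W ^+ 2 - a4 W ^+ 2.

Definition disc W : K :=
  - b2 W ^+ 2 * b8 W - 8%:R * b4 W ^+ 3 - 27%:R * b6 W ^+ 2
  + 9%:R * b2 W * b4 W * b6 W.

Definition elliptic W : Prop := disc W != 0.

(* The equation of W in the coordinates x', y' given by
   x = u^2 x' + r and y = u^3 y' + u^2 s x' + t. *)
Definition change_vars W (u r s t : K) : weierstrass :=
  {| a1 := (a1 W + 2%:R * s) / u;
     a2 := (a2 W - s * a1 W + 3%:R * r - s ^+ 2) / u ^+ 2;
     a3 := (a3 W + r * a1 W + 2%:R * t) / u ^+ 3;
     a4 := (a4 W - s * a3 W + 2%:R * r * a2 W - (t + r * s) * a1 W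
            + 3%:R * r ^+ 2 - 2%:R * s * t) / u ^+ 4;
     a6 := (a6 W + r * a4 W + r ^+ 2 * a2 W + r ^+ 3 - t * a3 W - t ^+ 2
            - r * t * a1 W) / u ^+ 6 |}.

Definition w_isom W W' : Prop :=
  exists u r s t : K, u != 0 /\ W' = change_vars W u r s t.

End Weierstrass.

Section GoodReduction.

Variable K : fieldExtType rat.

Definition alg_integer (x : K) : Prop := integralOver (intr : int -> K) x.

(* The nonzero prime ideals of the ring of integers of K, as subsets of K. *)
Record finite_prime (P : K -> Prop) : Prop := FinitePrime {
  fp_integer : forall x, P x -> alg_integer x;
  fp_zero : P 0;
  fp_add : forall x y, P x -> P y -> P (x + y);
  fp_mul : forall a x, alg_integer a -> P x -> P (a * x);
  fp_proper : ~ P 1;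
  fp_prime : forall x y, alg_integer x -> alg_integer y ->
    P (x * y) -> P x \/ P y;
  fp_nonzero : exists2 x, P x & x != 0
}.

Section AtPrime.

Variable P : K -> Prop.

(* The localization of the ring of integers at P, and its maximal ideal. *)
Definition local_integer (x : K) : Prop :=
  exists a b, [/\ alg_integer a, alg_integer b, ~ P b & x = a / b].

Definition local_max (x : K) : Prop :=
  exists a b, [/\ P a, alg_integer b, ~ P b & x = a / b].

Definition integral_model (W : weierstrass K) : Prop :=
  [/\ local_integer (a1 W), local_integer (a2 W), local_integer (a3 W),
      local_integer (a4 W) & local_integer (a6 W)].

(* v_P (disc W) <= v_P (disc W') is expressed as integrality at P of the
   quotient disc W' / disc W; this is used only for disc W != 0. *)
Definition minimal_model (W : weierstrass K) : Prop :=
  integral_model W /\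
  forall W', w_isom W W' -> integral_model W' ->
    local_integer (disc W' / disc W).

(* The discriminant of the reduced equation is the residue class of disc W',
   so the reduction is an elliptic curve iff disc W' is not in the maximal
   ideal of the localization. *)
Definition good_reduction_at (W : weierstrass K) : Prop :=
  exists W', [/\ w_isom W W', minimal_model W' & ~ local_max (disc W')].

End AtPrime.

Definition everywhere_good_reduction (W : weierstrass K) : Prop :=
  forall P, finite_prime P -> good_reduction_at P W.

End GoodReduction.

(* Main.v *)
Require Import Defs.
From HB Require Import structures.
From mathcomp Require Import all_boot all_order all_algebra all_field.
From mathcomp Require Import ring lra zify.
From Stdlib Require Import Classical_Prop.

Set Implicit Arguments.
Unset Strict Implicit.
Unset Printing Implicit Defensive.
Import GRing.Theory Num.Theory Order.TTheory.
Local Open Scope ring_scope.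

(* Let disc E = delta^3, and let c4, c6 be the usual invariants. At every prime delta is a
   unit up to 4th powers. Hilbert 90 for elements whose norm is a square, together with
   norm equations that fail modulo small primes, then gives delta = +- eps^j l^4 with eps
   the fundamental unit of K = Q(sqrt m), on a model that is good above 2. Modulo 8 this
   forces a1 to be a unit above 2.

   From c4^3 - c6^2 = 1728 delta^3 one gets C (C^2 + 36 delta C + 432 delta^2) = c6^2 with
   C = c4 - 12 delta, so C is a square up to 3 and eps. For m = 67 this contradicts the
   residue of C modulo 8; for m = 71 it leaves 3 C = g^2, and then w = 3 c6 / g satisfies
   (w - 18 delta) (w + 18 delta) = 3 (C + 18 delta)^2, where w - 18 delta has a norm that is
   +- a square but is not +-1 modulo 8.

   For m = 62, x = c4 / delta is an integer, prime to 2, with r y^2 = x^3 - 1728 for some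
   r in {1, -1, 2, -2}. The line through such a point and its conjugate meets the curve in a
   rational point. If r <> 2, infinite descent shows that (12, 0) is the only rational
   point, whence N(x - 12) = 432, which is impossible modulo 3. If r = 2, a descent over
   Q(sqrt(-6)) and Q(sqrt(-93)), whose class groups have no 3-torsion, makes
   y / 2 + 6 sqrt(-6) a cube in K(sqrt(-6)); this yields an integer b with
   b^3 - x b + 16 = 0 and 2 b (b^3 + 64) a square. One of b and x - b^2 is a unit, and each
   of the finitely many square classes of this unit is impossible modulo a power of 2 or by
   a computation of norms. *)

(** * Diophantine equations over the rationals *)

(** The cube condition enters through the curve y^2 = x^3 - 1728 delta^3: the pair (c4, c6) lies on
    it, and it has the 2-torsion point (12 delta, 0) over K, which is where the factor C = c4 - 12
    delta comes from. The elements considered are squares up to units at almost all primes, so that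
    everything is a question about square classes of K. In all three fields 2 ramifies as the square
    of a principal ideal (pi) with pi^2 = 2 eps, and the square classes trivial outside 2 are
    generated by -1, eps and pi; residues modulo the odd prime p dividing m decide which norms
    occur.

    For m = 62 the twist r = 2 is the obstacle. After scaling it is y^2 = x^3 - 216, which contains
    (10, 28) over Q, so that rational points alone cannot exclude it: this point corresponds to x =
    20, and only the condition that x is prime to 2 rules it out. The 3-descent turns that condition
    into a statement on units. *)

Lemma sq_mod16 (x : int) : exists a : int,
  [\/ x ^+ 2 = 16 * a, x ^+ 2 = 16 * a + 4 | x ^+ 2 = 8 * a + 1].
Proof.
have [k xk] : exists k, [\/ x = 4 * k, x = 4 * k + 2 | x = 2 * k + 1].
  case: (boolP (2 %| x)%Z) => x2; last by exists (x %/ 2)%Z; apply: Or33; lia.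
  exists (x %/ 4)%Z; case: (boolP (4 %| x)%Z) => x4; last by apply: Or32; lia.
  by apply: Or31; lia.
case: xk => ->; first by exists (k ^+ 2); apply: Or31; ring.
  by exists (k ^+ 2 + k); apply: Or32; ring.
have [j [->|->]] : exists j, k = 2 * j \/ k = 2 * j + 1.
  by exists (k %/ 2)%Z; lia.
  by exists (2 * j ^+ 2 + j); apply: Or33; ring.
by exists (2 * j ^+ 2 + 3 * j + 1); apply: Or33; ring.
Qed.

Lemma odd_sq (x : int) : ~~ (2 %| x)%Z -> exists a : int, x ^+ 2 = 8 * a + 1.
Proof.
move=> x2; have [a xa] := sq_mod16 x; exists a.
have [k xk] : exists k, x = 2 * k + 1 by exists (x %/ 2)%Z; lia.
by case: xa => //; rewrite xk => ?; lia.
Qed.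

Lemma even_sq (x : int) : (2 %| x)%Z ->
  exists a : int, x ^+ 2 = 16 * a \/ x ^+ 2 = 16 * a + 4.
Proof.
move=> x2; have [a [] xa] := sq_mod16 x; [by exists a; left | by exists a; right|].
have : (2 %| x ^+ 2)%Z by rewrite expr2 dvdz_mulr.
by rewrite xa; lia.
Qed.

Lemma sq_mod3 (x : int) : exists a : int,
  ((3 %| x)%Z /\ x ^+ 2 = 9 * a) \/ (~~ (3 %| x)%Z /\ x ^+ 2 = 3 * a + 1).
Proof.
have [k xk] : exists k, [\/ x = 3 * k, x = 3 * k + 1 | x = 3 * k + 2].
  exists (x %/ 3)%Z.
  have : (x %% 3)%Z = 0 \/ (x %% 3)%Z = 1 \/ (x %% 3)%Z = 2 by lia.
  by case=> [?|[?|?]]; [apply: Or31|apply: Or32|apply: Or33]; lia.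
case: xk => E; rewrite E.
- by exists (k ^+ 2); left; split; [rewrite dvdz_mulr|ring].
- by exists (3 * k ^+ 2 + 2 * k); right; split; [lia | ring].
- by exists (3 * k ^+ 2 + 4 * k + 1); right; split; [lia | ring].
Qed.

Lemma prime_pow_split (p i x y : nat) : prime p -> coprime x y ->
  (p ^ i %| x * y)%N -> (p ^ i %| x)%N || (p ^ i %| y)%N.
Proof.
move=> pp cxy d; case: (boolP (p %| x)%N) => [px|npx].
  have : coprime (p ^ i) y.
    by apply: coprimeXl; apply: (coprime_dvdl px).
  by move=> c; rewrite Gauss_dvdl // in d; rewrite d.
rewrite -prime_coprime // in npx.
have c : coprime (p ^ i) x by apply: coprimeXl.
by rewrite Gauss_dvdr // in d; rewrite d orbT.
Qed.

(** The factors are recovered as gcds: gcd(x, e)^k = gcd(x^k, x y) = x gcd(x^(k-1), y) = x. *)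
Lemma coprime_mul_pow (k x y e : nat) : (0 < k)%N -> coprime x y ->
  (x * y = e ^ k)%N -> exists u v, [/\ (x = u ^ k)%N, (y = v ^ k)%N & (e = u * v)%N].
Proof.
move=> k0 cxy E; exists (gcdn x e), (gcdn y e).
have exp_gcd (a b : nat) : (gcdn a b ^ k = gcdn (a ^ k) (b ^ k))%N.
  elim: k k0 {E} => // n IH _; case: n IH => [|n] IH; first by rewrite !expn1.
  have [a0|a0] := posnP a.
    by rewrite a0 !(gcd0n, exp0n).
  have [b0|b0] := posnP b; first by rewrite b0 !(gcdn0, exp0n).
  set g := gcdn a b; have g0 : (0 < g)%N by rewrite gcdn_gt0 a0.
  have /dvdnP[a' Ea] := dvdn_gcdl a b; have /dvdnP[b' Eb] := dvdn_gcdr a b.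
  have cab : coprime a' b'.
    by rewrite /coprime -(eqn_pmul2r g0) muln_gcdl -Ea -Eb mul1n.
  have -> : (a ^ n.+2 = a' ^ n.+2 * g ^ n.+2)%N by rewrite {1}Ea expnMn.
  have -> : (b ^ n.+2 = b' ^ n.+2 * g ^ n.+2)%N by rewrite {1}Eb expnMn.
  rewrite -/g -muln_gcdl.
  have /eqP -> : coprime (a' ^ n.+2) (b' ^ n.+2) by rewrite coprimeXl // coprimeXr.
  by rewrite mul1n.
have H1 (a b : nat) : coprime a b -> (a * b = e ^ k)%N -> (a = gcdn a e ^ k)%N.
  move=> cab Eab; rewrite exp_gcd -Eab -(prednK k0) expnS -muln_gcdr.
  have /eqP -> : coprime (a ^ k.-1) b by rewrite coprimeXl.
  by rewrite muln1.
have xE := H1 x y cxy E.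
have yE : (y = gcdn y e ^ k)%N by apply: (H1 y x); rewrite ?(mulnC y) 1?coprime_sym.
split=> //; apply/eqP; rewrite -(eqn_exp2r _ _ k0) expnMn -xE -yE E; exact: eqxx.
Qed.

Lemma prime_dvdz_sq (p : nat) (x : int) : prime p -> (p %| x ^+ 2)%Z -> (p %| x)%Z.
Proof. by move=> pp; rewrite !dvdzE abszX Euclid_dvdX // andbT. Qed.

Lemma coprime_by_prime (a b : nat) : (0 < a)%N ->
  (forall p, prime p -> (p %| a)%N -> (p %| b)%N -> False) -> coprime a b.
Proof.
move=> a0 H; rewrite /coprime; apply/negPn/negP => g1.
have g_gt1 : (1 < gcdn a b)%N.
  by rewrite ltn_neqAle eq_sym g1 gcdn_gt0 a0.
apply: (H (pdiv (gcdn a b))); first exact: pdiv_prime.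
  exact: dvdn_trans (pdiv_dvd _) (dvdn_gcdl _ _).
exact: dvdn_trans (pdiv_dvd _) (dvdn_gcdr _ _).
Qed.

Lemma coprime_split (p i x y E : nat) : prime p -> coprime x y ->
  (x * y = p ^ i * E)%N ->
  (exists x', [/\ (x = p ^ i * x')%N, (x' * y = E)%N & coprime x' y]) \/
  (exists y', [/\ (y = p ^ i * y')%N, (x * y' = E)%N & coprime x y']).
Proof.
move=> pp cxy EE; have pi0 : (0 < p ^ i)%N by rewrite expn_gt0 prime_gt0.
have /(prime_pow_split pp cxy)/orP[] : (p ^ i %| x * y)%N by rewrite EE dvdn_mulr.
- case/dvdnP=> x' xE; left; exists x'; split; first by rewrite xE mulnC.
    by apply/eqP; rewrite -(eqn_pmul2l pi0) -EE xE mulnAC mulnC; apply/eqP; ring.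
  by apply: coprime_dvdl cxy; rewrite xE dvdn_mulr.
- case/dvdnP=> y' yE; right; exists y'; split; first by rewrite yE mulnC.
    by apply/eqP; rewrite -(eqn_pmul2l pi0) -EE yE; apply/eqP; ring.
  by apply: coprime_dvdr cxy; rewrite yE dvdn_mulr.
Qed.

Lemma coprime_mul_pow4 (x y e : nat) : coprime x y -> (x * y = e ^ 4)%N ->
  exists u v, [/\ (x = u ^ 4)%N, (y = v ^ 4)%N, (e = u * v)%N & coprime u v].
Proof.
move=> c E; have [u [v [xE yE eE]]] := coprime_mul_pow (isT : 0 < 4)%N c E.
by exists u, v; split=> //; move: c; rewrite xE yE coprime_pexpl // coprime_pexpr.
Qed.

Lemma split27 (x y e : nat) : coprime x y -> (x * y = 27 * e ^ 4)%N ->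
  exists u v, [/\ (e = u * v)%N, coprime u v &
    (x = 27 * u ^ 4 /\ y = v ^ 4)%N \/ (x = u ^ 4 /\ y = 27 * v ^ 4)%N].
Proof.
move=> c E.
have [[x' [-> E' c']]|[y' [-> E' c']]] := @coprime_split 3 3 x y _ isT c E;
  have [u [v [-> -> -> uv]]] := coprime_mul_pow4 c' E'; exists u, v; split=> //.
- by left.
- by right.
Qed.

Lemma split108 (x y e : nat) : coprime x y -> (x * y = 108 * e ^ 4)%N ->
  exists u v, [/\ (e = u * v)%N, coprime u v &
    [\/ (x = 108 * u ^ 4 /\ y = v ^ 4)%N, (x = 27 * u ^ 4 /\ y = 4 * v ^ 4)%N,
        (x = 4 * u ^ 4 /\ y = 27 * v ^ 4)%N | (x = u ^ 4 /\ y = 108 * v ^ 4)%N]].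
Proof.
move=> c E; have {}E : (x * y = 2 ^ 2 * (27 * e ^ 4))%N by rewrite E; lia.
have [[x' [-> E' c']]|[y' [-> E' c']]] := @coprime_split 2 2 x y _ isT c E;
  have [u [v [-> uv [[-> ->]|[-> ->]]]]] := split27 c' E'; exists u, v; split=> //.
- by apply: Or41; split=> //; lia.
- by apply: Or43.
- by apply: Or42.
- by apply: Or44; split=> //; lia.
Qed.

Lemma half_factors (N Q F : int) : ~~ (2 %| N)%Z -> ~~ (2 %| Q)%Z ->
  0 <= N -> 0 < F -> N ^+ 2 - Q ^+ 2 = 4 * F ->
  exists X Y : nat, [/\ N - Q = 2 * X%:Z, N + Q = 2 * Y%:Z, (0 < X)%N & X%:Z * Y%:Z = F].
Proof.
move=> N2 Q2 N0 F0 E.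
have /andP[NQ QN] : - N < Q < N.
  by rewrite -ltr_norml -(@ltr_pXn2r _ 2) ?nnegrE // real_normK ?num_real // -subr_gt0 E mulr_gt0.
exists (absz ((N - Q) %/ 2)%Z), (absz ((N + Q) %/ 2)%Z).
have XE : N - Q = 2 * (absz ((N - Q) %/ 2)%Z) by clear E; lia.
have YE : N + Q = 2 * (absz ((N + Q) %/ 2)%Z) by clear E; lia.
split=> //; first by clear E; lia.
by apply: (@mulfI _ (4 : int)) => //; rewrite -E; nia.
Qed.

(** [X] and [Y] are the halves of A - B and A + B. A prime dividing both divides [A], [B] and k u^4:
    parity and the condition on 3 exclude the primes of [k], the last hypothesis those of [u]. *)
Lemma coprime_halves (k : nat) (A B : int) (u : nat) : k = 27%N \/ k = 108%N ->
  ~~ (2 %| A)%Z -> ~~ (2 %| B)%Z -> ~~ (3 %| B)%Z -> 0 <= A -> (0 < u)%N ->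
  A ^+ 2 - B ^+ 2 = 4 * (k%:Z * u%:Z ^+ 4) ->
  (forall p : nat, prime p -> (p %| u)%N -> (p %| A)%Z -> (p %| B)%Z -> False) ->
  exists X Y : nat, [/\ coprime X Y, (X * Y = k * u ^ 4)%N, A = X%:Z + Y%:Z & B = Y%:Z - X%:Z].
Proof.
move=> kE A2 B2 B3 A0 u0 E H.
have k0 : (0 < k)%N by case: kE => ->.
have F0 : 0 < k%:Z * u%:Z ^+ 4 by rewrite mulr_gt0 ?exprn_gt0.
have [X [Y [XE YE X0 XYz]]] := half_factors A2 B2 A0 F0 E.
have XY : (X * Y = k * u ^ 4)%N by clear -XYz; lia.
have AE : A = X%:Z + Y%:Z by clear -XE YE; lia.
have BE : B = Y%:Z - X%:Z by clear -XE YE; lia.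
exists X, Y; split=> //; apply: coprime_by_prime => // p pp pX pY.
have pA : (p %| A)%Z by rewrite AE rpredD.
have pB : (p %| B)%Z by rewrite BE rpredB.
have : (p %| k * u ^ 4)%N by rewrite -XY dvdn_mulr.
rewrite Euclid_dvdM // (Euclid_dvdX u 4 pp) andbT => /orP[pk|pu]; last exact: H pp pu pA pB.
have p23 : p = 2%N \/ p = 3%N.
  have : (p %| 2 ^ 2 * 3 ^ 3)%N by case: kE pk => -> // pk; rewrite dvdn_mull.
  rewrite Euclid_dvdM // (Euclid_dvdX 2 2 pp) (Euclid_dvdX 3 3 pp) !andbT !dvdn_prime2 //.
  by case/orP => /eqP ->; [left|right].
case: p23 => p23; first by rewrite p23 (negbTE A2) in pA.
by rewrite p23 (negbTE B3) in pB.
Qed.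

Lemma prime_coprime_absurd (p a b : nat) :
  prime p -> coprime a b -> (p %| a)%N -> (p %| b)%N -> False.
Proof.
move=> pp /eqP cab pa pb; have : (p %| gcdn a b)%N by rewrite dvdn_gcd pa.
by rewrite cab dvdn1 => /eqP p1; rewrite p1 in pp.
Qed.

(** Descent through a 2-isogeny and its dual. Completing the square and factoring N^2 - Q^2 leads to
    M^2 = v^4 - 18 r u^2 v^2 - 27 u^4, a quartic for the 2-isogenous curve; the same operation
    applied to it leads back to the first quartic, with a proper divisor of [e] in place of [e]. *)
Lemma no_quartic1 (r : int) (M e N : nat) : r = 1 \/ r = -1 ->
  coprime M e -> ~~ (3 %| M)%N -> (0 < e)%N ->
  N%:Z ^+ 2 = M%:Z ^+ 4 + 9 * r * M%:Z ^+ 2 * e%:Z ^+ 2 + 27 * e%:Z ^+ 4 -> False.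
Proof.
move=> rE; have r2 : r ^+ 2 = 1 by case: rE => ->.
elim/ltn_ind: e M N => e IH M N cMe M3 e0 E.
have [M2 e2] : ~~ (2 %| M%:Z)%Z /\ (2 %| e%:Z)%Z.
  have := @prime_coprime_absurd 2 _ _ isT cMe; have [a aE] := sq_mod16 N.
  case: (boolP (2 %| M%:Z)%Z) => HM; case: (boolP (2 %| e%:Z)%Z) => He // H.
  - by case: (H HM He).
  - have [b bE] := even_sq HM; have [c cE] := odd_sq He.
    move: E; rewrite -[4%N]/(2 * 2)%N !exprM cE; clear -rE bE aE.
    by case: rE => ->; case: bE => ->; case: aE => ->; lia.
  - have [b bE] := odd_sq HM; have [c cE] := odd_sq He.
    move: E; rewrite -[4%N]/(2 * 2)%N !exprM cE bE; clear -rE aE.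
    by case: rE => ->; case: aE => ->; lia.
have M3z : ~~ (3 %| M%:Z)%Z by [].
have [e1 eE] : exists e1 : nat, e = (2 * e1)%N by exists (e %/ 2)%N; lia.
have e10 : (0 < e1)%N by clear -e0 eE; lia.
pose Q := M%:Z ^+ 2 + 18 * r * e1%:Z ^+ 2.
have NQ : N%:Z ^+ 2 - Q ^+ 2 = 4 * (27 * e1%:Z ^+ 4).
  have -> : N%:Z ^+ 2 - Q ^+ 2 = 108 * e1%:Z ^+ 4 + 324 * e1%:Z ^+ 4 * (1 - r ^+ 2).
    by rewrite E /Q (_ : e%:Z = 2 * e1%:Z); [ring|lia].
  by rewrite r2; ring.
have Q2 : ~~ (2 %| Q)%Z by have [a aE] := odd_sq M2; rewrite /Q aE; lia.
have N2 : ~~ (2 %| N%:Z)%Z.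
  apply/negP => H; have [a aE] := even_sq H; have [b bE] := odd_sq Q2.
  by move: NQ; rewrite bE; clear -aE; case: aE => ->; lia.
have Q3 : ~~ (3 %| Q)%Z.
  apply: contra M3z => Q3; apply: (@prime_dvdz_sq 3) => //.
  have -> : M%:Z ^+ 2 = Q - 3 * (6 * r * e1%:Z ^+ 2) by rewrite /Q; ring.
  by rewrite rpredB // dvdz_mulr.
have [X [Y [cXY XY NE QE]]] : exists X Y : nat,
    [/\ coprime X Y, (X * Y = 27 * e1 ^ 4)%N, N%:Z = X%:Z + Y%:Z & Q = Y%:Z - X%:Z].
  apply: (@coprime_halves 27) => //; first by left.
  move=> p pp pe _ pQ; apply: (@prime_coprime_absurd p _ _ pp cMe); last by rewrite eE dvdn_mull.
  apply: (@prime_dvdz_sq p M) => //.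
  have -> : M%:Z ^+ 2 = Q - e1%:Z * (18 * r * e1%:Z) by rewrite /Q; ring.
  by rewrite rpredB // dvdz_mulr.
have [u [v [e1E cuv]]] := split27 cXY XY.
have e1z : e1%:Z = u%:Z * v%:Z by rewrite e1E PoszM.
have /andP[u0 v0] : (0 < u)%N && (0 < v)%N by rewrite -muln_gt0 -e1E.
(* If 27 divides [Y] instead of [X], then 3 divides the sum of M^2 and a square, although it does
   not divide [M]. *)
case=> [[xE yE]|[xE yE]]; last first.
  have ME : M%:Z ^+ 2 + (u%:Z ^+ 2 + 9 * r * v%:Z ^+ 2) ^+ 2 = 108 * v%:Z ^+ 4.
    have -> : M%:Z ^+ 2 = Q - 18 * r * e1%:Z ^+ 2 by rewrite /Q; ring.
    have -> : Q = 27 * v%:Z ^+ 4 - u%:Z ^+ 4 by clear -QE xE yE; lia.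
    by rewrite e1z; clear -rE; case: rE => ->; ring.
  have [a [[]|[_ aE]]] := sq_mod3 M%:Z; first by rewrite (negbTE M3z).
  have [b [[_ bE]|[_ bE]]] := sq_mod3 (u%:Z ^+ 2 + 9 * r * v%:Z ^+ 2);
    by move: ME; rewrite aE bE; clear; lia.
pose Z := v%:Z ^+ 2 - 9 * r * u%:Z ^+ 2.
have ME : M%:Z ^+ 2 = Z ^+ 2 - 108 * u%:Z ^+ 4.
  have -> : M%:Z ^+ 2 = Q - 18 * r * e1%:Z ^+ 2 by rewrite /Q; ring.
  have -> : Q = v%:Z ^+ 4 - 27 * u%:Z ^+ 4 by clear -QE xE yE; lia.
  by rewrite /Z e1z; clear -rE; case: rE => ->; ring.
have [u2 v2] : (2 %| u%:Z)%Z /\ ~~ (2 %| v%:Z)%Z.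
  have := @prime_coprime_absurd 2 _ _ isT cuv.
  have [a aE] := odd_sq M2; move: ME; rewrite aE /Z -[4%N]/(2 * 2)%N !exprM.
  case: (boolP (2 %| u%:Z)%Z) => Hu; case: (boolP (2 %| v%:Z)%Z) => Hv // H H'.
  - by case: (H' Hu Hv).
  - have [b bE] := odd_sq Hu; have [c cE] := even_sq Hv.
    by move: H; rewrite bE; clear -rE cE; case: rE => ->; case: cE => ->; lia.
  - have [b bE] := odd_sq Hu; have [c cE] := odd_sq Hv.
    by move: H; rewrite bE cE; clear -rE; case: rE => ->; lia.
have Z2 : ~~ (2 %| `|Z|)%Z.
  rewrite dvdzE absz_id; have [c cE] := odd_sq v2; have [b bE] := even_sq u2.
  by rewrite -dvdzE /Z cE; clear -bE rE; case: rE => ->; case: bE => ->; lia.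
have Z3 : ~~ (3 %| Z)%Z.
  apply: contra M3z => Z3; apply: (@prime_dvdz_sq 3) => //.
  have -> : M%:Z ^+ 2 = Z * Z - 3 * (36 * u%:Z ^+ 4) by rewrite ME /Z; ring.
  by rewrite rpredB // dvdz_mulr.
have ZM : `|Z| ^+ 2 - M%:Z ^+ 2 = 4 * (27 * u%:Z ^+ 4).
  by rewrite real_normK ?num_real // ME /Z; ring.
have [X' [Y' [cXY' XY' ZE ME']]] : exists X Y : nat,
    [/\ coprime X Y, (X * Y = 27 * u ^ 4)%N, `|Z| = X%:Z + Y%:Z & M%:Z = Y%:Z - X%:Z].
  apply: (@coprime_halves 27) => //; first by left.
  move=> p pp pu; rewrite dvdzE absz_id -dvdzE => pZ _.
  apply: (@prime_coprime_absurd p _ _ pp cuv pu); apply: (@prime_dvdz_sq p v) => //.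
  have -> : v%:Z ^+ 2 = Z + u%:Z * (9 * r * u%:Z) by rewrite /Z; ring.
  by rewrite rpredD // dvdz_mulr.
have [p [q [uE cpq WE]]] : exists p q : nat, [/\ (u = p * q)%N, coprime q p &
    `|Z| = q%:Z ^+ 4 + 27 * p%:Z ^+ 4].
  have [p [q [uE cpq [[X'E Y'E]|[X'E Y'E]]]]] := split27 cXY' XY'.
    by exists p, q; split; rewrite 1?coprime_sym //; clear -X'E Y'E ZE; lia.
  by exists q, p; split; rewrite 1?mulnC //; clear -X'E Y'E ZE; lia.
have /andP[p0 q0] : (0 < p)%N && (0 < q)%N by rewrite -muln_gt0 -uE.
have uz : u%:Z = p%:Z * q%:Z by rewrite uE PoszM.
have vE : v%:Z ^+ 2 = Z + 9 * r * p%:Z ^+ 2 * q%:Z ^+ 2 by rewrite /Z uz; ring.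
(* The factorisation only determines the absolute value of [Z]. A negative [Z] would make v^2 the
   opposite of a value of the positive definite form q^4 - 9 r p^2 q^2 + 27 p^4. *)
have [Z0|Z0] := lerP 0 Z.
  apply: (IH p _ q v) => //.
  - have pu : (p <= u)%N by rewrite dvdn_leq // uE dvdn_mulr.
    have ue : (u <= e1)%N by rewrite dvdn_leq // e1E dvdn_mulr.
    by clear -e0 eE pu ue; lia.
  - apply: contra Z3 => q3.
    rewrite -[_ \in _]/(3 %| absz Z)%N -absz_id.
    have -> : (absz `|Z| = q ^ 4 + 3 * (9 * p ^ 4))%N by clear -WE; lia.
    by rewrite dvdn_add ?dvdn_mulr ?dvdn_exp.
  - by rewrite vE -(ger0_norm Z0) WE; ring.
have : v%:Z ^+ 2 < 0.
  rewrite vE -[Z]opprK -(ltr0_norm Z0) WE.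
  have p4 : 0 < p%:Z ^+ 4 by rewrite exprn_gt0.
  have := sqr_ge0 (2 * q%:Z ^+ 2 - 9 * r * p%:Z ^+ 2).
  by clear -p4 rE; case: rE => ->; lia.
by rewrite ltNge sqr_ge0.
Qed.

(** The same double descent for r = -2. The product of the halves is now 108 times a fourth power,
    so 4 and 27 can be distributed over them in four ways; congruences modulo powers of 2 and modulo
    3 leave the one that continues the descent. *)
Lemma no_quartic2 (M e N : nat) :
  coprime M e -> ~~ (3 %| M)%N -> (0 < e)%N ->
  N%:Z ^+ 2 = M%:Z ^+ 4 - 18 * M%:Z ^+ 2 * e%:Z ^+ 2 + 108 * e%:Z ^+ 4 -> False.
Proof.
elim/ltn_ind: e M N => e IH M N cMe M3 e0 E.
have [M2 e2] : ~~ (2 %| M%:Z)%Z /\ (2 %| e%:Z)%Z.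
  have := @prime_coprime_absurd 2 _ _ isT cMe; have [a aE] := sq_mod16 N.
  case: (boolP (2 %| M%:Z)%Z) => HM; case: (boolP (2 %| e%:Z)%Z) => He // H.
  - by case: (H HM He).
  - have [k kE] : exists k : int, M%:Z = 2 * k by exists (M %/ 2)%N; lia.
    have [c cE] := odd_sq He.
    have N2 : (2 %| N%:Z)%Z.
      apply: contraT => /odd_sq[d dE]; move: E; rewrite -[4%N]/(2 * 2)%N !exprM kE cE dE.
      by clear; lia.
    have [n nE] : exists n : int, N%:Z = 2 * n by exists (N %/ 2)%N; lia.
    have {}E : n ^+ 2 = 4 * (k ^+ 2) ^+ 2 - 18 * k ^+ 2 * e%:Z ^+ 2 + 27 * (e%:Z ^+ 2) ^+ 2.
      by apply: (@mulfI _ (4 : int)) => //; move: E; rewrite nE kE => E;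
        transitivity ((2 * n) ^+ 2); [ring | rewrite E; ring].
    have [f fE] := sq_mod16 n; have [g gE] := sq_mod16 k.
    by move: E; rewrite cE; clear -fE gE; case: fE => ->; case: gE => ->; lia.
  - have [b bE] := odd_sq HM; have [c cE] := odd_sq He.
    move: E; rewrite -[4%N]/(2 * 2)%N !exprM cE bE; clear -aE.
    by case: aE => ->; lia.
have M3z : ~~ (3 %| M%:Z)%Z by [].
have [e1 eE] : exists e1 : nat, e = (2 * e1)%N by exists (e %/ 2)%N; lia.
have e10 : (0 < e1)%N by clear -e0 eE; lia.
pose Q := M%:Z ^+ 2 - 36 * e1%:Z ^+ 2.
have NQ : N%:Z ^+ 2 - Q ^+ 2 = 4 * (108 * e1%:Z ^+ 4).
  by rewrite E /Q (_ : e%:Z = 2 * e1%:Z); [ring|lia].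
have Q2 : ~~ (2 %| Q)%Z by have [a aE] := odd_sq M2; rewrite /Q aE; lia.
have N2 : ~~ (2 %| N%:Z)%Z.
  apply/negP => H; have [a aE] := even_sq H; have [b bE] := odd_sq Q2.
  by move: NQ; rewrite bE; clear -aE; case: aE => ->; lia.
have Q3 : ~~ (3 %| Q)%Z.
  apply: contra M3z => Q3; apply: (@prime_dvdz_sq 3) => //.
  have -> : M%:Z ^+ 2 = Q + 3 * (12 * e1%:Z ^+ 2) by rewrite /Q; ring.
  by rewrite rpredD // dvdz_mulr.
have [X [Y [cXY XY NE QE]]] : exists X Y : nat,
    [/\ coprime X Y, (X * Y = 108 * e1 ^ 4)%N, N%:Z = X%:Z + Y%:Z & Q = Y%:Z - X%:Z].
  apply: (@coprime_halves 108) => //; first by right.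
  move=> p pp pe _ pQ; apply: (@prime_coprime_absurd p _ _ pp cMe); last by rewrite eE dvdn_mull.
  apply: (@prime_dvdz_sq p M) => //.
  have -> : M%:Z ^+ 2 = Q + e1%:Z * (36 * e1%:Z) by rewrite /Q; ring.
  by rewrite rpredD // dvdz_mulr.
have [u [v [e1E cuv uvE]]] := split108 cXY XY.
have e1z : e1%:Z = u%:Z * v%:Z by rewrite e1E PoszM.
have /andP[u0 v0] : (0 < u)%N && (0 < v)%N by rewrite -muln_gt0 -e1E.
have [a [[]|[_ aE]]] := sq_mod3 M%:Z; first by rewrite (negbTE M3z).
have MQ : M%:Z ^+ 2 = Q + 36 * u%:Z ^+ 2 * v%:Z ^+ 2 by rewrite /Q e1z; ring.
have {uvE} QE' : Q = v%:Z ^+ 4 - 108 * u%:Z ^+ 4.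
  case: uvE => -[xE yE].
  - by clear -QE xE yE; lia.
  - have {}QE : Q = 4 * v%:Z ^+ 4 - 27 * u%:Z ^+ 4 by clear -QE xE yE; lia.
    have [c cE] := odd_sq M2; move: MQ; rewrite QE cE -[4%N]/(2 * 2)%N !exprM.
    have [d dE] := sq_mod16 u; have [f fE] := sq_mod16 v.
    by clear -dE fE; case: dE => ->; case: fE => ->; lia.
  - have {}QE : Q = 27 * v%:Z ^+ 4 - 4 * u%:Z ^+ 4 by clear -QE xE yE; lia.
    have [d dE] := sq_mod3 u; move: MQ; rewrite QE aE -[4%N]/(2 * 2)%N !exprM.
    by clear -dE; case: dE => -[_ ->]; lia.
  - have {}QE : Q = 108 * v%:Z ^+ 4 - u%:Z ^+ 4 by clear -QE xE yE; lia.
    have [d dE] := sq_mod3 u; move: MQ; rewrite QE aE -[4%N]/(2 * 2)%N !exprM.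
    by clear -dE; case: dE => -[_ ->]; lia.
pose Z := v%:Z ^+ 2 + 18 * u%:Z ^+ 2.
have ZM : Z ^+ 2 - M%:Z ^+ 2 = 4 * (108 * u%:Z ^+ 4) by rewrite /Z MQ QE'; ring.
have Z2 : ~~ (2 %| Z)%Z.
  have [c cE] := odd_sq M2; have [d dE] := sq_mod16 Z; move: ZM.
  by rewrite cE; clear -dE; case: dE => E; lia.
have [X' [Y' [cXY' XY' ZE ME']]] : exists X Y : nat,
    [/\ coprime X Y, (X * Y = 108 * u ^ 4)%N, Z = X%:Z + Y%:Z & M%:Z = Y%:Z - X%:Z].
  apply: (@coprime_halves 108) => //; first by right.
  move=> p pp pu pZ _.
  apply: (@prime_coprime_absurd p _ _ pp cuv pu); apply: (@prime_dvdz_sq p v) => //.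
  have -> : v%:Z ^+ 2 = Z - u%:Z * (18 * u%:Z) by rewrite /Z; ring.
  by rewrite rpredB // dvdz_mulr.
have v2 : ~~ (2 %| v%:Z)%Z.
  by apply: contra Z2 => /even_sq[c cE]; rewrite /Z; clear -cE; case: cE => ->; lia.
have Z3 : ~~ (3 %| Z)%Z.
  apply: contra M3z => Z3; apply: (@prime_dvdz_sq 3) => //.
  have -> : M%:Z ^+ 2 = Z * Z - 3 * (144 * u%:Z ^+ 4) by rewrite -expr2 -[LHS](subKr (Z ^+ 2)) ZM; ring.
  by rewrite rpredB // dvdz_mulr.
have [p [q [uE cpq WE]]] : exists p q : nat, [/\ (u = p * q)%N, coprime q p &
    Z = q%:Z ^+ 4 + 108 * p%:Z ^+ 4 \/ Z = 4 * q%:Z ^+ 4 + 27 * p%:Z ^+ 4].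
  have [p [q [uE cpq [] [X'E Y'E]]]] := split108 cXY' XY'.
  - by exists p, q; split; rewrite 1?coprime_sym //; left; clear -X'E Y'E ZE; lia.
  - by exists p, q; split; rewrite 1?coprime_sym //; right; clear -X'E Y'E ZE; lia.
  - by exists q, p; split; rewrite 1?mulnC //; right; clear -X'E Y'E ZE; lia.
  - by exists q, p; split; rewrite 1?mulnC //; left; clear -X'E Y'E ZE; lia.
have /andP[p0 q0] : (0 < p)%N && (0 < q)%N by rewrite -muln_gt0 -uE.
have uz : u%:Z = p%:Z * q%:Z by rewrite uE PoszM.
have vE : v%:Z ^+ 2 = Z - 18 * q%:Z ^+ 2 * p%:Z ^+ 2 by rewrite /Z uz; ring.
case: WE => WE.
  apply: (IH p _ q v) => //.
  - have pu : (p <= u)%N by rewrite dvdn_leq // uE dvdn_mulr.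
    have ue : (u <= e1)%N by rewrite dvdn_leq // e1E dvdn_mulr.
    by clear -e0 eE pu ue; lia.
  - apply: contra Z3 => q3; rewrite WE (_ : _ + _ = q%:Z * q%:Z ^+ 3 + 3 * (36 * p%:Z ^+ 4)); last by ring.
    by rewrite rpredD ?dvdz_mulr.
  - by rewrite vE WE; ring.
have [c cE] := odd_sq v2; move: vE; rewrite WE cE -[4%N]/(2 * 2)%N !exprM.
have [d dE] := sq_mod16 p; have [f fE] := sq_mod16 q.
by clear -dE fE; case: dE => ->; case: fE => ->; lia.
Qed.

(** * Squarefree parts *)

Definition squarefree (k : nat) := forall p, prime p -> ~~ (p ^ 2 %| k)%N.

Lemma squarefree_decomp (n : nat) : (0 < n)%N ->
  exists k f : nat, [/\ n = (k * f ^ 2)%N, (0 < k)%N, (0 < f)%N & squarefree k].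
Proof.
elim/ltn_ind: n => n IH n0.
case: (boolP (has (fun p => p ^ 2 %| n)%N (primes n))) => [/hasP[p]|/hasPn H].
  rewrite mem_primes => /and3P[pp _ _] /dvdnP[k nE].
  have k0 : (0 < k)%N by move: n0; rewrite nE; case: k {nE}.
  have kn : (k < n)%N by rewrite nE ltn_Pmulr // -[1%N](exp1n 2) ltn_exp2r // prime_gt1.
  have [j [f [kE j0 f0 sj]]] := IH k kn k0.
  exists j, (f * p)%N; split=> //; first by rewrite nE kE expnMn mulnA.
  by rewrite muln_gt0 f0 prime_gt0.
exists n, 1%N; split=> //; first by rewrite exp1n muln1.
move=> p pp; apply/negP => d; have := H p; rewrite mem_primes pp n0 /=.
by rewrite (dvdn_trans _ d) ?dvdn_exp // d => /(_ isT).
Qed.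

Lemma squarefree_dvd_cofactor (k y z p : nat) : squarefree k -> prime p ->
  (k * y = z ^ 2)%N -> (p %| k)%N -> (p %| y)%N.
Proof.
move=> sk pp E pk; have p0 := prime_gt0 pp.
have pz : (p %| z)%N.
  have : (p %| z ^ 2)%N by rewrite -E dvdn_mulr.
  by rewrite Euclid_dvdX // andbT.
case/dvdnP: pk (sk p pp) => k1 kE; case/dvdnP: pz => z1 zE.
rewrite kE expnS expn1 dvdn_pmul2r // => nk1.
have : (k1 * y = p * z1 ^ 2)%N.
  by apply/eqP; rewrite -(eqn_pmul2l p0); apply/eqP; move: E; rewrite kE zE expnMn; lia.
move=> E1; have : (p %| k1 * y)%N by rewrite E1 dvdn_mulr.
by rewrite Euclid_dvdM // (negbTE nk1).
Qed.

Lemma squarefree_primes (k : nat) (P : seq nat) : (0 < k)%N -> squarefree k ->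
  (forall p, prime p -> (p %| k)%N -> p \in P) -> (k %| \prod_(p <- undup P) p)%N.
Proof.
move=> k0 sk H.
have -> : k = \prod_(p <- primes k) p.
  rewrite {1}(prod_prime_decomp k0) prime_decompE big_map /=.
  rewrite big_seq [RHS]big_seq; apply: eq_bigr => p; rewrite mem_primes => /and3P[pp _ pk].
  suff -> : logn p k = 1%N by rewrite expn1.
  apply/eqP; rewrite eqn_leq; apply/andP; split; last by rewrite logn_gt0 mem_primes pp k0.
  by rewrite leqNgt -pfactor_dvdn // sk.
have uP := undup_uniq P; have up := primes_uniq k.
have sub : {subset primes k <= undup P}.
  by move=> p; rewrite mem_undup mem_primes => /and3P[pp _ pk]; apply: H.
elim: (undup P) (primes k) uP up sub => [|q Q IH] S uP uS sub.
  by case: S uS sub => [|p S] // _ /(_ p); rewrite inE eqxx => /(_ isT).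
case/andP: uP => qQ uQ; rewrite big_cons.
case: (boolP (q \in S)) => qS.
  rewrite (perm_big _ (perm_to_rem qS)) big_cons dvdn_mul //.
  apply: IH => //; first exact: rem_uniq.
  by move=> p; rewrite mem_rem_uniq // => /andP[pq /sub]; rewrite inE (negbTE pq).
rewrite dvdn_mull //; apply: IH => // p pS.
by have := sub _ pS; rewrite inE => /orP[/eqP pq|//]; rewrite pq (negbTE qS) in pS.
Qed.

Lemma rat_sqr_int (q : rat) (n : int) : q ^+ 2 = n%:~R -> exists z : int, q = z%:~R.
Proof.
move=> E; exists (numq q).
have qE := divq_num_den q.
have d0 : (denq q)%:~R != 0 :> rat by rewrite intr_eq0 denq_neq0.
have {}E : numq q ^+ 2 = n * denq q ^+ 2.
  apply: (@intr_inj rat); rewrite [LHS]rmorphXn [RHS]rmorphM [in RHS]rmorphXn /= -E -{2}qE.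
  by field.
have : (denq q %| numq q ^+ 2)%Z by rewrite E expr2 mulrA dvdz_mull.
have : coprimez (denq q) (numq q ^+ 2) by rewrite coprimezXr // coprimezE coprime_sym coprime_num_den.
rewrite coprimezE dvdzE => c d.
have : (absz (denq q) %| 1)%N by rewrite -(eqP c) dvdn_gcd dvdnn.
by rewrite dvdn1 => /eqP d1; rewrite -{1}qE -absz_denq d1 divr1.
Qed.

Lemma rat_squarefree (q : rat) : q != 0 ->
  exists (k : nat) (s : bool) (n : rat), [/\ q = (-1) ^+ s * k%:R * n ^+ 2, (0 < k)%N, squarefree k & n != 0].
Proof.
move=> q0; have n0 : (0 < absz (numq q * denq q)%R)%N.
  by rewrite absz_gt0 mulf_neq0 ?numq_eq0 ?denq_neq0.
have [k [f [E k0 f0 sk]]] := squarefree_decomp n0.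
exists k, (q < 0), (f%:R / (denq q)%:~R); split=> //; last first.
  by rewrite mulf_neq0 ?invr_eq0 ?intr_eq0 ?denq_neq0 ?pnatr_eq0 -?lt0n.
have d0 : (denq q)%:~R != 0 :> rat by rewrite intr_eq0 denq_neq0.
have -> : (-1) ^+ (q < 0)%R * k%:R * (f%:R / (denq q)%:~R) ^+ 2 =
  (-1) ^+ (q < 0)%R * (k * f ^ 2)%N%:R / (denq q)%:~R ^+ 2 :> rat.
  by rewrite natrM natrX; field.
rewrite -E natr_absz.
have -> : (-1) ^+ (q < 0)%R * `|numq q * denq q|%:~R = (numq q)%:~R * (denq q)%:~R :> rat.
  rewrite normrM (gtr0_norm (denq_gt0 q)) intrM mulrA -(numq_lt0 q).
  by rewrite [in RHS](numEsign (numq q)) [in RHS]intrM rmorph_sign.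
by rewrite -{1}(divq_num_den q); field.
Qed.

Lemma sqr_dvd_split (f y z : nat) : (0 < f)%N -> (f ^ 2 * y = z ^ 2)%N ->
  exists z', (z = f * z')%N /\ (y = z' ^ 2)%N.
Proof.
move=> f0 E; have : (f ^ 2 %| z ^ 2)%N by rewrite -E dvdn_mulr.
rewrite dvdn_pexp2r // => /dvdnP[z' zE]; exists z'; split; first by rewrite mulnC.
by apply/eqP; rewrite -(@eqn_pmul2l (f ^ 2)) ?expn_gt0 ?f0 // E zE -expnMn mulnC.
Qed.

Lemma no_quartic (r : int) (M e N : nat) : [\/ r = 1, r = -1 | r = -2] ->
  coprime M e -> ~~ (3 %| M)%N -> (0 < e)%N ->
  N%:Z ^+ 2 = M%:Z ^+ 4 + 9 * r * M%:Z ^+ 2 * e%:Z ^+ 2 + 27 * r ^+ 2 * e%:Z ^+ 4 -> False.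
Proof.
move=> rE cMe M3 e0 E; case: rE => rE.
- by apply: (@no_quartic1 r M e N) => //; [left|rewrite E rE; ring].
- by apply: (@no_quartic1 r M e N) => //; [right|rewrite E rE; ring].
- by apply: (@no_quartic2 M e N) => //; rewrite E rE; ring.
Qed.

(** The point is c = A / B on w^2 = c (c^2 + 9 r c + 27 r^2). Since [B] is prime to A G, it is a
    square. Primes of the squarefree part of [A] divide 27 r^2, so this part is 1, which leaves a
    case of [no_quartic], or it is 2 with r = -2, which is impossible modulo 16. *)
Lemma curve_no_point_int (r : int) (A B G z : nat) : [\/ r = 1, r = -1 | r = -2] ->
  (0 < A)%N -> (0 < B)%N -> coprime A B -> ~~ (3 %| A)%N ->
  G%:Z = A%:Z ^+ 2 + 9 * r * A%:Z * B%:Z + 27 * r ^+ 2 * B%:Z ^+ 2 ->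
  (B * (A * G) = z ^ 2)%N -> False.
Proof.
move=> rE A0 B0 cAB A3 GE E.
have AG (p : nat) : prime p -> (p %| B)%N -> (p %| A)%N -> False.
  by move=> pp pB pA; apply: (@prime_coprime_absurd p A B).
have [k [e [BE k0 e0 sk]]] := squarefree_decomp B0.
have [z1 [_ z1E]] : exists z1, (z = e * z1)%N /\ (k * (A * G) = z1 ^ 2)%N.
  by apply: sqr_dvd_split => //; rewrite -E BE; lia.
have k1 : k = 1%N.
  apply/eqP; rewrite -dvdn1.
  have := @squarefree_primes k [::] k0 sk; rewrite big_nil; apply => p pp pk.
  have pB : (p %| B)%N by rewrite BE dvdn_mulr.
  have := squarefree_dvd_cofactor sk pp z1E pk; rewrite Euclid_dvdM // => /orP[|pG].
    by move/(AG p pp pB).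
  case: (AG p pp pB); apply: (@prime_dvdz_sq p A) => //.
  have -> : A%:Z ^+ 2 = G%:Z - B%:Z * (9 * r * A%:Z + 27 * r ^+ 2 * B%:Z) by rewrite GE; ring.
  by rewrite rpredB // dvdz_mulr.
rewrite {k sk k0}k1 mul1n in BE z1E.
have [k [f [AE k0 f0 sk]]] := squarefree_decomp A0.
have [z2 [_ z2E]] : exists z2, (z1 = f * z2)%N /\ (k * G = z2 ^ 2)%N.
  by apply: sqr_dvd_split => //; rewrite -z1E AE; lia.
have kp p : prime p -> (p %| k)%N -> r = -2 /\ p = 2%N.
  move=> pp pk; have pA : (p %| A)%N by rewrite AE dvdn_mulr.
  have pG := squarefree_dvd_cofactor sk pp z2E pk.
  have : (p %| 27 * r ^+ 2 * B%:Z ^+ 2)%Z.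
    have -> : 27 * r ^+ 2 * B%:Z ^+ 2 = G%:Z - A%:Z * (A%:Z + 9 * r * B%:Z) by rewrite GE; ring.
    by rewrite rpredB // dvdz_mulr.
  rewrite dvdzE !abszM !Euclid_dvdM // => /orP[|pB2]; last first.
    by case: (AG p pp) => //; move: pB2; rewrite ?Euclid_dvdM ?orbb.
  have p3 : (p %| 27)%N -> False.
    rewrite (Euclid_dvdX 3 3 pp) andbT dvdn_prime2 // => /eqP p3.
    by rewrite p3 (negbTE A3) in pA.
  case/orP => [/p3 //|pr2]; have {pr2} : (p %| absz r)%N by move: pr2; rewrite ?Euclid_dvdM ?orbb.
  case: rE => ->; rewrite ?dvdn1; try by move/eqP=> p1; rewrite p1 in pp.
  by rewrite dvdn_prime2 // => /eqP.
have cfe : coprime f e.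
  by move: cAB; rewrite AE BE coprimeMl coprime_pexpl // !coprime_pexpr // => /andP[_].
have f3 : ~~ (3 %| f)%N.
  by apply: contra A3 => d; rewrite AE dvdn_mull // dvdn_exp.
case: (boolP (r == -2)) => [/eqP r2|/eqP nr2].
  have kd : (k %| 2)%N.
    have := @squarefree_primes k [:: 2%N] k0 sk; rewrite big_seq1; apply => p pp pk.
    by have [_ ->] := kp p pp pk.
  have /orP[/eqP k1|/eqP k2] : (k == 1%N) || (k == 2%N).
    by case: k kd k0 {AE sk z2E kp} => [|[|[|k]]] // /dvdn_leq; lia.
    apply: (@no_quartic r f e z2) => //.
    have -> : z2%:Z ^+ 2 = G%:Z by move: z2E; rewrite k1; clear; lia.
    by rewrite GE AE BE k1; clear; lia.
  have e2 : ~~ (2 %| e%:Z)%Z.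
    apply/negP => e2; apply: (AG 2%N) => //; first by rewrite BE dvdn_exp.
    by rewrite AE k2 dvdn_mulr.
  have [c cE] := odd_sq e2; have [d dE] := sq_mod16 f; have [g gE] := sq_mod16 z2.
  have : z2%:Z ^+ 2 = 8 * ((f%:Z ^+ 2) ^+ 2 - 9 * f%:Z ^+ 2 * e%:Z ^+ 2 + 27 * (e%:Z ^+ 2) ^+ 2).
    have -> : z2%:Z ^+ 2 = 2 * G%:Z by move: z2E; rewrite k2; clear; lia.
    by rewrite GE AE BE k2 r2; clear; lia.
  by rewrite cE; clear -dE gE; case: dE => ->; case: gE => ->; lia.
have k1 : k = 1%N.
  apply/eqP; rewrite -dvdn1.
  have := @squarefree_primes k [::] k0 sk; rewrite big_nil; apply => p pp pk.
  by have [] := kp p pp pk.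
apply: (@no_quartic r f e z2) => //.
have -> : z2%:Z ^+ 2 = G%:Z by move: z2E; rewrite k1; clear; lia.
by rewrite GE AE BE k1; clear; lia.
Qed.

Lemma curve_no_point_rat (r a b : int) (w : rat) : [\/ r = 1, r = -1 | r = -2] ->
  0 < a -> 0 < b -> ~~ (3 %| a)%Z ->
  let c : rat := a%:~R / b%:~R in
  c * (c ^+ 2 + 9 * r%:~R * c + 27 * r%:~R ^+ 2) = w ^+ 2 -> False.
Proof.
move=> rE a0 b0 a3 c E.
pose A := absz (numq c); pose B := absz (denq c).
have c0 : 0 < c by rewrite divr_gt0 ?ltr0z.
have AE : A%:Z = numq c by rewrite gez0_abs // numq_ge0 ltW.
have BE : B%:Z = denq c by rewrite absz_denq.
have b0' : b%:~R != 0 :> rat by rewrite intr_eq0 gt_eqF.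
have B0 : (B%:Z)%:~R != 0 :> rat by rewrite BE intr_eq0 denq_neq0.
have cE : c = (A%:Z)%:~R / (B%:Z)%:~R by rewrite AE BE divq_num_den.
have A3 : ~~ (3 %| A)%N.
  apply: contra a3 => A3; have : numq c * b = a * denq c.
    apply: (@intr_inj rat); rewrite !intrM -AE -BE.
    by move: cE; rewrite {1}/c => /eqP; rewrite eqr_div // => /eqP ->.
  move=> NE; have : (3 %| a * denq c)%Z by rewrite -NE dvdz_mulr.
  rewrite Gauss_dvdzl // coprimezE; exact: coprime_dvdl A3 (coprime_num_den c).
pose Gz := A%:Z ^+ 2 + 9 * r * A%:Z * B%:Z + 27 * r ^+ 2 * B%:Z ^+ 2.
have G0 : 0 <= Gz.
  have GE : 4 * Gz = (2 * A%:Z + 9 * r * B%:Z) ^+ 2 + 27 * (r * B%:Z) ^+ 2 by rewrite /Gz; ring.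
  have G4 : 0 <= 4 * Gz by rewrite GE; apply: addr_ge0; [|apply: mulr_ge0 => //]; apply: sqr_ge0.
  by move: G4; rewrite pmulr_rge0.
have [z zE] : exists z : int, (B%:Z)%:~R ^+ 2 * w = z%:~R.
  apply: (@rat_sqr_int _ (B%:Z * (A%:Z * Gz))).
  by rewrite exprMn -E cE /Gz; field.
apply: (@curve_no_point_int r A B (absz Gz) (absz z)) => //.
- by rewrite absz_gt0 numq_eq0 gt_eqF.
- by rewrite absz_gt0 denq_neq0.
- exact: coprime_num_den.
- by rewrite gez0_abs.
have z2 : (absz z ^ 2)%N%:Z = z ^+ 2 by rewrite -abszX gez0_abs ?sqr_ge0.
apply/eqP; rewrite -eqz_nat z2 !PoszM gez0_abs //; apply/eqP; apply: (@intr_inj rat).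
by rewrite [RHS]rmorphXn /= -zE exprMn -E cE /Gz; field.
Qed.

(** The descent requires a numerator prime to 3. If 3 divides it exactly once or twice, the left
    side has odd valuation at 3. If 27 divides it, c is replaced by 27 r^2 / c, its translate by the
    2-torsion point (0, 0), whose numerator is prime to 3. *)
Lemma curve_no_point (r : int) (c w : rat) : [\/ r = 1, r = -1 | r = -2] ->
  c * (c ^+ 2 + 9 * r%:~R * c + 27 * r%:~R ^+ 2) = w ^+ 2 -> c = 0.
Proof.
move=> rE E; apply/eqP/negPn/negP => cn0.
have r0 : (r%:~R : rat) != 0 by case: rE => ->.
have c0 : 0 < c.
  have Q0 : 0 < c ^+ 2 + 9 * r%:~R * c + 27 * r%:~R ^+ 2.
    have r2 : 0 < r%:~R ^+ 2 :> rat by rewrite lt0r sqr_ge0 sqrf_eq0 r0.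
    have := sqr_ge0 (2 * c + 9 * r%:~R); lra.
  by rewrite lt0r cn0 -(pmulr_lge0 _ Q0) E sqr_ge0.
pose a := numq c; pose b := denq c.
have a0 : 0 < a by rewrite numq_gt0.
have b0 : 0 < b by rewrite denq_gt0.
have cE : c = a%:~R / b%:~R by rewrite divq_num_den.
have [a3|a3] := boolP (3 %| a)%Z; last first.
  by apply: (@curve_no_point_rat r a b w) => //; rewrite -cE.
have cab : ~~ (3 %| b)%Z.
  apply/negP => b3; have := coprime_num_den c; rewrite /coprime => /eqP g1.
  have : (3 %| gcdn (absz (numq c)) (absz (denq c)))%N by rewrite dvdn_gcd; apply/andP.
  by rewrite g1.
have [a' aE] : exists a', a = 3 * a' by exists (a %/ 3)%Z; lia.
have bn0 : b%:~R != 0 :> rat by rewrite intr_eq0 gt_eqF.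
have [z zE] : exists z : int, b%:~R ^+ 2 * w = z%:~R.
  apply: (@rat_sqr_int _ (b * (a * (a ^+ 2 + 9 * r * a * b + 27 * r ^+ 2 * b ^+ 2)))).
  by rewrite exprMn -E cE; field.
have {}zE : z ^+ 2 = b * (a * (a ^+ 2 + 9 * r * a * b + 27 * r ^+ 2 * b ^+ 2)).
  by apply: (@intr_inj rat); rewrite [LHS]rmorphXn /= -zE exprMn -E cE; field.
have p3 : prime 3 by [].
have r3 : ~~ (3 %| r)%Z by case: rE => ->.
have sq3 (x y : int) : x ^+ 2 = 3 * y -> exists x', 3 * x' ^+ 2 = y.
  move=> xy; have : (3 %| x)%Z by apply: (prime_dvdz_sq p3); rewrite xy dvdz_mulr.
  case/dvdzP=> x' xE; exists x'; apply: (@mulfI _ 3) => //.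
  by rewrite -xy xE; ring.
have no3 (x y : int) : (3 %| x * y)%Z -> (3 %| x)%Z \/ (3 %| y)%Z.
  by rewrite !dvdzE abszM Euclid_dvdM // => /orP[]; [left|right].
have [a'3|a'3] := boolP (3 %| a')%Z; last first.
  have : z ^+ 2 = 3 * (9 * (b * a' * (a' * a' + 3 * (r * a' * b + r * r * b * b)))) by rewrite zE aE; ring.
  case/sq3=> z1 z1E.
  have : z1 ^+ 2 = 3 * (b * a' * (a' * a' + 3 * (r * a' * b + r * r * b * b))) by clear -z1E; lia.
  case/sq3=> z2 z2E; have : (3 %| b * a' * (a' * a' + 3 * (r * a' * b + r * r * b * b)))%Z.
    by rewrite -z2E dvdz_mulr.
  case/no3 => [/no3[]|]; [by rewrite (negbTE cab) | by rewrite (negbTE a'3) |].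
  by rewrite (rpredDr _ (dvdz_mulr _ (dvdzz 3))) => /no3[]; rewrite (negbTE a'3).
have [a'' a'E] : exists a'', a' = 3 * a'' by exists (a' %/ 3)%Z; lia.
have [a''3|a''3] := boolP (3 %| a'')%Z; last first.
  have : z ^+ 2 = 3 * (81 * (b * a'' * (r * r * (b * b) + 3 * (a'' * a'' + r * a'' * b)))) by rewrite zE aE a'E; ring.
  case/sq3=> z1 z1E.
  have : z1 ^+ 2 = 3 * (9 * (b * a'' * (r * r * (b * b) + 3 * (a'' * a'' + r * a'' * b)))) by clear -z1E; lia.
  case/sq3=> z2 z2E.
  have : z2 ^+ 2 = 3 * (b * a'' * (r * r * (b * b) + 3 * (a'' * a'' + r * a'' * b))) by clear -z2E; lia.
  case/sq3=> z3 z3E; have : (3 %| b * a'' * (r * r * (b * b) + 3 * (a'' * a'' + r * a'' * b)))%Z.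
    by rewrite -z3E dvdz_mulr.
  case/no3 => [/no3[]|]; [by rewrite (negbTE cab) | by rewrite (negbTE a''3) |].
  by rewrite (rpredDr _ (dvdz_mulr _ (dvdzz 3))) => /no3[/no3[]|/no3[]]; rewrite ?(negbTE r3) ?(negbTE cab).
have [a3' a''E] : exists a3', a'' = 3 * a3' by exists (a'' %/ 3)%Z; lia.
have aE' : a = 27 * a3' by rewrite aE a'E a''E; ring.
apply: (@curve_no_point_rat r (r ^+ 2 * b) a3' (27 * r%:~R ^+ 2 * w / c ^+ 2)) => //.
- by rewrite mulr_gt0 // lt0r sqr_ge0 andbT sqrf_eq0; case: rE => ->.
- by clear -a0 aE'; lia.
- by apply/negP => /no3[/no3[]|]; rewrite ?(negbTE r3) ?(negbTE cab).
have a3'0 : a3'%:~R != 0 :> rat by rewrite intr_eq0; clear -a0 aE'; lia.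
have -> : (27 * r%:~R ^+ 2 * w / c ^+ 2) ^+ 2 = (27 * r%:~R ^+ 2 / c ^+ 2) ^+ 2 * w ^+ 2 by ring.
by rewrite -E cE aE'; field; rewrite ?r0 ?bn0 ?a3'0.
Qed.

(** * Binary quadratic forms and cubes in imaginary quadratic fields *)

Lemma form_small_value (A B C D : int) : 0 < A -> 0 < D -> A * C - B ^+ 2 = D ->
  exists X Y : int, let k := A * X ^+ 2 + 2 * B * X * Y + C * Y ^+ 2 in
    0 < k /\ 3 * k ^+ 2 <= 4 * D.
Proof.
move: {2}(absz A) (leqnn (absz A)) => N.
elim: N A B C => [|N IH] A B C AN A0 D0 E; first by lia.
(* Gauss reduction: a translation achieves |2 B'| <= A. If the new last coefficient is at least [A],
   then 4 D >= 3 A^2 and [A] is the value sought; otherwise exchanging the variables decreases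
   [A]. *)
pose t := - ((2 * B + A) %/ (2 * A))%Z; pose B' := B + t * A.
have Bt : - A <= 2 * B' <= A.
  have : 2 * B + A = ((2 * B + A) %/ (2 * A))%Z * (2 * A) + ((2 * B + A) %% (2 * A))%Z := divz_eq _ _.
  have A2 : 2 * A != 0 by rewrite mulf_neq0 // gt_eqF.
  have := modz_ge0 (2 * B + A) A2; have : ((2 * B + A) %% (2 * A))%Z < 2 * A by rewrite ltz_pmod // mulr_gt0.
  rewrite /B' /t; set u := (_ %/ _)%Z; set v := (_ %% _)%Z; clear -A0 u v => *; apply/andP; split; nia.
have [|CA] := lerP A (C + 2 * t * B + t ^+ 2 * A).
  move=> AC; exists 1, 0; set k := A * _ + _ + _.
  have -> : k = A by rewrite /k; ring.
  split=> //; have B2 : 4 * B' ^+ 2 <= A ^+ 2 by clear -Bt A0; nia.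
  have EB : A * (C + 2 * t * B + t ^+ 2 * A) - B' ^+ 2 = D by rewrite -E /B'; ring.
  have AA : A * A <= A * (C + 2 * t * B + t ^+ 2 * A) by rewrite ler_pM2l.
  by clear -AA B2 EB; lia.
have E' : (C + 2 * t * B + t ^+ 2 * A) * A - B' ^+ 2 = D by rewrite -E /B'; ring.
have C'0 : 0 < C + 2 * t * B + t ^+ 2 * A.
  have : 0 < (C + 2 * t * B + t ^+ 2 * A) * A by rewrite -[ltRHS](subrK (B' ^+ 2)) E' ltr_wpDr ?sqr_ge0.
  by rewrite pmulr_lgt0.
have [|X [Y [k0 k4]]] := IH _ B' A _ C'0 D0 E'; first by clear -AN CA A0 C'0; lia.
exists (Y + t * X), X; set k := A * _ + _ + _.
suff -> : k = (C + 2 * t * B + t ^+ 2 * A) * X ^+ 2 + 2 * B' * X * Y + A * Y ^+ 2 by [].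
by rewrite /k /B'; ring.
Qed.

(* u + v sqrt(-D) denotes the pair (u, v); the conclusion says that
   p + q sqrt(-D) is a cube in Q(sqrt(-D)). *)
Definition cube_in (D p q : rat) :=
  exists u v : rat, p = u ^+ 3 - 3 * D * u * v ^+ 2 /\ q = 3 * u ^+ 2 * v - D * v ^+ 3.

(* The ideal I = (n, p + q sqrt(-D)) has I^3 = (p + q sqrt(-D)); an element of I
   of smallest norm n k satisfies g^3 = (p + q sqrt(-D)) (x + y sqrt(-D)) with
   x^2 + D y^2 = k^3 and 3 k^2 <= 4 D. *)
Lemma coprime_cube_in (D p q n : int) : 0 < D -> 0 < n ->
  (forall k x y : int, 0 < k -> 3 * k ^+ 2 <= 4 * D -> x ^+ 2 + D * y ^+ 2 = k ^+ 3 ->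
    y = 0 /\ exists c : int, x = c ^+ 3) ->
  coprimez q n -> p ^+ 2 + D * q ^+ 2 = n ^+ 3 -> cube_in D%:~R p%:~R q%:~R.
Proof.
move=> D0 n0 H cqn E.
have [[q' l] /= bez] := coprimezP _ _ cqn; rewrite mulrC (mulrC l) in bez.
pose s := p * q'.
(* The general element of the ideal used is g = n (X + Y l sqrt(-D)) + Y q' (p + q sqrt(-D)). By the
   Bezout relation it equals n X + s Y + Y sqrt(-D), and its norm is n times the form with
   coefficients [n], [s], [C]. *)
pose C := q' ^+ 2 * n ^+ 2 + 2 * D * q * q' * l + D * n * l ^+ 2.
have CE : n * C - s ^+ 2 = D.
  have -> : n * C - s ^+ 2 = q' ^+ 2 * (n ^+ 3 - (p ^+ 2 + D * q ^+ 2)) + D * (q * q' + n * l) ^+ 2.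
    by rewrite /C /s; ring.
  by rewrite E subrr bez; ring.
have [X [Y [k0 k4]]] := form_small_value n0 D0 CE.
set k := _ + C * Y ^+ 2 in k0 k4.
pose gx := n * X + p * (Y * q'); pose gy := n * Y * l + q * (Y * q').
have gyY : gy = Y by rewrite /gy -[RHS]mulr1 -bez; ring.
pose g2 := Y * q'.
pose a := X ^+ 3 - 3 * D * X * Y ^+ 2 * l ^+ 2.
pose b := 3 * X ^+ 2 * Y * l - D * Y ^+ 3 * l ^+ 3.
(* [mx] and [my] are the coordinates of g^3 / (p + q sqrt(-D)), expanded with n^3 = (p + q sqrt(-D))
   (p - q sqrt(-D)); [a] and [b] are those of the cube of X + Y l sqrt(-D). *)
pose mx := p * a + D * q * b + 3 * n ^+ 2 * g2 * (X ^+ 2 - D * Y ^+ 2 * l ^+ 2)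
  + 3 * n * g2 ^+ 2 * (X * p - D * Y * l * q) + g2 ^+ 3 * (p ^+ 2 - D * q ^+ 2).
pose my := p * b - q * a + 3 * n ^+ 2 * g2 * (2 * X * Y * l)
  + 3 * n * g2 ^+ 2 * (X * q + Y * l * p) + g2 ^+ 3 * (2 * p * q).
have gE1 : gx ^+ 3 - 3 * D * gx * gy ^+ 2 = p * mx - D * q * my.
  have -> : gx ^+ 3 - 3 * D * gx * gy ^+ 2 = p * mx - D * q * my + (n ^+ 3 - (p ^+ 2 + D * q ^+ 2)) * a.
    by rewrite /gx /gy /mx /my /a /b /g2; ring.
  by rewrite E subrr mul0r addr0.
have gE2 : 3 * gx ^+ 2 * gy - D * gy ^+ 3 = p * my + q * mx.
  have -> : 3 * gx ^+ 2 * gy - D * gy ^+ 3 = p * my + q * mx + (n ^+ 3 - (p ^+ 2 + D * q ^+ 2)) * b.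
    by rewrite /gx /gy /mx /my /a /b /g2; ring.
  by rewrite E subrr mul0r addr0.
have Ng : gx ^+ 2 + D * gy ^+ 2 = n * k.
  by rewrite gyY /k -CE /gx /s; ring.
have Nm : mx ^+ 2 + D * my ^+ 2 = k ^+ 3.
  apply: (@mulfI _ (n ^+ 3)); first by rewrite expf_neq0 // gt_eqF.
  rewrite -exprMn -Ng -E.
  have -> : (gx ^+ 2 + D * gy ^+ 2) ^+ 3 = (gx ^+ 3 - 3 * D * gx * gy ^+ 2) ^+ 2 + D * (3 * gx ^+ 2 * gy - D * gy ^+ 3) ^+ 2 by ring.
  by rewrite gE1 gE2; ring.
have [my0 [c mxE]] := H k mx my k0 k4 Nm.
have c0 : c%:~R != 0 :> rat.
  rewrite intr_eq0; apply/eqP => c0; move: Nm; rewrite my0 mxE c0 => k30.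
  by move: (exprn_gt0 3 k0); rewrite -k30 !expr0n mulr0 addr0 ltxx.
exists (gx%:~R / c%:~R), (gy%:~R / c%:~R).
split; apply: (@mulIf _ (c%:~R ^+ 3)); rewrite ?expf_neq0 //.
  have -> : p%:~R * c%:~R ^+ 3 = (p * mx - D * q * my)%:~R :> rat by rewrite my0 mxE; ring.
  by rewrite -gE1; field.
have -> : q%:~R * c%:~R ^+ 3 = (p * my + q * mx)%:~R :> rat by rewrite my0 mxE; ring.
by rewrite -gE2; field.
Qed.

(** A finite search, which is where the absence of 3-torsion in the two class groups is verified. *)
Lemma small_norm_cubes (D : nat) (k x y : int) : D = 6%N \/ D = 93%N ->
  0 < k -> 3 * k ^+ 2 <= 4 * D%:Z ->
  x ^+ 2 + D%:Z * y ^+ 2 = k ^+ 3 -> y = 0 /\ exists c : int, x = c ^+ 3.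
Proof.
move=> DE k0 k4 E; pose K := absz k; pose X := absz x; pose Y := absz y.
have {}E : (X ^ 2 + D * Y ^ 2 = K ^ 3)%N.
  apply/eqP; rewrite -eqz_nat PoszD PoszM -!abszX !gez0_abs ?sqr_ge0 ?exprn_ge0 ?ltW //.
  exact/eqP.
have K11 : (0 < K <= 11)%N by rewrite /K; case: DE k4 => ->; nia.
have K1331 : (K ^ 3 <= 11 ^ 3)%N by rewrite leq_exp2r //; case/andP: K11.
have X36 : (X <= 36)%N.
  have XK : (X ^ 2 <= K ^ 3)%N by rewrite -E leq_addr.
  have : (X ^ 2 < 37 ^ 2)%N by apply: leq_ltn_trans XK _; apply: leq_ltn_trans K1331 _.
  by rewrite ltn_exp2r // ltnS.
have Y14 : (Y <= 14)%N.
  have YK : (6 * Y ^ 2 <= K ^ 3)%N.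
    by rewrite -E; apply: leq_trans (leq_addl _ _); rewrite leq_mul2r; case: DE => ->; rewrite orbT.
  have : (6 * Y ^ 2 < 6 * 15 ^ 2)%N.
    by apply: leq_ltn_trans YK _; apply: leq_ltn_trans K1331 _.
  by rewrite ltn_pmul2l // ltn_exp2r // ltnS.
pose chk D B := all (fun k => all (fun x => all (fun y => (x ^ 2 + D * y ^ 2 == k ^ 3)%N ==>
  (y == 0%N) && has (fun c => x == c ^ 3)%N (iota 0 4)) (iota 0 15)) (iota 0 37)) (iota 1 B).
(* The range of k has to depend on [D]: 17^2 + 6 * 3^2 = 7^3 is a nontrivial solution for D = 6,
   beyond the bound 2 that holds there. *)
have [B chkB KB] : exists2 B, chk D B & (0 < K <= B)%N.
  case: DE => DE; last by exists 11%N => //; rewrite DE; vm_compute.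
  exists 2%N; first by rewrite DE; vm_compute.
  by rewrite /K; move: k4; rewrite DE; clear -k0; nia.
move: chkB => /allP/(_ K); rewrite mem_iota add1n ltnS KB => /(_ isT).
move=> /allP/(_ X); rewrite mem_iota add0n ltnS X36 => /(_ isT).
move=> /allP/(_ Y); rewrite mem_iota add0n ltnS Y14 => /(_ isT).
rewrite E eqxx implyTb => /andP[/eqP Y0 /hasP[c _ /eqP XE]].
split; first by apply/eqP; rewrite -absz_eq0 -/Y Y0.
exists ((-1) ^+ (x < 0)%R * c%:Z); rewrite exprMn {1}(intEsign x) -/X XE.
by rewrite -signr_odd; case: (x < 0); rewrite /= ?expr0 ?expr1 -rmorphXn /=.
Qed.

Lemma rat_cubic_denominators (d : int) (x y : rat) : y ^+ 2 + d%:~R = x ^+ 3 ->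
  exists a b e : int, [/\ x = a%:~R / e%:~R ^+ 2, y = b%:~R / e%:~R ^+ 3, e != 0,
    coprimez a e & b ^+ 2 + d * e ^+ 6 = a ^+ 3].
Proof.
move=> E; pose X := denq x; pose Y := denq y.
have X0 : X != 0 by exact: denq_neq0.
have Y0 : Y != 0 by exact: denq_neq0.
have Xr : X%:~R != 0 :> rat by rewrite intr_eq0.
have Yr : Y%:~R != 0 :> rat by rewrite intr_eq0.
have {}E : (numq y ^+ 2 + d * Y ^+ 2) * X ^+ 3 = numq x ^+ 3 * Y ^+ 2.
  apply: (@intr_inj rat); rewrite rmorphM [RHS]rmorphM /= rmorphD /= !rmorphXn rmorphM /= rmorphXn /=.
  by rewrite !numqE -/X -/Y !exprMn -E; ring.
have cX : coprimez (numq x) X by exact: coprime_num_den.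
have cY : coprimez (numq y) Y by exact: coprime_num_den.
have YX : (Y ^+ 2 %| X ^+ 3)%Z.
  rewrite -(@Gauss_dvdzr _ (numq y ^+ 2 + d * Y ^+ 2)); first by rewrite E dvdz_mull.
  rewrite coprimezXl // (_ : _ + _ = d * Y * Y + numq y ^+ 2); last by ring.
  by rewrite /coprimez gcdzMDl -/(coprimez _ _) coprimezXr // coprimez_sym.
have XY : (X ^+ 3 %| Y ^+ 2)%Z.
  rewrite -(@Gauss_dvdzr _ (numq x ^+ 3)); first by rewrite -E dvdz_mull.
  by rewrite coprimezXl // coprimezXr // coprimez_sym.
have XYE : X ^+ 3 = Y ^+ 2.
  have : absz (X ^+ 3) = absz (Y ^+ 2) by apply/eqP; rewrite eqn_dvd -!dvdzE XY YX.
  have Xge0 : 0 <= X by exact: ltW (denq_gt0 x).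
  by move/(congr1 Posz); rewrite (gez0_abs (sqr_ge0 _)) gez0_abs ?exprn_ge0.
have /dvdzP[e YE] : (X %| Y)%Z.
  by rewrite dvdzE -(@dvdn_pexp2r _ _ 2) // -!abszX -dvdzE -XYE exprS dvdz_mull.
have XE : X = e ^+ 2.
  by apply: (@mulfI _ (X ^+ 2)); rewrite ?expf_neq0 // -exprSr XYE YE; ring.
have YE3 : Y = e ^+ 3 by rewrite YE XE; ring.
have e0 : e != 0 by apply: contra Y0 => /eqP e0; rewrite YE e0 mul0r.
exists (numq x), (numq y), e; split=> //.
- by rewrite -rmorphXn /= -XE divq_num_den.
- by rewrite -rmorphXn /= -YE3 divq_num_den.
- by move: cX; rewrite XE coprimez_pexpr.
apply: (@mulIf _ (X ^+ 3)); first by rewrite expf_neq0.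
rewrite [in RHS]XYE -E; congr (_ * _); rewrite YE3; ring.
Qed.

Lemma prime_dvdzM (p : nat) (x y : int) : prime p ->
  (p %| x * y)%Z = (p %| x)%Z || (p %| y)%Z.
Proof. by move=> pp; rewrite !dvdzE abszM Euclid_dvdM. Qed.

Lemma prime_dvdzX (p : nat) (x : int) (k : nat) : prime p ->
  (p %| x ^+ k.+1)%Z = (p %| x)%Z.
Proof. by move=> pp; rewrite !dvdzE abszX Euclid_dvdX // andbT. Qed.

Lemma coprimez_by_prime (a b : int) : a != 0 ->
  (forall p : nat, prime p -> (p %| a)%Z -> (p %| b)%Z -> False) -> coprimez a b.
Proof.
by move=> a0 H; apply: coprime_by_prime; [rewrite absz_gt0 | exact: H].
Qed.

Lemma coprimez_absurd (p : nat) (a b : int) :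
  prime p -> coprimez a b -> (p %| a)%Z -> (p %| b)%Z -> False.
Proof. by move=> pp; apply: prime_coprime_absurd. Qed.

(* The cube of sqrt(-D) times that of the unknown cube root: squaring y + D sqrt(-D)
   makes its content a cube, so that the coprime case applies to the square; and an
   element whose square is a cube is a cube. *)
Lemma cube_of_square (D x y : rat) : x != 0 -> y ^+ 2 + D ^+ 3 = x ^+ 3 ->
  cube_in D (y ^+ 2 - D ^+ 3) (2 * D * y) -> cube_in D y D.
Proof.
move=> x0 E [u [v [Eu Ev]]]; pose M := u ^+ 2 + D * v ^+ 2.
have M3 : M ^+ 3 = (y ^+ 2 + D ^+ 3) ^+ 2.
  have -> : M ^+ 3 = (u ^+ 3 - 3 * D * u * v ^+ 2) ^+ 2 + D * (3 * u ^+ 2 * v - D * v ^+ 3) ^+ 2.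
    by rewrite /M; ring.
  by rewrite -Eu -Ev; ring.
have M0 : M != 0.
  have : M ^+ 3 != 0 by rewrite M3 E -exprM expf_neq0.
  by rewrite expf_eq0.
exists ((y * u + D ^+ 2 * v) / M), ((D * u - y * v) / M).
split; apply: (@mulIf _ (M ^+ 3)); rewrite ?expf_neq0 //.
  rewrite {1}M3 (_ : _ * M ^+ 3 = (y ^+ 3 - 3 * D ^+ 3 * y) * (u ^+ 3 - 3 * D * u * v ^+ 2) +
    D * (3 * y ^+ 2 * D - D ^+ 4) * (3 * u ^+ 2 * v - D * v ^+ 3)); last by field.
  by rewrite -Eu -Ev; ring.
rewrite {1}M3 (_ : _ * M ^+ 3 = (3 * y ^+ 2 * D - D ^+ 4) * (u ^+ 3 - 3 * D * u * v ^+ 2) -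
    (y ^+ 3 - 3 * D ^+ 3 * y) * (3 * u ^+ 2 * v - D * v ^+ 3)); last by field.
by rewrite -Eu -Ev; ring.
Qed.

Lemma squarefree_dvd_sqr (g x : nat) : (0 < g)%N -> squarefree g ->
  (g %| x ^ 2)%N -> (g %| x)%N.
Proof.
move=> g0 sg gx; pose k := gcdn g x.
have k0 : (0 < k)%N by rewrite gcdn_gt0 g0.
have /dvdnP[g' gE] : (k %| g)%N by exact: dvdn_gcdl.
have /dvdnP[x' xE] : (k %| x)%N by exact: dvdn_gcdr.
have cgx : coprime g' x'.
  by rewrite /coprime -(eqn_pmul2r k0) muln_gcdl -gE -xE mul1n.
have gk : (g' %| k)%N.
  move: gx; rewrite gE xE expnMn (_ : x' ^ 2 * k ^ 2 = k * x' ^ 2 * k)%N; last by ring.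
  by rewrite dvdn_pmul2r // Gauss_dvdl // coprimeXr.
have g'1 : g' = 1%N.
  apply/eqP/negPn/negP => g1; have g'0 : (0 < g')%N by move: g0; rewrite gE muln_gt0 => /andP[].
  have pp : prime (pdiv g') by apply: pdiv_prime; rewrite ltn_neqAle eq_sym g1.
  have := sg _ pp; rewrite gE expnS expn1 dvdn_mul ?pdiv_dvd //.
  exact: dvdn_trans (pdiv_dvd _) gk.
by rewrite gE g'1 mul1n dvdn_gcdr.
Qed.

(** With g = gcd(a, D), D = g h and b = g^2 b', the square of y + D sqrt(-D) is the cube of g / e^2
    times (g b'^2 - h^3 e^6) + 2 h b' e^3 sqrt(-D), an element of norm a'^6. The coprime case
    applies to the latter because [a'] is odd and prime to [h], [b'] and [e]. *)
Lemma curve_point_cube (D : nat) (x y : rat) : D = 6%N \/ D = 93%N ->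
  y ^+ 2 + D%:R ^+ 3 = x ^+ 3 -> cube_in D%:R y D%:R.
Proof.
move=> DE E.
have x0 : x != 0.
  apply/eqP => x0; have := sqr_ge0 y; have : 0 < D%:R ^+ 3 :> rat by rewrite exprn_gt0 //; case: DE => ->.
  by move: E; rewrite x0 expr0n /=; lra.
apply: (cube_of_square x0 E).
have E' : y ^+ 2 + (D%:Z ^+ 3)%:~R = x ^+ 3 by rewrite rmorphXn.
have [a [b [e [xE yE e0 cae {}E']]]] := rat_cubic_denominators E'.
have er0 : e%:~R != 0 :> rat by rewrite intr_eq0.
have a0 : a != 0 by apply: contra x0 => /eqP a0; rewrite xE a0 mul0r.
have D0 : D%:Z != 0 by case: DE => ->.
have [g gD] : exists g, g = gcdz a D by eexists.
have [a' aE] : exists a', a = a' * g by apply/dvdzP; rewrite gD dvdz_gcdl.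
have [h hE] : exists h, D%:Z = h * g by apply/dvdzP; rewrite gD dvdz_gcdr.
have g0 : g != 0 by apply: contra D0 => /eqP gE; rewrite hE gE mulr0.
have cah : coprimez a' h.
  apply: coprimez_by_prime; first by apply: contra a0 => /eqP a'0; rewrite aE a'0 mul0r.
  move=> p pp /dvdzP[a'' a'E] /dvdzP[h' h'E].
  have : (p%:Z * g %| g)%Z.
    rewrite {1}gD dvdz_gcd aE hE a'E h'E -!mulrA.
    by apply/andP; split; apply: dvdz_mull; apply: dvdzz.
  case/dvdzP=> k gk; have k1 : k * p%:Z = 1 by apply: (mulIf g0); rewrite mul1r -mulrA.
  have : (p %| k * p%:Z)%Z by apply: dvdz_mull; apply: dvdzz.
  by rewrite k1 dvdzE dvdn1 => /eqP p1; move: pp; rewrite -[p]/(absz p) p1.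
have sg : squarefree (absz g).
  move=> p pp; apply/negP => pg.
  have : (p ^ 2 %| D)%N by rewrite -[D]/(absz D) hE abszM dvdn_mull.
  have pD : (p ^ 2 %| D)%N -> False.
    move=> pD; have : (p %| D)%N by apply: dvdn_trans pD; rewrite dvdn_exp.
    have p2 : (p ^ 2 <= D)%N by apply: dvdn_leq => //; case: DE => ->.
    have p9 : (p < 10)%N by rewrite -(@ltn_exp2r _ _ 2) //; apply: leq_ltn_trans p2 _; case: DE => ->.
    by case: DE pD => ->; case: p p9 pp {pg p2} => [|[|[|[|[|[|[|[|[|[|p]]]]]]]]]].
  exact: pD.
have g0' : (0 < absz g)%N by rewrite absz_gt0.
have sqg (z : int) : (g %| z ^+ 2)%Z -> (g %| z)%Z.
  by rewrite !dvdzE abszX; apply: squarefree_dvd_sqr.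
have bE2 : b ^+ 2 = g * (g ^+ 2 * (a' ^+ 3 - h ^+ 3 * e ^+ 6)).
  by rewrite -[LHS](addrK (D%:Z ^+ 3 * e ^+ 6)) E' aE hE; ring.
have /dvdzP[b1 bE] : (g %| b)%Z by apply: sqg; rewrite bE2 dvdz_mulr.
have b1E2 : b1 ^+ 2 = g * (a' ^+ 3 - h ^+ 3 * e ^+ 6).
  by apply: (@mulIf _ (g ^+ 2)); rewrite ?expf_neq0 // -exprMn -bE bE2; ring.
have /dvdzP[b' b1E] : (g %| b1)%Z by apply: sqg; rewrite b1E2 dvdz_mulr.
have star : g * b' ^+ 2 + h ^+ 3 * e ^+ 6 = a' ^+ 3.
  apply: (@mulfI _ g) => //; rewrite mulrDr -[RHS](subrK (g * (h ^+ 3 * e ^+ 6))) -mulrBr -b1E2 b1E.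
  by ring.
have ca'e : coprimez a' e by move: cae; rewrite aE coprimezMl => /andP[].
have a'0 : a' != 0 by apply: contra a0 => /eqP a'0; rewrite aE a'0 mul0r.
(* If [a'] is even, [e] and [h] are odd. For D = 6 the factor [g] is then even and [star] fails
   modulo 2. For D = 93 it gives g = -h modulo 8, so that D = g h = -h^2 = -1, whereas 93 = 5 modulo
   8. *)
have a'2 : ~~ (2 %| a')%Z.
  apply/negP => a2; have e2 : ~~ (2 %| e)%Z by apply/negP => e2; apply: (@coprimez_absurd 2 a' e).
  have h2 : ~~ (2 %| h)%Z by apply/negP => h2; apply: (@coprimez_absurd 2 a' h).
  have [c a'E] : exists c, a' = 2 * c by exists (a' %/ 2)%Z; clear -a2; lia.
  have [i eE] := odd_sq e2; have [j hE2] := odd_sq h2.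
  have h8 : exists k, h ^+ 3 * e ^+ 6 = h + 8 * k.
    exists (h * (j + (8 * j + 1) * (3 * i + 24 * i ^+ 2 + 64 * i ^+ 3))).
    have -> : h ^+ 3 * e ^+ 6 = h * h ^+ 2 * (e ^+ 2) ^+ 3 by ring.
    by rewrite eE hE2; ring.
  move: star; have [k ->] := h8; rewrite a'E => star.
  case: DE => DE.
    have g2 : (2 %| g)%Z.
      have : (2 %| h * g)%Z by rewrite -hE DE.
      by rewrite (@prime_dvdzM 2) // (negbTE h2).
    have [g' gE] : exists g', g = 2 * g' by exists (g %/ 2)%Z; clear -g2; lia.
    by move: star h2; rewrite gE; clear; lia.
  have g2 : ~~ (2 %| g)%Z.
    apply/negP => g2; have : (2 %| h * g)%Z by rewrite dvdz_mull.
    by rewrite -hE DE.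
  have b2 : ~~ (2 %| b')%Z.
    apply/negP => b2; have [f bfE] : exists f, b' = 2 * f by exists (b' %/ 2)%Z; clear -b2; lia.
    by move: star h2; rewrite bfE; clear; lia.
  have [f bfE] := odd_sq b2; move: star; rewrite bfE => star.
  have gh : g = - h + 8 * (c ^+ 3 - g * f - k) by clear -star; lia.
  have : h * g = - (h ^+ 2) + 8 * (h * (c ^+ 3 - g * f - k)) by rewrite {1}gh; ring.
  by rewrite -hE DE hE2; clear; lia.
have cb : coprimez b' a'.
  rewrite coprimez_sym; apply: coprimez_by_prime => // p pp pa pb.
  have : (p %| h ^+ 3 * e ^+ 6)%Z.
    have -> : h ^+ 3 * e ^+ 6 = a' * a' ^+ 2 - b' * (g * b') by rewrite -exprS -star; ring.
    by rewrite rpredB // dvdz_mulr.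
  rewrite prime_dvdzM // !prime_dvdzX // => /orP[ph|pe].
    exact: (@coprimez_absurd p a' h).
  exact: (@coprimez_absurd p a' e).
have cQ : coprimez (2 * h * b' * e ^+ 3) (a' ^+ 2).
  rewrite coprimezXr // !coprimezMl cb (coprimez_sym h) cah (coprimez_sym e) ca'e.
  by rewrite !andbT coprimezE prime_coprime.
have NP : (g * b' ^+ 2 - h ^+ 3 * e ^+ 6) ^+ 2 + D%:Z * (2 * h * b' * e ^+ 3) ^+ 2 = (a' ^+ 2) ^+ 3.
  by rewrite -exprM mulnC exprM -star hE; ring.
have Dpos : 0 < D%:Z by case: DE => ->.
have a'2pos : 0 < a' ^+ 2 by rewrite lt0r sqr_ge0 andbT expf_neq0.
have [u [v [uE vE]]] := coprime_cube_in Dpos a'2pos (fun k x y => @small_norm_cubes D k x y DE) cQ NP.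
have hr : D%:R = h%:~R * g%:~R :> rat by rewrite -intrM -hE.
exists (u * (g%:~R / e%:~R ^+ 2)), (v * (g%:~R / e%:~R ^+ 2)); split.
  have -> : y ^+ 2 - D%:R ^+ 3 = (g%:~R / e%:~R ^+ 2) ^+ 3 * (g * b' ^+ 2 - h ^+ 3 * e ^+ 6)%:~R.
    by rewrite yE bE b1E hr; field.
  by rewrite uE; ring.
have -> : 2 * D%:R * y = (g%:~R / e%:~R ^+ 2) ^+ 3 * (2 * h * b' * e ^+ 3)%:~R.
  by rewrite yE bE b1E hr; field.
by rewrite vE; ring.
Qed.

(* The solutions form a single orbit under the unit (29 + 3 sqrt 93) / 2, whose
   action preserves u modulo 3. *)
Lemma pell_31_3 (w u : int) : 31 * w ^+ 2 - 3 * u ^+ 2 = 4 -> (3 %| u)%Z.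
Proof.
have nonneg : forall n : nat, forall v : int, 0 <= v ->
    31 * n%:Z ^+ 2 - 3 * v ^+ 2 = 4 -> (3 %| v)%Z.
  elim/ltn_ind=> n IH v v0 E.
  have [n1|n1] := leqP n 1.
    have nE : n = 1%N by case: n n1 E {IH} => [|[|n]] // _; clear -v0; nia.
    have : v = 3 by rewrite nE in E; clear -v0 E; nia.
    by move=> ->.
  have par : (2 %| n%:Z - v)%Z.
    have [a aE] := sq_mod16 n; have [b bE] := sq_mod16 v.
    case: (boolP (2 %| n%:Z)%Z) => Hn; case: (boolP (2 %| v)%Z) => Hv; try by clear -Hn Hv; lia.
      have [c cE] := even_sq Hn; have [d dE] := odd_sq Hv.
      by move: E; rewrite dE; clear -cE; case: cE => ->; lia.
    have [c cE] := odd_sq Hn; have [d dE] := even_sq Hv.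
    by move: E; rewrite cE; clear -dE; case: dE => ->; lia.
  have [k kE] : exists k, n%:Z - v = 2 * k by exists ((n%:Z - v) %/ 2)%Z; clear -par; lia.
  pose w' := 10 * n%:Z + 9 * k; pose v' := 29 * k.
  have w'E : 2 * (10 * n%:Z + 9 * k) = 29 * n%:Z - 9 * v by clear -kE; lia.
  have v'E : 2 * (- 32 * n%:Z - 29 * k) = 29 * v - 93 * n%:Z by clear -kE; lia.
  have n9 : 9 * v < 29 * n%:Z by clear -E v0 n1; nia.
  have n3 : 3 * n%:Z < v by clear -E v0 n1; nia.
  have [n' n'E] : exists n' : nat, 10 * n%:Z + 9 * k = n'%:Z.
    by exists (absz (10 * n%:Z + 9 * k)%R); clear -n9 w'E; lia.
  have E4 : 31 * (2 * n'%:Z) ^+ 2 - 3 * (29 * v - 93 * n%:Z) ^+ 2 = 16.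
    by rewrite -n'E w'E (_ : 16 = 4 * 4) // -{2}E; ring.
  have E' : 31 * n'%:Z ^+ 2 - 3 * (- 32 * n%:Z - 29 * k) ^+ 2 = 4.
    by move: E4; rewrite -v'E; clear; lia.
  have n'n : (n' < n)%N by clear -n'E w'E n3; lia.
  have : (3 %| `|- 32 * n%:Z - 29 * k|%R)%Z.
    by apply: (IH n' n'n) => //; rewrite real_normK ?num_real.
  by rewrite !dvdzE absz_id; clear -v'E; lia.
move=> E; have : (3 %| `|u|%R)%Z.
  apply: (nonneg (absz w)) => //; rewrite real_normK ?num_real //.
  by rewrite -abszE real_normK ?num_real.
by rewrite !dvdzE absz_id.
Qed.

(** This serves the case r = -2 with x rational and y in Q sqrt(62). The factors 12 - x and x^2 + 12
    x + 144 share at most the primes 2 and 3, so the squarefree part of 12 - x divides 93; powers of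
    2 exclude every divisor but 3. *)
Lemma no_integral_point_31 (x : int) (q : rat) : ~~ (2 %| x)%Z ->
  31 * q ^+ 2 = (1728 - x ^+ 3)%:~R -> False.
Proof.
move=> x2 E; pose Yz := 12 - x.
pose Gz := Yz ^+ 2 - 36 * Yz + 432.
have G0 : 0 < Gz.
  have -> : Gz = (Yz - 18) ^+ 2 + 108 by rewrite /Gz; ring.
  by rewrite ltr_wpDl ?sqr_ge0.
have [z zE] : exists z : int, 31 * q = z%:~R.
  apply: (@rat_sqr_int _ (31 * (1728 - x ^+ 3))).
  by rewrite rmorphM /= -E; ring.
have {}zE : Yz * (31 * Gz) = z ^+ 2.
  apply: (@intr_inj rat); rewrite [RHS]rmorphXn /= -zE (_ : Yz * _ = 31 * (1728 - x ^+ 3)); last first.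
    by rewrite /Gz /Yz; ring.
  by rewrite rmorphM /= -E; ring.
clear E; have Y2 : ~~ (2 %| Yz)%Z by rewrite /Yz; clear -x2; lia.
have Y0 : 0 < Yz.
  have Yn0 : Yz != 0 by apply: contra Y2 => /eqP ->.
  rewrite lt0r Yn0 -(@pmulr_lge0 _ (31 * Gz)) ?zE ?sqr_ge0 //.
  by rewrite mulr_gt0.
pose Y := absz Yz; pose G := absz Gz; pose Z := absz z.
have YE : Y%:Z = Yz by rewrite gez0_abs // ltW.
have GE : G%:Z = Yz ^+ 2 - 36 * Yz + 432 by rewrite gez0_abs // ltW.
have Y0n : (0 < Y)%N by rewrite absz_gt0 gt_eqF.
have YZ : (Y * (31 * G) = Z ^ 2)%N.
  by rewrite /Y /G /Z -abszX -zE !abszM.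
have [k [f [Ykf k0 f0 sk]]] := squarefree_decomp Y0n.
have [z' [_ z'E]] : exists z', (Z = f * z')%N /\ (k * (31 * G) = z' ^ 2)%N.
  by apply: sqr_dvd_split => //; rewrite -YZ Ykf; clear; lia.
have kd : (k %| 93)%N.
  have := @squarefree_primes k [:: 3; 31]%N k0 sk; rewrite /= !big_cons big_nil.
  apply=> p pp pk; have pY : (p %| Yz)%Z by rewrite -YE Ykf PoszM; apply: dvdz_mulr.
  have := squarefree_dvd_cofactor sk pp z'E pk.
  rewrite Euclid_dvdM // (@dvdn_prime2 p 31) // => /orP[/eqP ->//|pG].
  have : (p %| (2 ^ 4 * 3 ^ 3)%N%:Z)%Z.
    have -> : (2 ^ 4 * 3 ^ 3)%N%:Z = G%:Z - Yz * (Yz - 36) by rewrite GE; ring.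
    by rewrite rpredB // dvdz_mulr.
  rewrite dvdzE absz_nat Euclid_dvdM // !Euclid_dvdX // !andbT !dvdn_prime2 //.
  case/orP => /eqP p23; last by rewrite p23.
  by rewrite p23 (negbTE Y2) in pY.
have Yz' : Yz = k%:Z * f%:Z ^+ 2 by rewrite -YE Ykf PoszM.
have f2 : ~~ (2 %| f%:Z)%Z.
  apply: contra Y2 => f2; rewrite Yz'; apply: dvdz_mull; rewrite expr2; exact: dvdz_mulr.
have [c cE] := odd_sq f2; have [d dE] := sq_mod16 z'.
have z'2 : z'%:Z ^+ 2 = k%:Z * (31 * ((k%:Z * f%:Z ^+ 2) ^+ 2 - 36 * (k%:Z * f%:Z ^+ 2) + 432)).
  by rewrite -Yz' -GE; move: z'E; clear; lia.
have : k \in [:: 1; 3; 31; 93]%N by rewrite -[[:: _; _; _; _]]/(divisors 93) -dvdn_divisors.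
rewrite !inE => /or4P[] /eqP kE; move: z'2; rewrite kE.
- by rewrite cE; clear -dE; case: dE => ->; lia.
- move=> z'2; have : 31 * (27 * ((f%:Z ^+ 2) ^+ 2 - 12 * f%:Z ^+ 2 + 48)) = z'%:Z * z'%:Z by rewrite -expr2 z'2; ring.
  have p31 (t : int) : (31 %| t * t)%Z -> (31 %| t)%Z by rewrite (@prime_dvdzM 31) // orbb.
  have p3 (t : int) : (3 %| t * t)%Z -> (3 %| t)%Z by rewrite (@prime_dvdzM 3) // orbb.
  move=> zz; have z31 : (31 %| z'%:Z)%Z by apply: p31; rewrite -zz; apply: dvdz_mulr.
  have [z1 z1E] : exists z1, z'%:Z = 31 * z1 by exists (z'%:Z %/ 31)%Z; clear -z31; lia.
  have zz1 : 27 * ((f%:Z ^+ 2) ^+ 2 - 12 * f%:Z ^+ 2 + 48) = 31 * (z1 * z1) by move: zz; rewrite z1E; clear; lia.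
  have z13 : (3 %| z1)%Z by apply: p3; clear -zz1; lia.
  have [z2 z2E] : exists z2, z1 = 3 * z2 by exists (z1 %/ 3)%Z; clear -z13; lia.
  have zz2 : 3 * ((f%:Z ^+ 2) ^+ 2 - 12 * f%:Z ^+ 2 + 48) = 31 * (z2 * z2) by move: zz1; rewrite z2E; clear; lia.
  have z23 : (3 %| z2)%Z by apply: p3; clear -zz2; lia.
  have [w wE] : exists w, z2 = 3 * w by exists (z2 %/ 3)%Z; clear -z23; lia.
  have zz3 : (f%:Z * f%:Z) ^+ 2 - 12 * (f%:Z * f%:Z) + 48 = 93 * w ^+ 2 by move: zz2; rewrite wE; clear; lia.
  have f3 : (3 %| f%:Z)%Z by apply/p3/p3; clear -zz3; lia.
  have [t tE] : exists t, f%:Z = 3 * t by exists (f%:Z %/ 3)%Z; clear -f3; lia.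
  (* With f = 3 t the equation has become 31 w^2 - 3 (3 t^2 - 2)^2 = 4. *)
  have : (3 %| 3 * t ^+ 2 - 2)%Z.
    by apply: (@pell_31_3 w); move: zz3; rewrite tE; clear; lia.
  by clear; lia.
- by rewrite cE; clear -dE; case: dE => ->; lia.
- by rewrite cE; clear -dE; case: dE => ->; lia.
Qed.

(** * Norm equations modulo a prime *)

Definition nonresidue (l : nat) (a : int) := forall t : int, ~~ (l %| t ^+ 2 + a)%Z.

Lemma nonresidue_check (l : nat) (a : int) : (0 < l)%N ->
  all (fun t : nat => ~~ (l %| t%:Z ^+ 2 + a)%Z) (iota 0 l) -> nonresidue l a.
Proof.
move=> l0 /allP H t; have l0' : l%:Z != 0 by rewrite -lt0n.
have := H (absz (t %% l)%Z); rewrite mem_iota add0n gez0_abs ?modz_ge0 //.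
have -> : (absz (t %% l)%Z < l)%N by rewrite -ltz_nat gez0_abs ?modz_ge0 // ltz_pmod.
move=> /(_ isT); apply: contra => d.
have -> : (t %% l)%Z ^+ 2 + a = (t ^+ 2 + a) - l%:Z * ((t %/ l)%Z * (t + (t %% l)%Z)).
  have := divz_eq t l; move: (t %/ l)%Z (t %% l)%Z => u v ->; ring.
by rewrite rpredB // dvdz_mulr.
Qed.

(** Infinite descent: as -a is not a square modulo [l], both [n] and [p] are divisible by [l], hence
    so is [q], and the common factor cancels. *)
Lemma no_norm_int (l : nat) (a c p n q : int) : prime l -> nonresidue l a -> ~~ (l %| c)%Z ->
  p ^+ 2 + a * n ^+ 2 = l%:Z * c * q ^+ 2 -> [/\ p = 0, n = 0 & q = 0].
Proof.
move=> pl nr lc; have l0 : l%:Z != 0 by rewrite -lt0n prime_gt0.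
move: {2}(_ + _ + _)%N (leqnn (absz p + absz n + absz q)) => N.
elim: N p n q => [|N IH] p n q Npnq E.
  by move: Npnq; rewrite leqn0 !addn_eq0 !absz_eq0 => /andP[/andP[/eqP -> /eqP ->] /eqP ->].
have ln : (l %| n)%Z.
  apply: contraT => ln; have cln : coprimez l n by rewrite coprimezE prime_coprime.
  have [[u v] /= bez] := coprimezP _ _ cln.
  have /negP[] := nr (v * p).
  have -> : (v * p) ^+ 2 + a = l%:Z * (v ^+ 2 * c * q ^+ 2 + a * (u * (1 + v * n))).
    have -> : l%:Z * (v ^+ 2 * c * q ^+ 2 + a * (u * (1 + v * n))) =
      v ^+ 2 * (l%:Z * c * q ^+ 2) + a * ((u * l%:Z) * (1 + v * n)) by ring.
    have -> : u * l%:Z = 1 - v * n by rewrite -bez; ring.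
    by rewrite -E; ring.
  exact: dvdz_mulr.
have lp : (l %| p)%Z.
  rewrite -(@prime_dvdzX l p 1) // (_ : p ^+ 2 = l%:Z * (c * q ^+ 2) - n * (a * n)).
    by rewrite rpredB // dvdz_mulr.
  by rewrite mulrA -E; ring.
have /dvdzP[n' nE] := ln; have /dvdzP[p' pE] := lp.
have E1 : c * q ^+ 2 = l%:Z * (p' ^+ 2 + a * n' ^+ 2).
  by apply: (mulfI l0); rewrite mulrA -E pE nE; ring.
have lq : (l %| q)%Z.
  have : (l %| c * q ^+ 2)%Z by rewrite E1 dvdz_mulr.
  by rewrite prime_dvdzM // (negbTE lc) prime_dvdzX.
have /dvdzP[q' qE] := lq.
have E2 : p' ^+ 2 + a * n' ^+ 2 = l%:Z * c * q' ^+ 2.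
  by apply: (mulfI l0); rewrite -E1 qE; ring.
have [|p0] := posnP (absz p + absz n + absz q).
  by move/eqP; rewrite !addn_eq0 !absz_eq0 => /andP[/andP[/eqP -> /eqP ->] /eqP ->].
have [|p'0 n'0 q'0] := IH p' n' q' _ E2; last by rewrite pE nE qE p'0 n'0 q'0 !mul0r.
move: Npnq p0; rewrite pE nE qE !abszM !absz_nat -!mulnDl.
by have := prime_gt1 pl; clear; nia.
Qed.

Lemma no_norm (l : nat) (a c : int) (p n q : rat) : prime l -> nonresidue l a -> ~~ (l %| c)%Z ->
  p ^+ 2 + a%:~R * n ^+ 2 = l%:R * c%:~R * q ^+ 2 -> [/\ p = 0, n = 0 & q = 0].
Proof.
move=> pl nr lc E.
pose d := denq p * denq n * denq q.
have d0 : d%:~R != 0 :> rat by rewrite intr_eq0 !mulf_neq0 ?denq_neq0.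
have [P PE] : exists P : int, P%:~R = p * d%:~R.
  by exists (numq p * denq n * denq q); rewrite /d !rmorphM /= numqE; ring.
have [M ME] : exists M : int, M%:~R = n * d%:~R.
  by exists (denq p * numq n * denq q); rewrite /d !rmorphM /= numqE; ring.
have [Q QE] : exists Q : int, Q%:~R = q * d%:~R.
  by exists (denq p * denq n * numq q); rewrite /d !rmorphM /= numqE; ring.
have /(no_norm_int pl nr lc)[P0 M0 Q0] : P ^+ 2 + a * M ^+ 2 = l%:Z * c * Q ^+ 2.
  apply: (@intr_inj rat); rewrite rmorphD [X in X + _]rmorphXn rmorphM [X in _ * X]rmorphXn.
  rewrite [RHS]rmorphM [X in _ = _ * X]rmorphXn rmorphM /= PE ME QE.
  transitivity ((p ^+ 2 + a%:~R * n ^+ 2) * d%:~R ^+ 2); first by ring.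
  by rewrite E; ring.
by split; apply: (mulIf d0); rewrite mul0r -?PE -?ME -?QE ?P0 ?M0 ?Q0.
Qed.

Lemma rat_odd_valuation (l : nat) (c : int) (p q : rat) : prime l -> ~~ (l %| c)%Z ->
  p ^+ 2 = l%:R * c%:~R * q ^+ 2 -> q = 0.
Proof.
move=> pl lc E; apply/eqP/negPn/negP => q0.
pose P := numq p * denq q; pose Q := numq q * denq p.
have PQ : P ^+ 2 = l%:Z * c * Q ^+ 2.
  apply: (@intr_inj rat); rewrite /P /Q.
  transitivity (p ^+ 2 * (denq p * denq q)%:~R ^+ 2 : rat).
    by rewrite rmorphXn !rmorphM /= numqE; ring.
  by rewrite E [RHS]rmorphM [X in _ = X * _]rmorphM [X in _ = _ * X]rmorphXn !rmorphM /= numqE; ring.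
have p0 : p != 0.
  rewrite -sqrf_eq0 E !mulf_neq0 ?sqrf_eq0 ?q0 ?intr_eq0 ?pnatr_eq0 -?lt0n ?prime_gt0 //.
  by apply: contra lc => /eqP ->; rewrite dvdz0.
have P0 : (0 < absz P)%N by rewrite absz_gt0 mulf_neq0 ?numq_eq0 ?denq_neq0.
have Q0 : (0 < absz Q)%N by rewrite absz_gt0 mulf_neq0 ?numq_eq0 ?denq_neq0.
have c0 : (0 < absz c)%N by rewrite absz_gt0; apply: contra lc => /eqP ->; rewrite dvdz0.
have : (absz P ^ 2 = l * absz c * absz Q ^ 2)%N by rewrite -!abszX PQ !abszM.
move/(congr1 (logn l)); rewrite lognX.
have -> : logn l (l * absz c * absz Q ^ 2) = (1 + logn l (absz c) + 2 * logn l (absz Q))%N.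
  have Q20 : (0 < absz Q ^ 2)%N by rewrite expn_gt0 Q0.
  have lc0 : (0 < l * absz c)%N by rewrite muln_gt0 prime_gt0.
  rewrite (lognM l lc0 Q20) (lognM l (prime_gt0 pl) c0) (lognX l (absz Q) 2).
  by rewrite (logn_prime l pl) eqxx.
have -> : logn l (absz c) = 0%N by rewrite lognE pl c0 /=; move: lc; rewrite dvdzE => /negbTE ->.
by clear; lia.
Qed.

(** * Residues modulo 8 *)

(* The pair (a, b) stands for the residue class of a + b s modulo 8. *)
Definition z8 := ('Z_8 * 'Z_8)%type.
Definition mul8 (m : 'Z_8) (x y : z8) : z8 := (x.1 * y.1 + m * (x.2 * y.2), x.1 * y.2 + x.2 * y.1).
Definition exp8 m (x : z8) n : z8 := iter n (mul8 m x) (1, 0).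
Definition seq8 : seq z8 := [seq (inZp i, inZp j) | i <- iota 0 8, j <- iota 0 8].

Lemma mem_seq8 x : x \in seq8.
Proof.
case: x => i j; apply/allpairsP; exists (val i, val j).
by rewrite !mem_iota !ltn_ord /= !valZpK.
Qed.

(** Parity of the image under s -> c: the odd residues are those of integers outside the prime above
    2. *)
Definition odd8 (c : 'Z_8) (x : z8) := odd (x.1 + c * x.2 : 'Z_8)%R.
Definition odds8 c := [seq x <- seq8 | odd8 c x].
Definition bits8 : seq z8 := [:: (0, 0); (1, 0); (0, 1); (1, 1)].

(** The exponent of the unit group modulo 8 divides 16; this allows [a3] to be normalised to 1. *)
Definition unit_check m c := all (fun x => exp8 m x 16 == (1, 0)) (odds8 c).
Definition fourth8 m c := undup [seq exp8 m x 4 | x <- odds8 c].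

(* The discriminant modulo 8 of a Weierstrass equation with a3 = 1 and a1^2 = 2 y. *)
Definition disc8 m (a1 y a2 a4 : z8) : z8 :=
  let mu := mul8 m in
  let w := mu (mu y y) (mu a1 a4 + a2 + mu a4 a4) + mu y a4 + mu a2 a1 in
  (5%:R, 0) + mu y a1 *+ 2 + w *+ 4.

(* The residues of delta^3 for delta = eps^j l^4. *)
Definition disc_values m c eps :=
  [seq mul8 m (exp8 m eps (3 * j)) (exp8 m f 3) | j <- iota 0 4, f <- fourth8 m c].

(** The excluded case is supersingular reduction above 2, that is, [a1] in the prime. Then a1^2 = 2
    y because 2 ramifies, and [a2], [a4] matter only modulo 2. *)
Definition sup_check m c eps := let L := disc_values m c eps in let L' := L ++ [seq - x | x <- L] in
 all (fun a1 => all (fun y =>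
  all (fun a2 => all (fun a4 => disc8 m a1 y a2 a4 \notin L') bits8) bits8)
   [seq y <- seq8 | y *+ 2 == mul8 m a1 a1]) [seq x <- seq8 | ~~ odd8 c x].

(* q C <> eps^i g^2 for C = c4 - 12 delta, which is a1^4 - 12 delta modulo 8. *)
Definition ord_check m c eps (q i : nat) :=
 all (fun f => all (fun d => all (fun g => mul8 m (exp8 m eps i) (mul8 m g g) != (f + d *+ 4) *+ q) seq8) (odds8 c)) (fourth8 m c).

(* If w^2 = 3 (C^2 + 36 delta C + 432 delta^2) then w - 18 delta does not have norm +-1
   modulo 8. *)
Definition norm_check m c := 
 all (fun f => all (fun d => all (fun w =>
   (let C := f + d *+ 4 in mul8 m w w == (mul8 m C C + mul8 m d C *+ 4) *+ 3) ==>
   (let F := w - d *+ 2 in let n := F.1 * F.1 - m * (F.2 * F.2) in (n != 1) && (n != -1))) seq8) (odds8 c)) (fourth8 m c).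

Lemma odd_Z8 (n : int) : odd (n%:~R : 'Z_8) = ~~ (2 %| n)%Z.
Proof.
have -> : (n%:~R : 'Z_8) = (absz (n %% 8)%Z)%:R.
  rewrite {1}(divz_eq n 8) rmorphD rmorphM /= (_ : 8%:~R = 0 :> 'Z_8) ?mulr0 ?add0r; last exact/eqP.
  by rewrite -[RHS]/((absz (n %% 8)%Z)%:~R) gez0_abs ?modz_ge0.
rewrite val_Zp_nat //= ; lia.
Qed.

(** * Weierstrass invariants and chords *)

Section Invariants.

Variable K : fieldType.
Implicit Type W : weierstrass K.

Definition c4 W := b2 W ^+ 2 - 24%:R * b4 W.
Definition c6 W := - b2 W ^+ 3 + 36%:R * b2 W * b4 W - 216%:R * b6 W.

Lemma c4_c6_disc W : c4 W ^+ 3 - c6 W ^+ 2 = 1728%:R * disc W.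
Proof. rewrite /c4 /c6 /disc /b2 /b4 /b6 /b8; ring. Qed.

Lemma change_vars_invariants W u r s t : u != 0 -> let W' := change_vars W u r s t in
  [/\ c4 W' = c4 W / u ^+ 4, c6 W' = c6 W / u ^+ 6 & disc W' = disc W / u ^+ 12].
Proof.
move=> u0 W'; rewrite /W' /c4 /c6 /disc /b2 /b4 /b6 /b8 /change_vars /=.
by split; field.
Qed.

End Invariants.

Lemma chord (F : fieldType) (r k x y z w : F) : x != y ->
  r * z ^+ 2 = x ^+ 3 - k -> r * w ^+ 2 = y ^+ 3 - k ->
  let l := (z - w) / (x - y) in let x3 := r * l ^+ 2 - x - y in let z3 := z + l * (x3 - x) in
  r * z3 ^+ 2 = x3 ^+ 3 - k.
Proof.
move=> xy E1 E2 l x3 z3; have d0 : x - y != 0 by rewrite subr_eq0.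
have El : l * (x - y) = z - w by rewrite /l; field.
(* Let f(X) = X^3 - k - r (z + l (X - x))^2. The left side is the value at y of (f(X) - f(x)) / (X -
   x), a monic quadratic whose roots add up to r l^2 - x; hence [x3] is its other root. *)
have g0 : y ^+ 2 + y * x + x ^+ 2 - r * (2 * z * l + l ^+ 2 * (y - x)) = 0.
  apply: (mulfI d0); rewrite mulr0.
  transitivity (x ^+ 3 - y ^+ 3 - r * (2 * z - l * (x - y)) * (l * (x - y))); first by ring.
  rewrite El; transitivity ((x ^+ 3 - k - r * z ^+ 2) - (y ^+ 3 - k - r * w ^+ 2)); first by ring.
  by rewrite E1 E2; ring.
apply/eqP; rewrite eq_sym -subr_eq0; apply/eqP.
transitivity ((x ^+ 3 - k - r * z ^+ 2) +
    (x3 - x) * (y ^+ 2 + y * x + x ^+ 2 - r * (2 * z * l + l ^+ 2 * (y - x)))).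
  rewrite /z3 /x3; ring.
by rewrite E1 g0; ring.
Qed.

Lemma chord1 (F : fieldType) (k x y z w : F) : x != y ->
  z ^+ 2 = x ^+ 3 - k -> w ^+ 2 = y ^+ 3 - k ->
  let l := (z - w) / (x - y) in let x3 := l ^+ 2 - x - y in let z3 := z + l * (x3 - x) in
  z3 ^+ 2 = x3 ^+ 3 - k.
Proof.
move=> xy E1 E2 l x3 z3; have := @chord F 1 k x y z w xy; rewrite !mul1r => /(_ E1 E2) /=.
by rewrite -/l !mul1r -/x3 -/z3.
Qed.

(* The real and imaginary parts of (z + 6j) (w + 6j) (z3 + 6j) = (b + 6j)^3, where
   j^2 = -6; substitute X = - (b + 6j) / l in
   (X - x) (X - y) (X - x3) = X^3 - 216 - (l X + b)^2. *)
Lemma chord_cube (F : fieldType) (x y z w : F) : x != y ->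
  z ^+ 2 = x ^+ 3 - 216 -> w ^+ 2 = y ^+ 3 - 216 ->
  let l := (z - w) / (x - y) in let x3 := l ^+ 2 - x - y in let z3 := z + l * (x3 - x) in let b := z - l * x in
  z * w + z * z3 + w * z3 = 3 * b ^+ 2 /\ z * w * z3 - 216 * (z + w + z3) = b ^+ 3 - 648 * b.
Proof.
move=> xy E1 E2 l x3 z3 b; have d0 : x - y != 0 by rewrite subr_eq0.
have El : l * (x - y) = z - w by rewrite /l; field.
have g0 : y ^+ 2 + y * x + x ^+ 2 - (2 * z * l + l ^+ 2 * (y - x)) = 0.
  apply: (mulfI d0); rewrite mulr0.
  transitivity (x ^+ 3 - y ^+ 3 - (2 * z - l * (x - y)) * (l * (x - y))); first by ring.
  rewrite El; transitivity ((x ^+ 3 - 216 - z ^+ 2) - (y ^+ 3 - 216 - w ^+ 2)); first by ring.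
  by rewrite E1 E2; ring.
have zE : z = l * x + b by rewrite /b; ring.
have wE : w = l * y + b by rewrite /b -[RHS]opprK -(subKr z w) -El; ring.
have z3E : z3 = l * x3 + b by rewrite /z3 /b; ring.
have s2 : x * y + (x + y) * x3 = - (2 * l * b).
  apply/eqP; rewrite -subr_eq0; apply/eqP; rewrite /x3 -[RHS]oppr0 -g0 {1}/b; ring.
have s3 : x * y * x3 = 216 + b ^+ 2.
  transitivity (x * (- (2 * l * b)) - x ^+ 2 * (l ^+ 2 - x)); first by rewrite -s2 /x3; ring.
  transitivity (x ^+ 3 - z ^+ 2 + b ^+ 2); last by rewrite E1; ring.
  by rewrite zE; ring.
have s1 : x3 = l ^+ 2 - x - y by [].
rewrite z3E zE wE; split.
  transitivity (l ^+ 2 * (x * y + (x + y) * x3) + 2 * l * b * (x + y + x3) + 3 * b ^+ 2); first by ring.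
  by rewrite s2 s1; ring.
transitivity (l ^+ 3 * (x * y * x3) + l ^+ 2 * b * (x * y + (x + y) * x3) + l * b ^+ 2 * (x + y + x3) + b ^+ 3
  - 216 * (l * (x + y + x3)) - 648 * b); first by ring.
by rewrite s2 s3 s1; ring.
Qed.

(** * The ring F[j] with j^2 = -6 *)

(** A separate name, since pairs already carry the componentwise product. *)
Definition adjoin_sqrtN6 (F : fieldType) := (F * F)%type.

Section AdjoinSqrtN6.

Variable F : fieldType.
Local Notation L := (adjoin_sqrtN6 F).

HB.instance Definition _ := GRing.Zmodule.on L.

Definition mulj (x y : L) : L := (x.1 * y.1 - 6 * (x.2 * y.2), x.1 * y.2 + x.2 * y.1).

Lemma muljA : associative mulj.
Proof. by move=> [a b] [c d] [e f]; rewrite /mulj /=; congr (_, _); ring. Qed.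
Lemma muljC : commutative mulj.
Proof. by move=> [a b] [c d]; rewrite /mulj /=; congr (_, _); ring. Qed.
Lemma mul1j : left_id ((1, 0) : L) mulj.
Proof. by move=> [a b]; rewrite /mulj /=; congr (_, _); ring. Qed.
Lemma muljDl : left_distributive mulj +%R.
Proof. by move=> [a b] [c d] [e f]; congr (_, _); rewrite /=; ring. Qed.
Lemma onej_neq0 : ((1, 0) : L) != 0.
Proof. by rewrite -pair_eqE /= /pair_eq /= oner_eq0. Qed.

HB.instance Definition _ := GRing.Zmodule_isComNzRing.Build L muljA muljC mul1j muljDl onej_neq0.

Lemma mkM (a b c d : F) : ((a, b) : L) * (c, d) = (a * c - 6 * (b * d), a * d + b * c).
Proof. by []. Qed.

Lemma mkX3 (a b : F) : ((a, b) : L) ^+ 3 = (a ^+ 3 - 18 * a * b ^+ 2, 3 * a ^+ 2 * b - 6 * b ^+ 3).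
Proof. by rewrite !exprS expr0 mulr1 !mkM; congr (_, _); ring. Qed.

End AdjoinSqrtN6.

Lemma odd_shifted_cube (n r k : int) : ~~ (2 %| n)%Z -> ~~ (2 %| r)%Z -> (2 %| k)%Z ->
  ~~ (2%N %| 31 * r * (n ^+ 3 - k))%Z.
Proof.
move=> on or k2; rewrite !prime_dvdzM // !negb_or or andTb.
by rewrite (rpredBr _ k2) prime_dvdzX.
Qed.

Lemma no_sqr_2mod128 (a b e f : int) : a ^+ 2 + 62 * b ^+ 2 = 2 + 128 * e -> 2 * (a * b) = 128 * f -> False.
Proof.
move=> H1 H2; have [A AE] := sq_mod16 a; have [b2|b2] := boolP (2 %| b)%Z.
  have [B BE] := even_sq b2; move: H1; clear -AE BE.
  by case: AE => ->; case: BE => ->; lia.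
have [B BE] := odd_sq b2; have /dvdzP[a' aE] : ((2 ^ 2)%N %| a)%Z.
  have c : coprimez (2 ^ 2)%N b by rewrite coprimezE coprimeXl // prime_coprime.
  by rewrite -(Gauss_dvdzl _ c); apply/dvdzP; exists (16 * f); clear -H2; lia.
have a2 : a ^+ 2 = 16 * a' ^+ 2 by rewrite aE; ring.
by move: H1; rewrite a2 BE; clear; lia.
Qed.

Lemma no_sqr_neg1mod64 (a b e f : int) : a ^+ 2 + 62 * b ^+ 2 = - 1 + 64 * e -> 2 * (a * b) = 64 * f -> False.
Proof.
move=> H1 H2; have [A AE] := sq_mod16 a; have [b2|b2] := boolP (2 %| b)%Z.
  have [B BE] := even_sq b2; move: H1; clear -AE BE.
  by case: AE => ->; case: BE => ->; lia.
have [B BE] := odd_sq b2; have : (2%N %| a * b)%Z by apply/dvdzP; exists (16 * f); clear -H2; lia.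
rewrite prime_dvdzM // (negbTE b2) orbF => /even_sq[C CE].
by move: H1; rewrite BE; clear -CE; case: CE => ->; lia.
Qed.

Lemma no_sum_128 (a b e f : int) : a ^+ 2 + 62 * b ^+ 2 + 2 * (e ^+ 2 + 62 * f ^+ 2) = 128 ->
  2 * (a * b) + 4 * (e * f) = 0 -> (e ^+ 2 - 62 * f ^+ 2) ^+ 2 = 1 -> False.
Proof.
move=> H1 H2 H3; have a0 := sqr_ge0 a; have b0 := sqr_ge0 b; have e0 := sqr_ge0 e; have f0 := sqr_ge0 f.
have {}H3 : e ^+ 2 - 62 * f ^+ 2 = 1 \/ e ^+ 2 - 62 * f ^+ 2 = -1.
  by move/eqP: H3; rewrite sqrf_eq1 => /orP[] /eqP->; [left|right].
(* With e^2 = 62 f^2 +- 1, the first equation gives 248 f^2 - 2 <= 128. *)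
have f00 : f = 0 by apply/eqP; rewrite -sqrf_eq0; apply/eqP; clear -H1 H3 a0 b0 e0 f0; lia.
have : a * b = 0 by rewrite f00 in H2; clear -H2; lia.
rewrite f00 in H1 H3; have [A AE] := sq_mod16 a.
move/eqP; rewrite mulf_eq0 => /orP[/eqP a00|/eqP b00].
  by rewrite a00 in H1; clear -H1 H3; lia.
by rewrite b00 in H1; clear -H1 H3 AE; case: AE; lia.
Qed.

(** The hypotheses are the norms of t = e + f s and of t + 256 conj t - 32. Eliminating [f] leaves a
    quadratic equation for [e] with roots 8 and 129 / 16. *)
Lemma no_unit_trace (e f : int) : e ^+ 2 - 62 * f ^+ 2 = 1 ->
  (257 * e - 32) ^+ 2 - 62 * (255 * f) ^+ 2 = 1 -> False.
Proof.
move=> H1 H2; have : (e - 8) * (16 * e - 129) = 0 by lia.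
move/eqP; rewrite mulf_eq0 => /orP[/eqP e8|/eqP e8]; last by lia.
have {e8} eE : e = 8 by lia.
by rewrite eE in H1; lia.
Qed.

(** * Integers and primes of a quadratic field *)

Lemma Q_sqrt_coord (m : nat) (K : fieldExtType rat) : is_Q_sqrt m K ->
  exists (s : K) (re im : K -> rat), s ^+ 2 = m%:R /\
    forall x, x = in_alg K (re x) + in_alg K (im x) * s.
Proof.
case=> s s2 gen.
have H (x : K) : exists c : rat * rat, x == in_alg K c.1 + in_alg K c.2 * s.
  have : x \in <<1; s>>%VS by rewrite gen memvf.
  case/Fadjoin_polyP=> p pK ->; elim/poly_ind: p pK => [|p c IH] pK.
    by exists (0, 0); rewrite horner0 /= !scale0r mul0r addr0.
  have pcoef i : p`_i \in 1%VS.
    by have /polyOverP/(_ i.+1) := pK; rewrite coefD coefMX coefC /= addr0.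
  have [|[a b] /eqP /= E] := IH; first by apply/polyOverP.
  have : c \in 1%VS by have /polyOverP/(_ 0) := pK; rewrite coefD coefMX coefC /= add0r.
  case/vlineP=> k kE; exists (m%:R * b + k, a); apply/eqP.
  rewrite hornerMXaddC E kE /=; have -> : k *: (1 : K) = in_alg K k by [].
  have -> : b *: (1 : K) = in_alg K b by [].
  have -> : a *: (1 : K) = in_alg K a by [].
  have -> : (m%:R * b + k) *: (1 : K) = in_alg K (m%:R * b + k) by [].
  ring: s2.
exists s, (fun x => (xchoose (H x)).1), (fun x => (xchoose (H x)).2); split=> // x.
by apply/eqP; exact: (xchooseP (H x)).
Qed.

Lemma rat_integral (K : fieldExtType rat) (iK : {rmorphism rat -> K}) (q : rat) :
  integralOver (intr : int -> K) (iK q) -> q \is a Num.int.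
Proof.
case=> p pm; have -> : map_poly (intr : int -> K) p = map_poly iK (map_poly intr p).
  by rewrite -map_poly_comp; apply: eq_map_poly => i; exact/esym/(rmorph_int iK).
rewrite fmorph_root => rp; rewrite -Cint_rat; apply: Cint_rat_Aint; first exact: Crat_rat.
apply: (@root_monic_Aint (map_poly ratr (map_poly intr p))); first by rewrite fmorph_root.
  by rewrite map_monic; apply: monic_map.
rewrite -map_poly_comp; apply/polyOverP => i; rewrite coef_map_id0 /= ?rmorph_int ?rmorph0 //; exact: intr_int.
Qed.

Section QuadraticField.

Variables (m : nat) (K : fieldExtType rat) (iK : {rmorphism rat -> K}) (s : K) (re im : K -> rat).
Hypothesis s2 : s ^+ 2 = m%:R.
Hypothesis coord : forall x, x = iK (re x) + iK (im x) * s.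
Hypothesis msf : squarefree m.
Hypothesis m23 : (m %% 4 = 2 \/ m %% 4 = 3)%N.

Local Notation "q %:K" := (iK q) (at level 2, format "q %:K").

Lemma irrat (q : rat) : q ^+ 2 = m%:R -> False.
Proof.
move=> E; have [z zE] := @rat_sqr_int q m E.
have {}E : z ^+ 2 = m by apply: (@intr_inj rat); rewrite rmorphXn /= -zE E.
by have [a aE] := sq_mod16 z; move: m23; case: aE; rewrite E; clear; lia.
Qed.

Lemma inK_inj : injective iK.
Proof. exact: fmorph_inj. Qed.

Lemma coord_uniq (a b c d : rat) : a%:K + b%:K * s = c%:K + d%:K * s -> a = c /\ b = d.
Proof.
move=> E; have E' : (a - c)%:K = (d - b)%:K * s.
  by rewrite !rmorphB /= mulrBl -[a%:K](addrK (b%:K * s)) E; ring.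
have [bd|bd] := eqVneq b d.
  by move: E'; rewrite bd subrr rmorph0 mul0r => /eqP; rewrite fmorph_eq0 subr_eq0 => /eqP.
case: (@irrat ((a - c) / (d - b))); apply: inK_inj.
have db : (d - b)%:K != 0 by rewrite fmorph_eq0 subr_eq0 eq_sym.
rewrite rmorphXn rmorphM fmorphV /= E' mulrC mulKf // s2; exact/esym/rmorph_nat.
Qed.

Lemma re_im (a b : rat) : re (a%:K + b%:K * s) = a /\ im (a%:K + b%:K * s) = b.
Proof. by apply: coord_uniq; rewrite -coord. Qed.

Lemma reE a b : re (a%:K + b%:K * s) = a. Proof. by have [] := re_im a b. Qed.
Lemma imE a b : im (a%:K + b%:K * s) = b. Proof. by have [] := re_im a b. Qed.

Lemma re_inK a : re a%:K = a.
Proof. by rewrite -[a%:K]addr0 -(mul0r s) -(rmorph0 iK) reE. Qed.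
Lemma im_inK a : im a%:K = 0.
Proof. by rewrite -[a%:K]addr0 -(mul0r s) -(rmorph0 iK) imE. Qed.

Lemma coordD x y : re (x + y) = re x + re y /\ im (x + y) = im x + im y.
Proof.
apply: coord_uniq; rewrite -coord {1}(coord x) {1}(coord y) !rmorphD /=; ring.
Qed.
Lemma reD x y : re (x + y) = re x + re y. Proof. by have [] := coordD x y. Qed.
Lemma imD x y : im (x + y) = im x + im y. Proof. by have [] := coordD x y. Qed.

Lemma coordN x : re (- x) = - re x /\ im (- x) = - im x.
Proof. apply: coord_uniq; rewrite -coord {1}(coord x) !rmorphN /=; ring. Qed.
Lemma reN x : re (- x) = - re x. Proof. by have [] := coordN x. Qed.
Lemma imN x : im (- x) = - im x. Proof. by have [] := coordN x. Qed.

Lemma coordM x y : re (x * y) = re x * re y + m%:R * im x * im y /\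
  im (x * y) = re x * im y + im x * re y.
Proof.
apply: coord_uniq; rewrite -coord {1}(coord x) {1}(coord y); ring: s2.
Qed.
Lemma reM x y : re (x * y) = re x * re y + m%:R * im x * im y.
Proof. by have [] := coordM x y. Qed.
Lemma imM x y : im (x * y) = re x * im y + im x * re y.
Proof. by have [] := coordM x y. Qed.

Definition conj x : K := (re x)%:K - (im x)%:K * s.

Lemma re_conj x : re (conj x) = re x /\ im (conj x) = - im x.
Proof. by apply: coord_uniq; rewrite -coord /conj rmorphN mulNr. Qed.

Lemma conjK : involutive conj.
Proof.
by move=> x; rewrite {1}/conj; have [-> ->] := re_conj x; rewrite rmorphN mulNr opprK -coord.
Qed.

Lemma conjD x y : conj (x + y) = conj x + conj y.
Proof. rewrite /conj reD imD; ring. Qed.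
Lemma conjN x : conj (- x) = - conj x.
Proof. rewrite /conj reN imN; ring. Qed.
Lemma conjM x y : conj (x * y) = conj x * conj y.
Proof. rewrite /conj reM imM; ring: s2. Qed.
Lemma conj_inK q : conj q%:K = q%:K.
Proof. by rewrite /conj re_inK im_inK rmorph0 mul0r subr0. Qed.
Lemma conj_s : conj s = - s.
Proof.
have sE : s = 0%:K + 1%:K * s by rewrite rmorph0 rmorph1 mul1r add0r.
by rewrite {1}sE /conj reE imE rmorph0 rmorph1 mul1r sub0r.
Qed.

Definition nm x : rat := re x ^+ 2 - m%:R * im x ^+ 2.

Lemma nmE x : (nm x)%:K = x * conj x.
Proof. rewrite {2}(coord x) /conj /nm; ring: s2. Qed.

Lemma nmM x y : nm (x * y) = nm x * nm y.
Proof. apply: inK_inj; rewrite rmorphM /= !nmE conjM; ring. Qed.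

Lemma nm_inK q : nm q%:K = q ^+ 2.
Proof. by rewrite /nm re_inK im_inK expr0n mulr0 subr0. Qed.

Lemma conj_eq0 x : (conj x == 0) = (x == 0).
Proof.
rewrite -(inj_eq (inv_inj conjK)); congr (_ == _).
by rewrite conjK. by have := conj_inK 0; rewrite rmorph0.
Qed.

Lemma nm_eq0 x : (nm x == 0) = (x == 0).
Proof. by rewrite -(fmorph_eq0 iK) nmE mulf_eq0 conj_eq0 orbb. Qed.

Lemma conjV x : conj x^-1 = (conj x)^-1.
Proof.
have [->|x0] := eqVneq x 0.
  by rewrite invr0; have := conj_inK 0; rewrite rmorph0 => ->; rewrite invr0.
apply: (mulfI (x := conj x)); first by rewrite conj_eq0.
rewrite -conjM !mulfV ?conj_eq0 //; have := conj_inK 1; by rewrite rmorph1.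
Qed.

Lemma conjX x n : conj (x ^+ n) = conj x ^+ n.
Proof.
elim: n => [|n IH]; last by rewrite !exprS conjM IH.
by rewrite !expr0; have := conj_inK 1; rewrite rmorph1.
Qed.

Lemma nmX x n : nm (x ^+ n) = nm x ^+ n.
Proof. by apply: inK_inj; rewrite nmE conjX rmorphXn /= nmE exprMn. Qed.

Lemma conj_fixed x : conj x = x -> exists q, x = q%:K.
Proof.
move=> E; exists (re x); have : (im x)%:K * s = 0.
  have : x - conj x = 0 by rewrite E subrr.
  rewrite {1}(coord x) /conj (_ : _ - _ = 2%:K * ((im x)%:K * s)); last by ring.
  by move/eqP; rewrite mulf_eq0 fmorph_eq0 => /eqP.
by move=> E'; rewrite {1}(coord x) E' addr0.
Qed.

Lemma conj_anti x : conj x = - x -> exists q, x = q%:K * s.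
Proof.
move=> E; exists (im x); have : (re x)%:K = 0.
  have : x + conj x = 0 by rewrite E subrr.
  rewrite {1}(coord x) /conj (_ : _ + _ = 2%:K * (re x)%:K); last by ring.
  by move/eqP; rewrite mulf_eq0 fmorph_eq0 => /eqP.
by move=> E'; rewrite {1}(coord x) E' add0r.
Qed.

(** Membership in Z[s], which is the whole ring of integers because m is 2 or 3 modulo 4. *)
Definition isO x := (re x \is a Num.int) && (im x \is a Num.int).

Lemma isO_D x y : isO x -> isO y -> isO (x + y).
Proof. by case/andP=> a b /andP[c d]; rewrite /isO reD imD !rpredD. Qed.
Lemma isO_N x : isO x -> isO (- x).
Proof. by case/andP=> a b; rewrite /isO reN imN !rpredN a b. Qed.
Lemma isO_M x y : isO x -> isO y -> isO (x * y).
Proof.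
by case/andP=> a b /andP[c d]; rewrite /isO reM imM !rpredD ?rpredM ?rpred_nat.
Qed.
Lemma isO_int (n : int) : isO n%:~R.
Proof. by rewrite -(rmorph_int iK) /isO re_inK im_inK intr_int rpred0. Qed.
Lemma isO_nat (n : nat) : isO n%:R.
Proof. exact: (isO_int n). Qed.
Lemma isO_1 : isO 1. Proof. exact: (isO_nat 1). Qed.
Lemma isO_X x n : isO x -> isO (x ^+ n).
Proof. by move=> Ox; elim: n => [|n IH]; [exact: isO_1 | rewrite exprS isO_M]. Qed.
Lemma isO_s : isO s.
Proof.
have -> : s = 0%:K + 1%:K * s by rewrite rmorph0 rmorph1 mul1r add0r.
by rewrite /isO reE imE rpred0 rpred1.
Qed.
Lemma isO_conj x : isO x -> isO (conj x).
Proof. by case/andP=> a b; rewrite /isO; have [-> ->] := re_conj x; rewrite rpredN a. Qed.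

Lemma isOP x : isO x -> exists a b : int, x = a%:~R + b%:~R * s.
Proof.
case/andP=> /intrP[a aE] /intrP[b bE]; exists a, b.
by rewrite {1}(coord x) aE bE !rmorph_int.
Qed.

Lemma isO_mk (a b : int) : isO (a%:~R + b%:~R * s).
Proof. by rewrite isO_D ?isO_M ?isO_int ?isO_s. Qed.

Lemma isO_nm x : isO x -> nm x \is a Num.int.
Proof. by case/andP=> a b; rewrite /nm rpredB ?rpredM ?rpredX ?rpred_nat. Qed.

Lemma conj_int (n : int) : conj n%:~R = n%:~R.
Proof. by rewrite -(rmorph_int iK) conj_inK. Qed.

Lemma alg_integer_isO x : alg_integer x <-> isO x.
Proof.
split=> [Ix|Ox]; last first.
  have [a [b xE]] := isOP Ox; rewrite xE; apply: integral_add; first exact: integral_id.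
  apply: integral_mul; first exact: integral_id.
  exists ('X^2 - (m%:Z)%:P); first by rewrite monicE lead_coefDl ?lead_coefXn // size_polyN size_polyXn size_polyC; case: (_ != 0).
  by rewrite rmorphB /= map_polyXn map_polyC /= /root !hornerE s2 subrr.
have Icx : alg_integer (conj x).
  case: Ix => p pm /eqP px; exists p => //; rewrite /root; apply/eqP.
  have H (q : {poly int}) : (map_poly (intr : int -> K) q).[conj x] = conj (map_poly (intr : int -> K) q).[x].
    elim/poly_ind: q => [|q c IH]; first by rewrite rmorph0 !horner0; have := conj_int 0; rewrite rmorph0.
    rewrite rmorphD rmorphM /= map_polyX map_polyC /= !hornerE IH.
    by rewrite conjD conjM conj_int.
  by rewrite H px; have := conj_int 0; rewrite rmorph0.
have re2 : 2 * re x \is a Num.int.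
  apply: (@rat_integral K iK); have -> : (2 * re x)%:K = x + conj x.
    by rewrite /conj [X in _ = X + _]coord; ring.
  exact: integral_add.
have nmx : nm x \is a Num.int.
  by apply: (@rat_integral K iK); rewrite nmE; apply: integral_mul.
case/intrP: re2 => a aE; case/intrP: nmx => n nE.
have mb : m%:R * (2 * im x) ^+ 2 = (a ^+ 2 - 4 * n)%:~R.
  by rewrite rmorphB rmorphXn rmorphM /= -aE -nE /nm; ring.
have [w wE] : exists w : int, m%:R * (2 * im x) = w%:~R.
  by apply: (@rat_sqr_int _ (m%:Z * (a ^+ 2 - 4 * n))); rewrite rmorphM /= -mb; ring.
have m0 : (0 < m)%N by case: m m23 => // -[].
have m0r : m%:R != 0 :> rat by rewrite pnatr_eq0 -lt0n.
have w2 : w ^+ 2 = m%:Z * (a ^+ 2 - 4 * n).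
  by apply: (@intr_inj rat); rewrite rmorphXn rmorphM /= -mb -wE; ring.
have /dvdzP[b bE] : (m %| w)%Z.
  rewrite dvdzE; apply: squarefree_dvd_sqr => //.
  by rewrite -abszX -dvdzE w2 dvdz_mulr.
have imb : 2 * im x = b%:~R by apply: (mulfI m0r); rewrite wE bE rmorphM /= mulrC.
have E : m%:Z * b ^+ 2 = a ^+ 2 - 4 * n.
  by apply: (@intr_inj rat); rewrite rmorphM rmorphXn /= -imb.
(* A trace a and a norm n satisfy a^2 - m b^2 = 4 n; for m = 2 or 3 modulo 4 this makes a and b
   even. *)
have [[a2 aE2] [b2 bE2]] : (exists a2, a = 2 * a2) /\ (exists b2, b = 2 * b2).
  have H : (2 %| a)%Z /\ (2 %| b)%Z.
    have [k mk] : exists k : int, m%:Z = 4 * k + 2 \/ m%:Z = 4 * k + 3.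
      by exists (m %/ 4)%N; clear -m23; lia.
    case: (boolP (2 %| a)%Z) => Ha; case: (boolP (2 %| b)%Z) => Hb //; exfalso; move: E.
    - have [c cE] := even_sq Ha; have [d dE] := odd_sq Hb.
      by rewrite dE; clear -mk cE; case: mk => ->; case: cE => ->; lia.
    - have [c cE] := odd_sq Ha; have [d dE] := even_sq Hb.
      by rewrite cE; clear -mk dE; case: mk => ->; case: dE => ->; lia.
    - have [c cE] := odd_sq Ha; have [d dE] := odd_sq Hb.
      by rewrite cE dE; clear -mk; case: mk => ->; lia.
  case: H => Ha Hb; split; [exists (a %/ 2)%Z | exists (b %/ 2)%Z]; clear -Ha Hb; lia.
have rex : re x = a2%:~R by apply: (@mulfI _ (2 : rat)) => //; rewrite aE aE2 rmorphM.
have imx : im x = b2%:~R by apply: (@mulfI _ (2 : rat)) => //; rewrite imb bE2 rmorphM.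
by rewrite /isO rex imx !intr_int.
Qed.

Lemma isO_root n x : (0 < n)%N -> isO (x ^+ n) -> isO x.
Proof.
move=> n0 /alg_integer_isO Ix; apply/alg_integer_isO.
apply: (@integral_root_monic _ _ _ _ ('X^n - (x ^+ n)%:P)).
- by rewrite monicE lead_coefDl ?lead_coefXn // size_polyN size_polyXn size_polyC; case: (_ != 0); case: n n0 {Ix}.
- by rewrite /root !hornerE subrr.
move=> y /(nthP 0)[i _ <-]; rewrite coefB coefXn coefC.
apply: integral_sub; first by case: (_ == _); [exact: integral1 | exact: integral0].
by case: (_ == _); [exact: Ix | exact: integral0].
Qed.

Lemma int_coord (a b c d : int) : a%:~R + b%:~R * s = c%:~R + d%:~R * s -> a = c /\ b = d.
Proof.
rewrite -!(rmorph_int iK) => /coord_uniq[ac bd].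
by split; apply: (@intr_inj rat).
Qed.

Lemma int_mulE (a b c d : int) :
  (a%:~R + b%:~R * s) * (c%:~R + d%:~R * s) = (a * c + m%:Z * b * d)%:~R + (a * d + b * c)%:~R * s.
Proof. by rewrite !(rmorphD, rmorphM) /=; ring: s2. Qed.

Lemma nm_int (a b : int) : nm (a%:~R + b%:~R * s) = (a ^+ 2 - m%:Z * b ^+ 2)%:~R.
Proof.
rewrite /nm -!(rmorph_int iK) reE imE; ring.
Qed.

(** * Primes of K and their local rings *)

(** The kernel of s -> c modulo [l]. For c^2 = m modulo [l] it is a prime above [l], ramified primes
    included: c = 0 when [l] divides [m]. *)
Definition split_prime (l : nat) (c : int) (x : K) : Prop :=
  exists a b : int, x = a%:~R + b%:~R * s /\ (l %| a + b * c)%Z.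

Definition inert_prime (l : nat) (x : K) : Prop :=
  exists a b : int, x = (l%:Z * a)%:~R + (l%:Z * b)%:~R * s.

Lemma split_prime_finite l c : prime l -> (l %| c ^+ 2 - m%:Z)%Z -> finite_prime (split_prime l c).
Proof.
move=> pl lc; have lM (a b a' b' : int) : (l %| (a * a' + m%:Z * b * b') + (a * b' + b * a') * c)%Z =
    (l %| (a + b * c) * (a' + b' * c))%Z.
  have -> : (a + b * c) * (a' + b' * c) = (a * a' + m%:Z * b * b') + (a * b' + b * a') * c
    + (c ^+ 2 - m%:Z) * (b * b') by ring.
  by rewrite (rpredDr _ (dvdz_mulr _ lc)).
have intP (a b : int) : split_prime l c (a%:~R + b%:~R * s) -> (l %| a + b * c)%Z.
  by case=> a' [b' [/int_coord[-> ->]]].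
split.
- by move=> x [a [b [-> _]]]; apply/alg_integer_isO; exact: isO_mk.
- by exists 0, 0; rewrite mul0r addr0 mul0r addr0 dvdz0.
- move=> x y [a [b [-> ab]]] [a' [b' [-> ab']]]; exists (a + a'), (b + b').
  split; first by rewrite !rmorphD /=; ring.
  have -> : a + a' + (b + b') * c = (a + b * c) + (a' + b' * c) by ring.
  exact: rpredD.
- move=> x y /alg_integer_isO /isOP[a [b ->]] [a' [b' [-> ab']]].
  exists (a * a' + m%:Z * b * b'), (a * b' + b * a'); rewrite int_mulE; split=> //.
  by rewrite lM dvdz_mull.
- have -> : 1 = 1%:~R + 0%:~R * s by rewrite mul0r addr0.
  by move/intP; rewrite mul0r addr0 dvdzE dvdn1 => /eqP l1; rewrite -[l]/(absz l) l1 in pl.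
- move=> x y /alg_integer_isO /isOP[a [b ->]] /alg_integer_isO /isOP[a' [b' ->]].
  rewrite int_mulE => /intP; rewrite lM prime_dvdzM // => /orP[H|H]; [left | right].
    by exists a, b.
  by exists a', b'.
exists l%:R; last by rewrite -(rmorph_nat iK) fmorph_eq0 pnatr_eq0 -lt0n prime_gt0.
by exists l%:Z, 0; rewrite mul0r addr0 mul0r addr0.
Qed.

Lemma inert_prime_finite l : prime l -> nonresidue l (- m%:Z) -> finite_prime (inert_prime l).
Proof.
move=> pl nr.
have intP (a b : int) : inert_prime l (a%:~R + b%:~R * s) -> (l %| a)%Z /\ (l %| b)%Z.
  by case=> a' [b' /int_coord[-> ->]]; split; apply: dvdz_mulr.
have norm_dvd (a b : int) : (l %| a ^+ 2 - m%:Z * b ^+ 2)%Z -> (l %| a)%Z /\ (l %| b)%Z.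
  move=> H; have lb : (l %| b)%Z.
    apply: contraT => lb; have clb : coprimez l b by rewrite coprimezE prime_coprime.
    have [[u v] /= bez] := coprimezP _ _ clb.
    have /negP[] := nr (v * a).
    have -> : (v * a) ^+ 2 + - m%:Z = v ^+ 2 * (a ^+ 2 - m%:Z * b ^+ 2) - l%:Z * (m%:Z * u * (1 + v * b)).
      have -> : l%:Z * (m%:Z * u * (1 + v * b)) = m%:Z * (u * l%:Z) * (1 + v * b) by ring.
      have -> : u * l%:Z = 1 - v * b by rewrite -bez; ring.
      by ring.
    by rewrite rpredB ?(dvdz_mull _ H) ?dvdz_mulr.
  split=> //; rewrite -(@prime_dvdzX l a 1) //.
  rewrite (_ : a ^+ 2 = (a ^+ 2 - m%:Z * b ^+ 2) + b * (m%:Z * b)); last by ring.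
  by rewrite rpredD // dvdz_mulr.
have dvdP (a b : int) : (l %| a)%Z -> (l %| b)%Z -> inert_prime l (a%:~R + b%:~R * s).
  by case/dvdzP=> a' -> /dvdzP[b' ->]; exists a', b'; rewrite ![_ * l%:Z]mulrC.
split.
- by move=> x [a [b ->]]; apply/alg_integer_isO; exact: isO_mk.
- by exists 0, 0; rewrite !mulr0 mul0r addr0.
- by move=> x y [a [b ->]] [a' [b' ->]]; exists (a + a'), (b + b'); rewrite !(rmorphD, rmorphM) /=; ring.
- move=> x y /alg_integer_isO /isOP[a [b ->]] [a' [b' ->]].
  exists (a * a' + m%:Z * b * b'), (a * b' + b * a').
  by rewrite !(rmorphD, rmorphM) /=; ring: s2.
- have -> : 1 = 1%:~R + 0%:~R * s by rewrite mul0r addr0.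
  by move/intP; rewrite dvdzE dvdn1 => -[/eqP l1]; rewrite -[l]/(absz l) l1 in pl.
- move=> x y /alg_integer_isO /isOP[a [b ->]] /alg_integer_isO /isOP[a' [b' ->]].
  rewrite int_mulE => /intP[H1 H2].
  have : (l %| (a ^+ 2 - m%:Z * b ^+ 2) * (a' ^+ 2 - m%:Z * b' ^+ 2))%Z.
    have -> : (a ^+ 2 - m%:Z * b ^+ 2) * (a' ^+ 2 - m%:Z * b' ^+ 2) =
      (a * a' + m%:Z * b * b') * (a * a' + m%:Z * b * b') - (a * b' + b * a') * (m%:Z * (a * b' + b * a')) by ring.
    by rewrite rpredB // dvdz_mulr.
  rewrite prime_dvdzM // => /orP[] /norm_dvd[la lb]; [left|right]; exact: dvdP.
exists l%:R; last by rewrite -(rmorph_nat iK) fmorph_eq0 pnatr_eq0 -lt0n prime_gt0.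
by exists 1, 0; rewrite mulr1 mulr0 mul0r addr0.
Qed.

Section AtPrime.

Variables (P : K -> Prop) (l : nat).
Hypotheses (fP : finite_prime P) (pl : prime l) (Pl : P l%:R).

Lemma fpO x : P x -> isO x.
Proof. by move/(fp_integer fP)/alg_integer_isO. Qed.

Lemma fpM x y : isO x -> P y -> P (x * y).
Proof. by move/alg_integer_isO/(fp_mul fP); exact. Qed.

Lemma fpN x : P x -> P (- x).
Proof. by rewrite -mulN1r; apply: fpM; apply/isO_N/isO_1. Qed.

Lemma fpB x y : P x -> P y -> P (x - y).
Proof. by move=> Px Py; apply: (fp_add fP) => //; exact: fpN. Qed.

Lemma fp_notM x y : isO x -> isO y -> ~ P x -> ~ P y -> ~ P (x * y).
Proof.
move=> /alg_integer_isO Ox /alg_integer_isO Oy nPx nPy /(fp_prime fP Ox Oy)[].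
  exact: nPx.
exact: nPy.
Qed.

Lemma fp_notX x n : isO x -> ~ P x -> ~ P (x ^+ n).
Proof.
move=> Ox nPx; elim: n => [|n IH]; first by rewrite expr0; exact: (fp_proper fP).
by rewrite exprS; apply: fp_notM => //; exact: isO_X.
Qed.

Lemma fp_primeM x y : isO x -> isO y -> P (x * y) -> P x \/ P y.
Proof. by move=> /alg_integer_isO Ox /alg_integer_isO Oy; exact: fp_prime. Qed.

Lemma fp_primeX x n : isO x -> P (x ^+ n) -> P x.
Proof.
move=> Ox; elim: n => [|n IH]; first by rewrite expr0 => /(fp_proper fP).
by rewrite exprS => /(fp_primeM Ox (isO_X n Ox))[].
Qed.

Lemma fp_n0 x : ~ P x -> x != 0.
Proof. by move=> nPx; apply/eqP => x0; apply: nPx; rewrite x0; exact: fp_zero fP. Qed.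

Lemma fp_int (n : int) : P n%:~R -> (l %| n)%Z.
Proof.
move=> Pn; apply: contraT => ln.
have cln : coprimez l n by rewrite coprimezE prime_coprime.
have [[u v] /= bez] := coprimezP _ _ cln.
case: (fp_proper fP); have -> : 1 = u%:~R * l%:R + v%:~R * n%:~R :> K.
  transitivity ((u * l%:Z + v * n)%:~R : K); first by rewrite bez.
  by rewrite rmorphD !rmorphM.
by apply: (fp_add fP); apply: fpM => //; exact: isO_int.
Qed.

Definition unitP w := exists a b, [/\ isO a, isO b, ~ P a, ~ P b & w = a / b].
Definition locP w := exists a b, [/\ isO a, isO b, ~ P b & w = a / b].

Lemma local_integer_locP x : local_integer P x <-> locP x.
Proof.
by split=> -[a [b [Oa Ob nPb xE]]]; exists a, b; split=> //; apply/alg_integer_isO.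
Qed.

Lemma unitP_loc w : unitP w -> locP w.
Proof. by case=> a [b [Oa Ob _ nb E]]; exists a, b. Qed.

Lemma locP_O x : isO x -> locP x.
Proof. by move=> Ox; exists x, 1; rewrite divr1; split=> //; [exact: isO_1 | exact: (fp_proper fP)]. Qed.

Lemma unitP_O x : isO x -> ~ P x -> unitP x.
Proof. by move=> Ox nx; exists x, 1; rewrite divr1; split=> //; [exact: isO_1 | exact: (fp_proper fP)]. Qed.

Lemma unitP_n0 w : unitP w -> w != 0.
Proof. by case=> a [b [_ _ /fp_n0 a0 /fp_n0 b0 ->]]; rewrite mulf_neq0 ?invr_eq0. Qed.

Lemma locP_D x y : locP x -> locP y -> locP (x + y).
Proof.
case=> a [b [Oa Ob nb ->]] [c [d [Oc Od nd ->]]].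
exists (a * d + c * b), (b * d); split; [by rewrite isO_D ?isO_M|by rewrite isO_M|exact: fp_notM|].
by field; rewrite !fp_n0.
Qed.

Lemma locP_M x y : locP x -> locP y -> locP (x * y).
Proof.
case=> a [b [Oa Ob nb ->]] [c [d [Oc Od nd ->]]].
exists (a * c), (b * d); split; [by rewrite isO_M|by rewrite isO_M|exact: fp_notM|].
by field; rewrite !fp_n0.
Qed.

Lemma locP_X x n : locP x -> locP (x ^+ n).
Proof.
move=> lx; elim: n => [|n IH]; first by apply: locP_O; exact: isO_1.
by rewrite exprS; exact: locP_M.
Qed.

Lemma locP_N x : locP x -> locP (- x).
Proof. by move=> lx; rewrite -mulN1r; apply: locP_M => //; apply: locP_O; apply/isO_N/isO_1. Qed.

Lemma unitP_M x y : unitP x -> unitP y -> unitP (x * y).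
Proof.
case=> a [b [Oa Ob na nb ->]] [c [d [Oc Od nc nd ->]]].
exists (a * c), (b * d); split; rewrite ?isO_M //; try exact: fp_notM.
by field; rewrite !fp_n0.
Qed.

Lemma unitP_V x : unitP x -> unitP x^-1.
Proof. by case=> a [b [Oa Ob na nb ->]]; exists b, a; rewrite invf_div. Qed.

Lemma unitP_X x n : unitP x -> unitP (x ^+ n).
Proof.
move=> ux; elim: n => [|n IH]; last by rewrite exprS; exact: unitP_M.
by apply: unitP_O; [exact: isO_1 | exact: (fp_proper fP)].
Qed.

Lemma unitP_root n x : (0 < n)%N -> unitP (x ^+ n) -> unitP x.
Proof.
case: n => // n _ [a [b [Oa Ob na nb E]]]; have b0 := fp_n0 nb.
have E' : (x * b) ^+ n.+1 = a * b ^+ n by rewrite exprMn E exprS; field.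
have Oxb : isO (x * b) by apply: (@isO_root n.+1) => //; rewrite E' isO_M ?isO_X.
exists (x * b), b; split=> //; last by rewrite mulfK.
move=> Pxb; have : P ((x * b) ^+ n.+1) by rewrite exprSr; apply: fpM => //; exact: isO_X.
by rewrite E'; apply: fp_notM => //; [exact: isO_X | exact: fp_notX].
Qed.

Lemma locP_root n x : (0 < n)%N -> locP (x ^+ n) -> locP x.
Proof.
case: n => // n _ [a [b [Oa Ob nb E]]]; have b0 := fp_n0 nb.
have E' : (x * b) ^+ n.+1 = a * b ^+ n by rewrite exprMn E exprS; field.
have Oxb : isO (x * b) by apply: (@isO_root n.+1) => //; rewrite E' isO_M ?isO_X.
by exists (x * b), b; rewrite mulfK.
Qed.

Lemma locP_unit x : locP x -> ~ local_max P x -> unitP x.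
Proof.
case=> a [b [Oa Ob nb xE]] nmax; exists a, b; split=> // Pa; apply: nmax.
by exists a, b; split=> //; apply/alg_integer_isO.
Qed.

End AtPrime.

Lemma conj_finite_prime P : finite_prime P -> finite_prime (fun x => P (conj x)).
Proof.
move=> fP; split.
- by move=> x Px; apply/alg_integer_isO; rewrite -[x]conjK; apply/isO_conj/(fpO fP).
- by have := conj_inK 0; rewrite rmorph0 => ->; exact: fp_zero fP.
- by move=> x y Px Py; rewrite conjD; exact: fp_add.
- move=> a x /alg_integer_isO Oa Px; rewrite conjM; apply: (fpM fP) => //; exact: isO_conj.
- by have := conj_inK 1; rewrite rmorph1 => ->; exact: fp_proper fP.
- move=> x y /alg_integer_isO /isO_conj Ox /alg_integer_isO /isO_conj Oy; rewrite conjM.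
  by apply: (fp_prime fP); apply/alg_integer_isO.
by have [x Px x0] := fp_nonzero fP; exists (conj x); rewrite ?conjK // conj_eq0.
Qed.

Lemma split_or_inert l : (0 < l)%N ->
  (exists c : int, (l %| c ^+ 2 - m%:Z)%Z) \/ nonresidue l (- m%:Z).
Proof.
move=> l0; case: (boolP (all (fun t : nat => ~~ (l %| t%:Z ^+ 2 + - m%:Z)%Z) (iota 0 l))) => [H|/allPn[c _]].
  by right; exact: nonresidue_check.
by rewrite negbK => lc; left; exists c%:Z.
Qed.

Lemma prime_exists l : prime l -> exists2 P, finite_prime P & P (l%:R : K).
Proof.
move=> pl; have [[c lc]|nr] := split_or_inert (prime_gt0 pl).
  exists (split_prime l c); first exact: split_prime_finite.
  by exists l%:Z, 0; rewrite mul0r addr0 mul0r addr0.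
exists (inert_prime l); first exact: inert_prime_finite.
by exists 1, 0; rewrite mulr1 mulr0 mul0r addr0.
Qed.

Lemma dvdz_pow_cancel (l N : nat) (T n : int) : prime l -> ~~ ((l ^ 2)%N %| T)%Z ->
  ((l ^ N.+2)%N %| T * n)%Z -> ((l ^ N.+1)%N %| n)%Z.
Proof.
move=> pl T2 H; case: (boolP (l %| T)%Z) => lT; last first.
  have c : coprimez (l ^ N.+1)%N T by rewrite coprimezE coprimeXl // prime_coprime.
  rewrite -(Gauss_dvdzr n c); apply: dvdz_trans H.
  by rewrite dvdzE /= dvdn_exp2l.
case/dvdzP: lT T2 H => h ->; have l0 : l%:Z != 0 by rewrite -lt0n prime_gt0.
rewrite expnS expn1 PoszM dvdz_mul2r // => lh.
rewrite [in (l ^ N.+2)%N]expnSr PoszM mulrAC dvdz_mul2r //.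
by rewrite Gauss_dvdzr // coprimezE coprimeXl // prime_coprime.
Qed.

(** The element [t] replaces a generator of the conjugate prime: x -> t x / l lowers the valuation
    at P by one and preserves integrality on P. In the inert case t = 1. *)
Lemma unramified_prime l : prime l -> l != 2%N -> ~~ (l %| m)%N ->
  exists P, [/\ finite_prime P, P (l%:R : K) &
    exists (t : K) (T : int), [/\ isO t, ~ P t, nm t = T%:~R, ~~ ((l ^ 2)%N %| T)%Z &
      forall x, P x -> exists2 y, isO y & t * x = l%:R * y]].
Proof.
move=> pl l2 lm; have [[c0 lc0]|nr] := split_or_inert (prime_gt0 pl); last first.
  exists (inert_prime l); split; first exact: inert_prime_finite.
    by exists 1, 0; rewrite mulr1 mulr0 mul0r addr0.
  exists 1, 1; split; [exact: isO_1 | exact: (fp_proper (inert_prime_finite pl nr)) | | |].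
  - by rewrite -(rmorph1 iK) nm_inK expr1n.
  - by rewrite dvdzE dvdn1 -[1%N](exp1n 2) eqn_exp2r //; apply: contraTneq pl => ->.
  move=> x [a [b ->]]; exists (a%:~R + b%:~R * s); first exact: isO_mk.
  by rewrite !rmorphM /=; ring.
have l0 : l%:Z != 0 by rewrite -lt0n prime_gt0.
have lc0' : ~~ (l %| c0)%Z.
  apply: contra lm => lc; rewrite -[m]/(absz m) -[l]/(absz l) -dvdzE.
  have -> : m%:Z = c0 * c0 - (c0 ^+ 2 - m%:Z) by ring.
  by rewrite rpredB // dvdz_mulr.
have l2z : ~~ (l %| 2)%Z by rewrite dvdzE dvdn_prime2.
(* Passing from [c0] to c0 + l changes c0^2 - m by l (2 c0 + l), which is not divisible by l^2. *)
have [c [lc lc' lc2]] : exists c : int, [/\ (l %| c ^+ 2 - m%:Z)%Z, ~~ (l %| c)%Z &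
    ~~ ((l ^ 2)%N %| c ^+ 2 - m%:Z)%Z].
  have [H|H] := boolP ((l ^ 2)%N %| c0 ^+ 2 - m%:Z)%Z; last by exists c0.
  exists (c0 + l); split.
  - have -> : (c0 + l%:Z) ^+ 2 - m%:Z = (c0 ^+ 2 - m%:Z) + l%:Z * (2 * c0 + l) by ring.
    by rewrite rpredD // dvdz_mulr.
  - apply: contra lc0' => d; have -> : c0 = (c0 + l) - l%:Z by ring.
    by rewrite rpredB.
  apply/negP => H'; have : ((l ^ 2)%N %| l%:Z * (2 * c0 + l))%Z.
    have -> : l%:Z * (2 * c0 + l) = ((c0 + l%:Z) ^+ 2 - m%:Z) - (c0 ^+ 2 - m%:Z) by ring.
    exact: rpredB.
  rewrite expnS expn1 PoszM dvdz_mul2l // => H2.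
  have : (l %| 2 * c0)%Z.
    have -> : 2 * c0 = (2 * c0 + l) - l%:Z by ring.
    by rewrite rpredB.
  by rewrite prime_dvdzM // (negbTE l2z) (negbTE lc0').
have fP := split_prime_finite pl lc.
exists (split_prime l c); split=> //.
  by exists l%:Z, 0; rewrite mul0r addr0 mul0r addr0.
exists (c%:~R + 1%:~R * s), (c ^+ 2 - m%:Z); split.
- exact: isO_mk.
- case=> a [b [/int_coord[<- <-]]]; rewrite mul1r (_ : c + c = 2 * c); last by ring.
  by rewrite prime_dvdzM // (negbTE l2z) (negbTE lc').
- by rewrite nm_int expr1n mulr1.
- by [].
move=> x [a [b [-> lab]]]; rewrite int_mulE.
have /dvdzP[u uE] : (l %| c * a + m%:Z * 1 * b)%Z.
  have -> : c * a + m%:Z * 1 * b = c * (a + b * c) - (c ^+ 2 - m%:Z) * b by ring.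
  by rewrite rpredB ?(dvdz_mull _ lab) ?(dvdz_mulr _ lc).
have /dvdzP[v vE] : (l %| c * b + 1 * a)%Z by rewrite mul1r addrC mulrC.
exists (u%:~R + v%:~R * s); first exact: isO_mk.
by rewrite uE vE !rmorphM /=; ring.
Qed.

(* Elements with u^2 l a unit at P would have half-integral valuation. *)
Lemma no_half_valuation l : prime l -> l != 2%N -> ~~ (l %| m)%N ->
  exists P, [/\ finite_prime P, P (l%:R : K) &
    forall u : K, u != 0 -> ~ unitP P (l%:R * u ^+ 2)].
Proof.
move=> pl l2 lm; have [P [fP Pl [t [T [Ot nPt tT T2 tP]]]]] := unramified_prime pl l2 lm.
have lK0 : l%:R != 0 :> K by rewrite -(rmorph_nat iK) fmorph_eq0 pnatr_eq0 -lt0n prime_gt0.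
exists P; split=> //.
have t0 := fp_n0 fP nPt.
(* Both [a] and [b] lie in P. Replacing them by t a / l and t b / l keeps the equation and
   multiplies the norm of [b] by T / l^2, where l^2 does not divide [T]; iterating, every power of
   [l] divides that norm. *)
have descent (N : nat) : forall a b x y : K, isO a -> isO b -> isO x -> isO y -> ~ P x -> ~ P y ->
    a != 0 -> b != 0 -> l%:R * a ^+ 2 * x = b ^+ 2 * y ->
    forall n : int, nm b = n%:~R -> ((l ^ N)%N %| n)%Z.
  elim: N => [|N IH] a b x y Oa Ob Ox Oy nx ny a0 b0 E n nE; first by rewrite expn0 dvdzE dvd1n.
  have Pb : P b.
    have : P (b ^+ 2 * y) by rewrite -E -mulrA mulrC; apply: (fpM fP) => //; rewrite isO_M ?isO_X.
    by case/(fp_primeM fP (isO_X 2 Ob) Oy) => // /(fp_primeX fP Ob).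
  have [b' Ob' b'E] := tP _ Pb.
  have E1 : t ^+ 2 * a ^+ 2 * x = l%:R * b' ^+ 2 * y.
    apply: (mulfI lK0); transitivity (t ^+ 2 * (l%:R * a ^+ 2 * x)); first by ring.
    by rewrite E -[LHS]/(t ^+ 2 * (b ^+ 2 * y)) mulrA -exprMn b'E; ring.
  have Pa : P a.
    have : P (t ^+ 2 * a ^+ 2 * x).
      by rewrite E1 -mulrA mulrC; apply: (fpM fP) => //; rewrite isO_M ?isO_X.
    case/(fp_primeM fP (isO_M (isO_X 2 Ot) (isO_X 2 Oa)) Ox) => //.
    by case/(fp_primeM fP (isO_X 2 Ot) (isO_X 2 Oa)) => [/(fp_primeX fP Ot)|/(fp_primeX fP Oa)].
  have [a' Oa' a'E] := tP _ Pa.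
  have E2 : l%:R * a' ^+ 2 * x = b' ^+ 2 * y.
    apply: (mulfI lK0); transitivity ((t * a) ^+ 2 * x); first by rewrite a'E; ring.
    by rewrite exprMn E1; ring.
  have a'0 : a' != 0.
    by apply: contra (mulf_neq0 t0 a0) => /eqP a'0; rewrite a'E a'0 mulr0.
  have b'0 : b' != 0.
    by apply: contra (mulf_neq0 t0 b0) => /eqP b'0; rewrite b'E b'0 mulr0.
  have /intrP[n' n'E] := isO_nm Ob'.
  have H := IH a' b' x y Oa' Ob' Ox Oy nx ny a'0 b'0 E2 n' n'E.
  apply: (@dvdz_pow_cancel l N T) => //.
  have -> : T * n = (l ^ 2)%N%:Z * n'.
    apply: (@intr_inj rat); rewrite !rmorphM /= -tT -nE -n'E -nmM b'E nmM.
    by rewrite -(rmorph_nat iK) nm_inK expr2.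
  have -> : (l ^ N.+2)%N%:Z = (l ^ 2)%N%:Z * (l ^ N)%N%:Z by rewrite -PoszM -expnD.
  exact: dvdz_mul.
move=> u u0 [x [y [Ox Oy nx ny E]]].
pose d := denq (re u) * denq (im u).
have dK0 : d%:~R != 0 :> K.
  by rewrite -(rmorph_int iK) fmorph_eq0 intr_eq0 mulf_neq0 ?denq_neq0.
pose du := u * d%:~R.
have Odu : isO du.
  have -> : du = (numq (re u) * denq (im u))%:~R + (denq (re u) * numq (im u))%:~R * s.
    by rewrite /du {1}(coord u) /d -!(rmorph_int iK) !intrM !numqE !rmorphM /=; ring.
  exact: isO_mk.
have du0 : du != 0 by rewrite mulf_neq0.
have y0 := fp_n0 fP ny.
have E1 : l%:R * du ^+ 2 * y = d%:~R ^+ 2 * x.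
  by transitivity ((l%:R * u ^+ 2) * (y * d%:~R ^+ 2)); [rewrite /du; ring | rewrite E; field].
have nmd : nm d%:~R = (d ^+ 2)%:~R by rewrite -(rmorph_int iK) nm_inK; ring.
have := descent (absz (d ^+ 2)) du d%:~R y x Odu (isO_int _) Oy Ox ny nx du0 dK0 E1 _ nmd.
rewrite dvdzE /= => /dvdn_leq; rewrite absz_gt0 expf_neq0 ?mulf_neq0 ?denq_neq0 // => /(_ isT).
by rewrite leqNgt ltn_expl // prime_gt1.
Qed.

Lemma unitP_conj P w : unitP (fun x => P (conj x)) w -> unitP P (conj w).
Proof.
by case=> a [b [Oa Ob na nb ->]]; exists (conj a), (conj b); rewrite conjM conjV !isO_conj.
Qed.

Lemma fp_conj_nat P (l : nat) : P (l%:R : K) -> P (conj l%:R).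
Proof. by rewrite (conj_int l). Qed.

Lemma unitP_int P l (n : int) : finite_prime P -> prime l -> P (l%:R : K) -> ~~ (l %| n)%Z -> unitP P n%:~R.
Proof.
move=> fP pl Pl ln; apply: (unitP_O fP); first exact: isO_int.
by move/(fp_int fP pl Pl); rewrite (negbTE ln).
Qed.

(** * Elements of even valuation *)

Definition locally_square P x := exists2 u, u != 0 & unitP P (x / u ^+ 2).

Lemma unitP_sign P w (sg : bool) : finite_prime P -> unitP P w -> unitP P ((-1) ^+ sg * w).
Proof.
move=> fP; case: sg; last by rewrite mul1r.
rewrite expr1 mulN1r => -[a [b [Oa Ob na nb ->]]]; exists (- a), b; split=> //.
- exact: isO_N.
- by move/(fpN fP); rewrite opprK.
by rewrite mulNr.
Qed.

Lemma class_prime l k (sg : bool) (x nu : K) : prime l -> l != 2%N -> ~~ (l %| m)%N ->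
  squarefree k -> (l %| k)%N -> nu != 0 -> x = (-1) ^+ sg * k%:R * nu ^+ 2 ->
  (forall P, finite_prime P -> P (l%:R : K) -> locally_square P x) -> False.
Proof.
move=> pl l2 lm sk lk nu0 xE H.
have [P [fP Pl nP]] := no_half_valuation pl l2 lm.
have [u u0 ux] := H P fP Pl.
case/dvdnP: lk sk xE => k' -> sk xE.
have lk' : ~~ (l %| k'%:Z)%Z.
  by apply: contra (sk l pl) => lk'; rewrite expnS expn1 dvdn_mul.
have uk' := unitP_int fP pl Pl lk'.
have k'0 := unitP_n0 fP uk'.
apply: (nP (nu / u)); first by rewrite mulf_neq0 ?invr_eq0.
have -> : l%:R * (nu / u) ^+ 2 = (-1) ^+ sg * (x / u ^+ 2 * (k'%:Z%:~R)^-1).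
  rewrite xE natrM mulrA; case: sg {xE} => /=; field; rewrite u0 andbT; exact: k'0.
by apply/unitP_sign/unitP_M/unitP_V.
Qed.

(** For unramified [l], the element and its conjugate both have even valuation at P, hence so has
    the norm, whose squarefree part is then prime to [l]. If [l] divides [m], units at the prime
    above [l] have norms prime to [l], so the norm of x has even valuation at [l]. *)
Lemma norm_prime l k (sg : bool) (n : rat) (x : K) : prime l -> l != 2%N ->
  x != 0 -> squarefree k -> n != 0 -> nm x = (-1) ^+ sg * k%:R * n ^+ 2 ->
  (forall P, finite_prime P -> P (l%:R : K) -> locally_square P x) -> ~~ (l %| k)%N.
Proof.
move=> pl l2 x0 sk n0 xE H; apply/negP => lk.
have [lm|lm] := boolP (l %| m)%N; last first.
  have [P [fP Pl nP]] := no_half_valuation pl l2 lm.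
  have [u u0 ux] := H P fP Pl.
  have [u' u'0 u'x] := H _ (conj_finite_prime fP) (fp_conj_nat Pl).
  have {}u'x := unitP_conj u'x.
  case/dvdnP: lk sk xE => k' -> sk xE.
  have lk' : ~~ (l %| k'%:Z)%Z.
    by apply: contra (sk l pl) => lk'; rewrite expnS expn1 dvdn_mul.
  have uk' := unitP_int fP pl Pl lk'.
  have k'0 := unitP_n0 fP uk'.
  have cu'0 : conj u' != 0 by rewrite conj_eq0.
  have nK0 : n%:K != 0 by rewrite fmorph_eq0.
  apply: (nP (n%:K / (u * conj u'))); first by rewrite !mulf_neq0 ?invr_eq0 ?mulf_neq0.
  have -> : l%:R * (n%:K / (u * conj u')) ^+ 2 =
      (-1) ^+ sg * ((x / u ^+ 2) * (conj (x / u' ^+ 2)) * (k'%:Z%:~R)^-1).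
    have -> : x / u ^+ 2 * conj (x / u' ^+ 2) = (x * conj x) / (u ^+ 2 * conj u' ^+ 2).
      by rewrite conjM conjV conjX; field; rewrite ?u0 ?cu'0.
    rewrite -nmE xE natrM.
    by case: sg {xE} => /=; field; rewrite u0 cu'0 !andbT; exact: k'0.
  by apply/unitP_sign/unitP_M/unitP_V => //; exact: unitP_M.
have lc : (l %| 0 ^+ 2 - m%:Z)%Z by rewrite expr0n sub0r dvdzE abszN.
have fP := split_prime_finite pl lc.
have Pl : split_prime l 0 l%:R by exists l%:Z, 0; rewrite mul0r addr0 mul0r addr0.
have [u u0 [a [b [Oa Ob na nb ab]]]] := H _ fP Pl.
have Pconj z : split_prime l 0 (conj z) -> split_prime l 0 z.
  case=> c [d [E lcd]]; exists c, (- d); split; last by move: lcd; rewrite !mulr0.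
  by rewrite -[z]conjK E conjD conjM !conj_int conj_s rmorphN; ring.
have nmZ z : isO z -> ~ split_prime l 0 z -> exists2 A : int, nm z = A%:~R & ~~ (l %| A)%Z.
  move=> Oz nz; have /intrP[A AE] := isO_nm Oz; exists A => //.
  apply/negP => /dvdzP[A' A'E].
  have : split_prime l 0 (z * conj z).
    rewrite -nmE AE rmorph_int A'E rmorphM /=.
    by apply: (fpM fP) => //; exact: isO_int.
  case/(fp_primeM fP Oz (isO_conj Oz)) => // /Pconj; exact: nz.
have [A AE lA] := nmZ a Oa na; have [B BE lB] := nmZ b Ob nb.
have a0 := fp_n0 fP na; have b0 := fp_n0 fP nb.
case/dvdnP: lk sk xE => k' -> sk xE.
have lk' : ~~ (l %| k'%:Z)%Z.
  by apply: contra (sk l pl) => lk'; rewrite expnS expn1 dvdn_mul.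
have A0 : A%:~R != 0 :> rat by rewrite -AE nm_eq0.
have B0 : B%:~R != 0 :> rat by rewrite -BE nm_eq0.
have E : nm u ^+ 2 * A%:~R = (-1) ^+ sg * (k' * l)%N%:R * n ^+ 2 * B%:~R.
  rewrite -xE -AE -BE -!nmX -!nmM; congr nm.
  have -> : x = u ^+ 2 * (a / b) by rewrite -ab; field.
  by field.
suff n00 : n = 0 by rewrite n00 eqxx in n0.
apply: (@rat_odd_valuation l ((-1) ^+ sg * (k'%:Z * (A * B))) (nm u * A%:~R) n) => //.
  rewrite !prime_dvdzM // (negbTE lA) (negbTE lB) (negbTE lk') !orbF.
  by rewrite dvdzE abszX /= exp1n dvdn1; apply: contraTneq pl => ->.
transitivity ((nm u ^+ 2 * A%:~R) * A%:~R); first by ring.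
by rewrite E natrM; case: sg {E xE} => /=; ring.
Qed.

(** Explicit Hilbert 90: w = x + n satisfies conj w * x = n w, so that x = n w / conj w = (n / nm w)
    w^2 is rational up to a square. If w = 0, then x itself is rational. *)
Lemma hilbert90_class (x : K) (n : rat) : x != 0 -> nm x = n ^+ 2 ->
  exists (sg : bool) (k : nat) (nu : K), [/\ x = (-1) ^+ sg * k%:R * nu ^+ 2, squarefree k, (0 < k)%N & nu != 0].
Proof.
move=> x0 E.
have n0 : n != 0 by rewrite -sqrf_eq0 -E nm_eq0.
have nK0 : n%:K != 0 by rewrite fmorph_eq0.
have [q [nu [xE q0 nu0]]] : exists (q : rat) (nu : K), [/\ x = q%:K * nu ^+ 2, q != 0 & nu != 0].
  have [xn|xn] := eqVneq x (- n%:K).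
    by exists (- n), 1; rewrite expr1n mulr1 rmorphN oppr_eq0 oner_neq0.
  have w0 : x + n%:K != 0 by rewrite addr_eq0.
  exists (n / nm (x + n%:K)), (x + n%:K); split=> //; last by rewrite mulf_neq0 // invr_eq0 nm_eq0.
  have wE : conj (x + n%:K) * x = n%:K * (x + n%:K).
    by rewrite conjD conj_inK mulrDl mulrC -nmE E rmorphXn /=; ring.
  have cw0 : conj (x + n%:K) != 0 by rewrite conj_eq0.
  apply: (mulfI cw0); rewrite wE fmorph_div nmE.
  by field; rewrite w0 cw0.
have [k [sg [r [qE k0 sk r0]]]] := rat_squarefree q0.
exists sg, k, (r%:K * nu); split=> //; last by rewrite mulf_neq0 // fmorph_eq0.
by rewrite xE qE; case: sg {qE} => /=; ring.
Qed.

Lemma fp_not_coprime P (l l' : nat) : finite_prime P -> prime l -> prime l' -> l != l' ->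
  P (l%:R : K) -> ~ P (l'%:R : K).
Proof.
move=> fP pl pl' ll' Pl Pl'; have := @fp_int P l fP pl Pl l' Pl'.
by rewrite dvdzE /= dvdn_prime2 // (negbTE ll').
Qed.

(* An element that is integral at all primes is integral: the denominators b with
   b x integral avoid each of the two conjugate primes over l, hence some
   combination avoids both. *)
Lemma locally_integral x : (forall P, finite_prime P -> locP P x) -> isO x.
Proof.
move=> H; pose d := absz (denq (re x) * denq (im x)).
have d0 : (0 < d)%N by rewrite absz_gt0 mulf_neq0 ?denq_neq0.
have Od : isO (d%:R * x).
  have dE : (d%:R : K) = (denq (re x) * denq (im x))%:~R.
    by rewrite -[d%:R]/(d%:Z%:~R) gez0_abs // mulr_ge0 ?denq_ge0.
  have -> : d%:R * x = (numq (re x) * denq (im x))%:~R + (denq (re x) * numq (im x))%:~R * s.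
    by rewrite {1}(coord x) dE -!(rmorph_int iK) !intrM !numqE !rmorphM /=; ring.
  exact: isO_mk.
elim/ltn_ind: d d0 Od => d IH d0 Od.
have [d1|d1] := eqVneq d 1%N; first by move: Od; rewrite d1 mul1r.
have dgt1 : (1 < d)%N by rewrite ltn_neqAle eq_sym d1.
pose l := pdiv d; have pl : prime l by exact: pdiv_prime.
have /dvdnP[e dE] : (l %| d)%N by exact: pdiv_dvd.
have e0 : (0 < e)%N by move: d0; rewrite dE; case: e {dE}.
have ed : (e < d)%N by rewrite dE ltn_Pmulr // prime_gt1.
apply: (IH e) => //; pose y := e%:R * x.
have Oly : isO (l%:R * y) by rewrite /y mulrA -natrM mulnC -dE.
have [P fP Pl] := prime_exists pl.
have loc Q : finite_prime Q -> exists b, [/\ isO b, ~ Q b & isO (b * y)].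
  move=> fQ; have [a [b [Oa Ob nb xE]]] := H Q fQ; exists b; split=> //.
  have -> : b * y = e%:R * a by rewrite /y xE; field; exact: (fp_n0 fQ nb).
  by rewrite isO_M ?isO_nat.
have [b [Ob nb Oby]] := loc P fP.
have [b' [Ob' nb' Ob'y]] := loc _ (conj_finite_prime fP).
have [c [Oc nc nc' Ocy]] : exists c, [/\ isO c, ~ P c, ~ P (conj c) & isO (c * y)].
  have /intrP[B BE] := isO_nm Ob; have /intrP[B' B'E] := isO_nm Ob'.
  have nP z (Z : int) : isO z -> nm z = Z%:~R -> P (z * conj z) <-> (l %| Z)%Z.
    move=> Oz ZE; rewrite -nmE ZE rmorph_int; split; first exact: fp_int.
    case/dvdzP=> Z' ->; rewrite rmorphM /=; apply: (fpM fP) => //; exact: isO_int.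
  case: (boolP (l %| B)%Z) => [lB|lB]; last first.
    exists b; split=> // Pcb; move/negP: lB; apply; apply/(nP _ _ Ob BE).
    by apply: (fpM fP).
  case: (boolP (l %| B')%Z) => [lB'|lB']; last first.
    exists b'; split=> // Pb'; move/negP: lB'; apply; apply/(nP _ _ Ob' B'E).
    by rewrite mulrC; apply: (fpM fP) => //; exact: isO_conj.
  have Pcb : P (conj b) by have /(nP _ _ Ob BE)/(fp_primeM fP Ob (isO_conj Ob))[] := lB.
  have Pb' : P b' by have /(nP _ _ Ob' B'E)/(fp_primeM fP Ob' (isO_conj Ob'))[] := lB'.
  exists (b + b'); split.
  - exact: isO_D.
  - by move=> Pbb; apply: nb; rewrite -[b](addrK b'); exact: (fpB fP).
  - rewrite conjD => Pbb; apply: nb'.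
    have -> : conj b' = (conj b + conj b') - conj b by ring.
    exact: (fpB fP).
  - by rewrite mulrDl isO_D.
have /intrP[C CE] := isO_nm Oc.
have lC : ~~ (l %| C)%Z.
  apply/negP => /dvdzP[C' C'E]; have : P (c * conj c).
    by rewrite -nmE CE rmorph_int C'E rmorphM /=; apply: (fpM fP) => //; exact: isO_int.
  by case/(fp_primeM fP Oc (isO_conj Oc)).
have clC : coprimez l C by rewrite coprimezE prime_coprime.
have [[u v] /= bez] := coprimezP _ _ clC.
rewrite -/y; have -> : y = u%:~R * (l%:R * y) + v%:~R * (conj c * (c * y)).
  have -> : conj c * (c * y) = C%:~R * y by rewrite mulrA [conj c * c]mulrC -nmE CE rmorph_int.
  transitivity ((u * l%:Z + v * C)%:~R * y); first by rewrite bez mul1r.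
  by rewrite rmorphD !rmorphM /=; ring.
by apply: isO_D; apply: isO_M; rewrite ?isO_int //; apply: isO_M; rewrite ?isO_conj.
Qed.

(** * Reduction modulo 8 and integral models *)

Definition red x : z8 := ((numq (re x))%:~R, (numq (im x))%:~R).

Lemma red_mk (a b : int) : red (a%:~R + b%:~R * s) = (a%:~R, b%:~R).
Proof. by rewrite /red -!(rmorph_int iK) reE imE !numq_int. Qed.

Lemma redD x y : isO x -> isO y -> red (x + y) = red x + red y.
Proof.
move=> /isOP[a [b ->]] /isOP[a' [b' ->]].
have -> : a%:~R + b%:~R * s + (a'%:~R + b'%:~R * s) = (a + a')%:~R + (b + b')%:~R * s.
  by rewrite !rmorphD /=; ring.
by rewrite !red_mk !rmorphD.
Qed.

Lemma redN x : isO x -> red (- x) = - red x.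
Proof.
move=> /isOP[a [b ->]].
have -> : - (a%:~R + b%:~R * s) = (- a)%:~R + (- b)%:~R * s by rewrite !rmorphN /=; ring.
by rewrite !red_mk !rmorphN.
Qed.

Lemma redM x y : isO x -> isO y -> red (x * y) = mul8 m%:R (red x) (red y).
Proof.
move=> /isOP[a [b ->]] /isOP[a' [b' ->]].
rewrite int_mulE !red_mk /mul8 /= !rmorphD !rmorphM /=; congr (_, _); ring.
Qed.

Lemma red_int (n : int) : red n%:~R = (n%:~R, 0).
Proof. by have := red_mk n 0; rewrite mul0r addr0 => ->. Qed.

Lemma red_nat (n : nat) : red n%:R = (n%:R, 0).
Proof. exact: (red_int n). Qed.

Lemma red1 : red 1 = (1, 0). Proof. exact: (red_nat 1). Qed.

Lemma red0 : red 0 = 0. Proof. exact: (red_nat 0). Qed.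

Lemma redX x n : isO x -> red (x ^+ n) = exp8 m%:R (red x) n.
Proof.
move=> Ox; elim: n => [|n IH]; first exact: red1.
by rewrite exprS redM ?isO_X // IH.
Qed.

Lemma red_natM (n : nat) x : isO x -> red (n%:R * x) = red x *+ n.
Proof.
move=> Ox; rewrite mulr_natl; elim: n => [|n IH]; first exact: red0.
by rewrite !mulrS redD ?IH // -mulr_natl isO_M ?isO_nat.
Qed.

Lemma red_8 x : isO x -> red (8 * x) = 0.
Proof.
move=> /isOP[a [b ->]].
have -> : 8 * (a%:~R + b%:~R * s) = (8 * a)%:~R + (8 * b)%:~R * s by rewrite !rmorphM /=; ring.
by rewrite red_mk !rmorphM /= (_ : 8%:~R = 0 :> 'Z_8) ?mul0r //; apply/eqP.
Qed.

Lemma split_prime_red (c : int) x : isO x -> split_prime 2 c x <-> ~~ odd8 c%:~R (red x).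
Proof.
move=> /isOP[a [b ->]]; rewrite red_mk /odd8 [fst _]/= [snd _]/= -intrM -intrD [c * b]mulrC odd_Z8 negbK.
split=> [[a' [b' [/int_coord[-> ->]]]] //|H]; by exists a, b.
Qed.

Lemma red_nm x (N : int) : isO x -> nm x = N%:~R ->
  N%:~R = (red x).1 * (red x).1 - m%:R * ((red x).2 * (red x).2).
Proof.
move=> /isOP[a [b ->]]; rewrite nm_int => /intr_inj <-; rewrite red_mk /=.
by rewrite rmorphB [X in _ - X]rmorphM /= !rmorphXn /=; ring.
Qed.

Ltac isO_tac := repeat first [assumption | apply: isO_nat | apply: isO_int | apply: isO_1 | apply: isO_D
  | apply: isO_N | apply: isO_M | apply: isO_X].

Ltac locP_tac fP := repeat first [assumption | apply: (locP_O fP (isO_nat _)) | apply: (locP_D fP)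
  | apply: (locP_N fP) | apply: (locP_M fP) | apply: (locP_X fP)].

Lemma unitP_notP P x : finite_prime P -> isO x -> unitP P x -> ~ P x.
Proof.
move=> fP Ox [a [b [Oa Ob na nb xE]]] Px; apply: na.
have -> : a = b * x by rewrite xE; field; exact: (fp_n0 fP nb).
exact: (fpM fP).
Qed.

Lemma good_local P W : finite_prime P -> elliptic W -> good_reduction_at P W ->
  exists u r t v, u != 0 /\ let W' := change_vars W u r t v in
  [/\ locP P (a1 W'), locP P (a2 W'), locP P (a3 W'), locP P (a4 W') & locP P (a6 W')] /\ unitP P (disc W').
Proof.
move=> fP ell [W' [[u [r [t [v [u0 ->]]]]] [[H1 H2 H3 H4 H6] _] nm]].
exists u, r, t, v; split=> //; split; first by split; apply/local_integer_locP.
apply: locP_unit => //; rewrite /disc /b2 /b4 /b6 /b8.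
move: H1 H2 H3 H4 H6; set V := change_vars _ _ _ _ _.
move=> /local_integer_locP H1 /local_integer_locP H2 /local_integer_locP H3
  /local_integer_locP H4 /local_integer_locP H6.
by locP_tac fP.
Qed.

Lemma good_invariants P W : finite_prime P -> elliptic W -> good_reduction_at P W ->
  exists u, [/\ u != 0, locP P (c4 W / u ^+ 4), locP P (c6 W / u ^+ 6) & unitP P (disc W / u ^+ 12)].
Proof.
move=> fP ell /(good_local fP ell)[u [r [t [v [u0 [[H1 H2 H3 H4 H6] ud]]]]]].
have [E4 E6 Ed] := change_vars_invariants W r t v u0; exists u; rewrite -E4 -E6 -Ed.
by split=> //; rewrite /c4 /c6 /b2 /b4 /b6; locP_tac fP.
Qed.

Definition isO_model (W : weierstrass K) := [/\ isO (a1 W), isO (a2 W), isO (a3 W), isO (a4 W) & isO (a6 W)].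

Lemma isO_disc W : isO_model W -> isO (disc W).
Proof. by case=> *; rewrite /disc /b2 /b4 /b6 /b8; isO_tac. Qed.

(** The coefficients of a model good at P have a common denominator outside P. Scaling by it gives a
    model that is integral at all primes and still has unit discriminant at P. *)
Lemma integral_good_model P W : finite_prime P -> elliptic W -> good_reduction_at P W ->
  exists u W', [/\ u != 0, isO_model W', ~ P (disc W') &
    [/\ c4 W' = c4 W / u ^+ 4, c6 W' = c6 W / u ^+ 6 & disc W' = disc W / u ^+ 12]].
Proof.
move=> fP ell /(good_local fP ell)[u [r [t [v [u0 [HW ud]]]]]].
have := change_vars_invariants W r t v u0; move: HW ud; move: (change_vars W u r t v) => W1.
move=> [[x1 [y1 [Ox1 Oy1 n1 E1]]] [x2 [y2 [Ox2 Oy2 n2 E2]]] [x3 [y3 [Ox3 Oy3 n3 E3]]]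
  [x4 [y4 [Ox4 Oy4 n4 E4]]] [x6 [y6 [Ox6 Oy6 n6 E6]]]] ud /= [C4 C6 D].
pose n := y1 * y2 * y3 * y4 * y6.
have On : isO n by rewrite /n; isO_tac.
have nn : ~ P n by rewrite /n; do 4 (apply: (fp_notM fP) => //; try by isO_tac).
have n0 := fp_n0 fP nn; have ni0 : n^-1 != 0 by rewrite invr_eq0.
have y10 := fp_n0 fP n1; have y20 := fp_n0 fP n2; have y30 := fp_n0 fP n3.
have y40 := fp_n0 fP n4; have y60 := fp_n0 fP n6.
have [C4' C6' D'] := change_vars_invariants W1 0 0 0 ni0.
have Om : isO_model (change_vars W1 n^-1 0 0 0).
  split.
  - have -> : a1 (change_vars W1 n^-1 0 0 0) = x1 * (y2 * y3 * y4 * y6) * n ^+ 0.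
      by rewrite /= ?E1 ?E2 ?E3 ?E4 ?E6 /n; field; rewrite ?y10 ?y20 ?y30 ?y40 ?y60 ?oner_neq0.
    by isO_tac.
  - have -> : a2 (change_vars W1 n^-1 0 0 0) = x2 * (y1 * y3 * y4 * y6) * n ^+ 1.
      by rewrite /= ?E1 ?E2 ?E3 ?E4 ?E6 /n; field; rewrite ?y10 ?y20 ?y30 ?y40 ?y60 ?oner_neq0.
    by isO_tac.
  - have -> : a3 (change_vars W1 n^-1 0 0 0) = x3 * (y1 * y2 * y4 * y6) * n ^+ 2.
      by rewrite /= ?E1 ?E2 ?E3 ?E4 ?E6 /n; field; rewrite ?y10 ?y20 ?y30 ?y40 ?y60 ?oner_neq0.
    by isO_tac.
  - have -> : a4 (change_vars W1 n^-1 0 0 0) = x4 * (y1 * y2 * y3 * y6) * n ^+ 3.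
      by rewrite /= ?E1 ?E2 ?E3 ?E4 ?E6 /n; field; rewrite ?y10 ?y20 ?y30 ?y40 ?y60 ?oner_neq0.
    by isO_tac.
  - have -> : a6 (change_vars W1 n^-1 0 0 0) = x6 * (y1 * y2 * y3 * y4) * n ^+ 5.
      by rewrite /= ?E1 ?E2 ?E3 ?E4 ?E6 /n; field; rewrite ?y10 ?y20 ?y30 ?y40 ?y60 ?oner_neq0.
    by isO_tac.
exists (u / n), (change_vars W1 n^-1 0 0 0); split=> //.
- by rewrite mulf_neq0.
- apply: (unitP_notP fP); first exact: isO_disc.
  rewrite D'; apply: (unitP_M fP) => //; apply: unitP_V; apply: (unitP_X fP); apply: unitP_V.
  exact: (unitP_O fP).
by rewrite C4' C6' D' C4 C6 D; split; field; rewrite ?oner_neq0 ?u0 n0.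
Qed.

Definition cong8 x y := [/\ isO x, isO y & red x = red y].

Lemma cong8_refl x : isO x -> cong8 x x.
Proof. by []. Qed.
Lemma cong8D x y x' y' : cong8 x x' -> cong8 y y' -> cong8 (x + y) (x' + y').
Proof. by move=> [? ? E] [? ? E']; split; [exact: isO_D.. | rewrite !redD // E E']. Qed.
Lemma cong8N x x' : cong8 x x' -> cong8 (- x) (- x').
Proof. by move=> [? ? E]; split; [exact: isO_N.. | rewrite !redN // E]. Qed.
Lemma cong8M x y x' y' : cong8 x x' -> cong8 y y' -> cong8 (x * y) (x' * y').
Proof. by move=> [? ? E] [? ? E']; split; [exact: isO_M.. | rewrite !redM // E E']. Qed.
Lemma cong8X n x x' : cong8 x x' -> cong8 (x ^+ n) (x' ^+ n).
Proof. by move=> [? ? E]; split; [exact: isO_X.. | rewrite !redX // E]. Qed.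

Lemma disc_a3_cong (A1 A2 A3 A4 A6 : K) : isO A1 -> isO A2 -> isO A3 -> isO A4 -> isO A6 ->
  red A3 = (1, 0) -> red (disc (Weierstrass A1 A2 A3 A4 A6)) = red (disc (Weierstrass A1 A2 1 A4 A6)).
Proof.
move=> O1 O2 O3 O4 O6 R3; have c3 : cong8 A3 1 by split=> //; [exact: isO_1 | rewrite red1].
have [//] : cong8 (disc (Weierstrass A1 A2 A3 A4 A6)) (disc (Weierstrass A1 A2 1 A4 A6)).
rewrite /disc /b2 /b4 /b6 /b8 /=.
by repeat first [exact: c3 | apply: (cong8_refl (isO_nat _)) | exact: (cong8_refl O1) | exact: (cong8_refl O2)
  | exact: (cong8_refl O4) | exact: (cong8_refl O6) | apply: cong8D | apply: cong8N | apply: cong8M | apply: cong8X].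
Qed.

Lemma isO_bits x : isO x -> exists a t, [/\ isO a, isO t, x = a + 2 * t & red a \in bits8].
Proof.
move=> /isOP[a [b ->]].
exists ((a %% 2)%Z%:~R + (b %% 2)%Z%:~R * s), ((a %/ 2)%Z%:~R + (b %/ 2)%Z%:~R * s).
split; rewrite ?isO_mk //.
  rewrite {1}(divz_eq a 2) {1}(divz_eq b 2) !rmorphD !rmorphM /=; ring.
rewrite red_mk; have [->|->] : (a %% 2)%Z = 0 \/ (a %% 2)%Z = 1 by lia.
  by have [->|->] : (b %% 2)%Z = 0 \/ (b %% 2)%Z = 1 by lia.
by have [->|->] : (b %% 2)%Z = 0 \/ (b %% 2)%Z = 1 by lia.
Qed.

Lemma disc_red (A1 A2 A4 A6 y : K) : isO A1 -> isO A2 -> isO A4 -> isO A6 -> isO y -> A1 ^+ 2 = 2 * y ->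
  exists x2 x4, [/\ x2 \in bits8, x4 \in bits8 &
    red (disc (Weierstrass A1 A2 1 A4 A6)) = disc8 m%:R (red A1) (red y) x2 x4].
Proof.
move=> O1 /isO_bits[e2 [t2 [Oe2 Ot2 -> B2]]] /isO_bits[e4 [t4 [Oe4 Ot4 -> B4]]] O6 Oy Ey.
exists (red e2), (red e4); split=> //.
pose w := y ^+ 2 * (A1 * e4 + e2 + e4 ^+ 2) + y * e4 + e2 * A1.
pose w' := y ^+ 2 * (A1 * t4 + t2 + 2 * e4 * t4 + 2 * t4 ^+ 2) + y * t4 + t2 * A1.
pose a2 := e2 + 2 * t2; pose a4 := e4 + 2 * t4.
have O2 : isO a2 by rewrite /a2; isO_tac.
have O4 : isO a4 by rewrite /a4; isO_tac.
pose X := - 4 - 27 * A6 - 54 * A6 ^+ 2 - 8 * a4 ^+ 3 + 9 * a2 * a4 + 36 * a2 * a4 * A6 + 2 * a2 ^+ 2 * a4 ^+ 2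
  - 2 * a2 ^+ 3 - 8 * a2 ^+ 3 * A6 - 8 * y * a4 + 18 * y * a4 * A6 + 2 * y * a2 * a4 ^+ 2 - 2 * y * a2 ^+ 2
  - 12 * y * a2 ^+ 2 * A6 - y ^+ 2 * a2 - 6 * y ^+ 2 * a2 * A6 - y ^+ 3 * A6 - 12 * A1 * a4 ^+ 2 + 4 * A1 * a2
  + 18 * A1 * a2 * A6 + 2 * A1 * a2 ^+ 2 * a4 + 9 * A1 * y * A6 + 2 * A1 * y * a2 * a4.
have OX : isO X by rewrite /X; isO_tac.
have Ow : isO w by rewrite /w; isO_tac.
have Ow' : isO w' by rewrite /w'; isO_tac.
have -> : disc (Weierstrass A1 (e2 + 2 * t2) 1 (e4 + 2 * t4) A6) = 5 + 2 * (y * A1) + 4 * w + 8 * (X + w').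
  rewrite -/a2 -/a4.
  have -> : 4 * w = 4 * (y ^+ 2 * (A1 * a4 + a2 + a4 ^+ 2) + y * a4 + a2 * A1) - 8 * w'.
    by rewrite /w /w' /a2 /a4; ring.
  rewrite /X /disc /b2 /b4 /b6 /b8 /=; move: a2 a4 {O2 O4 X OX} => a2 a4; ring: Ey.
rewrite redD ?red_8 ?addr0; [|by isO_tac..].
rewrite !redD; [|by isO_tac..].
rewrite !red_natM ?red_nat; [|by isO_tac..].
rewrite /w !expr2 !(redD, redM) //; try by isO_tac.
by rewrite red1 /disc8; congr (_ + _ + _); apply/eqP.
Qed.

Lemma change_disc_values (c : int) (eps : K) (j : nat) (sg : bool) (l : K) :
  unit_check m%:R c%:~R -> isO eps -> isO l -> odd8 c%:~R (red l) -> (j < 4)%N ->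
  red (((-1) ^+ sg * eps ^+ j * l ^+ 4) ^+ 3) \in
   disc_values m%:R c%:~R (red eps) ++ [seq - x | x <- disc_values m%:R c%:~R (red eps)].
Proof.
move=> uc Oe Ol ol j4.
have H : red (eps ^+ (3 * j) * (l ^+ 4) ^+ 3) \in disc_values m%:R c%:~R (red eps).
  rewrite redM ?redX; [|by isO_tac..]; apply: allpairs_f; first by rewrite mem_iota.
  by rewrite mem_undup; apply: map_f; rewrite mem_filter ol mem_seq8.
have -> : ((-1) ^+ sg * eps ^+ j * l ^+ 4) ^+ 3 = (-1) ^+ sg * (eps ^+ (3 * j) * (l ^+ 4) ^+ 3).
  by rewrite mulnC exprM; case: sg => /=; ring.
rewrite mem_cat; case: sg; last by rewrite mul1r H.
by rewrite mulN1r redN ?map_f ?orbT //; isO_tac.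
Qed.

(** * Square classes that are trivial outside 2 *)

Section UnitClasses.

Variables (p : nat) (eps pi : K) (sp : bool).
Hypotheses (pp : prime p) (p2 : p != 2%N) (mp : m = p \/ m = (2 * p)%N).
Hypotheses (Oe : isO eps) (pi2 : pi ^+ 2 = 2 * eps).
Hypotheses (nme : nm eps = 1) (nmpi : nm pi = (-1) ^+ sp * 2).
Hypotheses (nr1 : nonresidue p 1) (nr2 : nonresidue p ((-1) ^+ sp * 2)).

Lemma eps0 : eps != 0.
Proof. by rewrite -nm_eq0 nme oner_neq0. Qed.

Lemma two0 : 2 != 0 :> K.
Proof. by rewrite -(rmorph_nat iK 2) fmorph_eq0. Qed.

Lemma pi0 : pi != 0.
Proof. by rewrite -sqrf_eq0 pi2 mulf_neq0 ?eps0 ?two0. Qed.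

(** As [p] divides [m], a norm +-k n^2 is a square modulo [p], up to denominators. The conditions
    [nr1] and [nr2] leave only the classes of 1 and of nm pi among +-1 and +-2. *)
Lemma norm_class (x : K) (sg : bool) (k : nat) (n : rat) : (k %| 2)%N -> n != 0 ->
  nm x = (-1) ^+ sg * k%:R * n ^+ 2 -> k = 1%N /\ sg = false \/ k = 2%N /\ sg = sp.
Proof.
move=> k2 n0 E.
have k12 : k = 1%N \/ k = 2%N.
  by case: k k2 {E} => [|[|[|k]]] //; [left|right].
have nr (a : int) : nonresidue p a -> re x ^+ 2 + a%:~R * n ^+ 2 = m%:R * im x ^+ 2 -> False.
  move=> nra H; have [c [pc mc]] : exists c : int, ~~ (p %| c)%Z /\ (m%:R : rat) = p%:R * c%:~R.
    case: mp => ->; [exists 1 | exists 2]; split; rewrite ?mulr1 //.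
    - by rewrite dvdzE dvdn1 absz_nat; apply: contraTneq pp => ->.
    - by rewrite dvdzE dvdn_prime2.
    - by rewrite mulrC natrM.
  rewrite mc in H; have [_ n00 _] := no_norm pp nra pc H.
  by rewrite n00 eqxx in n0.
case: k12 => kE; [left|right]; split=> //; rewrite kE in E; apply/eqP/negPn/negP => sgn.
  apply: (nr 1 nr1); move: E; rewrite /nm; case: sg sgn => // _ E.
  have -> : re x ^+ 2 = (re x ^+ 2 - m%:R * im x ^+ 2) + m%:R * im x ^+ 2 by ring.
  by rewrite E; ring.
apply: (nr _ nr2); move: E; rewrite /nm => E.
have -> : re x ^+ 2 = (re x ^+ 2 - m%:R * im x ^+ 2) + m%:R * im x ^+ 2 by ring.
by rewrite E rmorphM rmorph_sign; case: sg sp sgn {E} => -[] //= _; ring.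
Qed.

(* Since 2 = pi^2 / eps, and p or 2 p is s^2, divisors of 2 p are squares up to eps. *)
Lemma ramified_class k : (k %| 2 * p)%N ->
  exists (i : bool) (nu : K), nu != 0 /\ k%:R = eps ^+ i * nu ^+ 2.
Proof.
move=> kd; have e0 := eps0; have q0 := pi0; have t0 := two0.
have s0 : s != 0.
  rewrite -sqrf_eq0 s2 -(rmorph_nat iK) fmorph_eq0 pnatr_eq0.
  by case: mp => ->; rewrite ?muln_eq0 -?lt0n ?prime_gt0.
have twoE : 2 = eps * (pi / eps) ^+ 2 :> K.
  by rewrite exprMn pi2; field.
have kk : [\/ k = 1%N, k = 2%N, k = p | k = (2 * p)%N].
  have [c2|c2] := boolP (2 %| k)%N; last first.
    have c : coprime k 2 by rewrite coprime_sym prime_coprime.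
    move: kd; rewrite Gauss_dvdr // => /(primeP pp).2 /orP[/eqP->|/eqP->]; [exact: Or41 | exact: Or43].
  case/dvdnP: c2 kd => k' ->; rewrite mulnC dvdn_pmul2l // => /(primeP pp).2 /orP[/eqP->|/eqP->].
    exact: Or42.
  exact: Or44.
case: mp s2 => -> sE; case: kk => ->.
- by exists false, 1; rewrite oner_neq0 expr1n mulr1.
- by exists true, (pi / eps); rewrite mulf_neq0 ?invr_eq0.
- by exists false, s; rewrite s0 mul1r sE.
- by exists true, (pi / eps * s); rewrite !mulf_neq0 ?invr_eq0 // exprMn sE natrM mulrA -twoE.
- by exists false, 1; rewrite oner_neq0 expr1n mulr1.
- by exists true, (pi / eps); rewrite mulf_neq0 ?invr_eq0.
- exists true, (s / pi); rewrite mulf_neq0 ?invr_eq0 //; split=> //.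
  by rewrite exprMn exprVn sE pi2 natrM; field; rewrite e0 t0.
- by exists false, s; rewrite s0 mul1r sE.
Qed.

Lemma unit_eps P : finite_prime P -> unitP P eps.
Proof.
move=> fP; apply: (unitP_O fP Oe) => Pe; apply: (fp_proper fP).
by rewrite -(rmorph1 iK) -nme nmE mulrC; apply: (fpM fP) => //; exact: isO_conj.
Qed.

Lemma unit_pi P : finite_prime P -> ~ P (2%:R : K) -> unitP P pi.
Proof.
move=> fP n2; apply: (@unitP_root P fP 2) => //; rewrite pi2.
by apply: (unitP_M fP); [apply: (unitP_O fP) => //; exact: isO_nat | exact: unit_eps].
Qed.

(** The norm of x is a square up to 1 or nm pi, so x or x pi has a square norm and is, by Hilbert
    90, a rational number times a square. Only 2 and [p] can divide the squarefree part of that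
    number, and they are squares up to eps and the square root [s] of [m]. *)
Lemma class_outside2 (x : K) : x != 0 ->
  (forall P, finite_prime P -> ~ P (2%:R : K) -> locally_square P x) ->
  exists (sg i k : bool) (nu : K), nu != 0 /\ x = (-1) ^+ sg * eps ^+ i * pi ^+ k * nu ^+ 2.
Proof.
move=> x0 H.
have H' l : prime l -> l != 2%N -> forall P, finite_prime P -> P (l%:R : K) -> locally_square P x.
  by move=> pl l2 P fP Pl; apply: H => //; exact: (@fp_not_coprime P l 2).
have nx0 : nm x != 0 by rewrite nm_eq0.
have [k [sg [n [nxE k0 sk n0]]]] := rat_squarefree nx0.
have k2 : (k %| 2)%N.
  have := @squarefree_primes k [:: 2%N] k0 sk; rewrite /= big_seq1; apply=> l pl lk.
  rewrite inE; apply: contraLR lk => l2.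
  exact: (@norm_prime l k sg n x pl l2 x0 sk n0 nxE (H' l pl l2)).
have [j [n' xjE]] : exists (j : bool) (n' : rat), nm (x * pi ^+ j) = n' ^+ 2.
  case: (norm_class k2 n0 nxE) => -[kE sgE].
    by exists false, n; rewrite mulr1 nxE kE sgE !mul1r.
  exists true, (2 * n); rewrite nmM nxE kE sgE nmpi.
  by case: sp; rewrite /= ?expr0 ?expr1; ring.
have xj0 : x * pi ^+ j != 0 by rewrite mulf_neq0 ?expf_neq0 ?pi0.
have [sg' [k' [nu [xE sk' k'0 nu0]]]] := hilbert90_class xj0 xjE.
have k'd : (k' %| 2 * p)%N.
  have := @squarefree_primes k' [:: 2%N; p] k'0 sk'.
  rewrite /= inE eq_sym (negbTE p2) /= !big_cons big_nil muln1; apply=> l pl lk.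
  rewrite !inE; have [//|l2 /=] := eqVneq l 2%N; apply: contraLR lk => lp; apply/negP => lk.
  have lm : ~~ (l %| m)%N.
    by case: mp => ->; rewrite ?Euclid_dvdM // ?dvdn_prime2 // (negbTE lp) ?(negbTE l2).
  apply: (class_prime pl l2 lm sk' lk nu0 xE) => P fP Pl.
  have [u u0 ux] := H' l pl l2 P fP Pl; exists u => //.
  rewrite mulrAC; apply: (unitP_M fP) => //; apply: (unitP_X fP); apply: unit_pi => //.
  exact: (@fp_not_coprime P l 2).
have [i [nu' [nu'0 k'E]]] := ramified_class k'd.
exists sg', i, j, (nu' * nu / pi ^+ j); split.
  by rewrite !mulf_neq0 ?invr_eq0 ?expf_neq0 ?pi0.
apply: (mulIf (expf_neq0 j pi0)); rewrite xE k'E.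
by have q0 := pi0; case: j {xE xj0 xjE}; case: i {k'E} => /=; field; rewrite ?q0 ?expf_neq0 ?q0 ?expr0 ?oner_neq0.
Qed.

(** * The discriminant *)

Variable c : int.
Local Notation P2 := (split_prime 2 c).
Hypothesis c2 : (2 %| c ^+ 2 - m%:Z)%Z.
Hypothesis uc : unit_check m%:R c%:~R.
Hypothesis sc : sup_check m%:R c%:~R (red eps).

Lemma P2_finite : finite_prime P2.
Proof. exact: split_prime_finite. Qed.

Lemma P2_nat (n : nat) : P2 (n%:R : K) <-> ~~ odd n.
Proof.
have OnX := isO_nat n; rewrite (split_prime_red c OnX) red_nat /odd8 [fst _]/= [snd _]/= mulr0 addr0.
by have := odd_Z8 n; rewrite -[n%:~R]/(n%:R) => ->; rewrite dvdzE /= dvdn2 negbK.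
Qed.

Lemma P2_2 : P2 (2%:R : K). Proof. exact/P2_nat. Qed.

(** 2 ramifies, and the square of the prime above it is (2). *)
Lemma P2_half x : P2 x -> exists2 y, isO y & x ^+ 2 = 2 * y.
Proof.
case=> a [b [-> H]]; have /dvdzP[h hE] : (2 %| a ^+ 2 + m%:Z * b ^+ 2)%Z.
  have -> : a ^+ 2 + m%:Z * b ^+ 2 = (a + b * c) * (a - b * c) + 2 * (m%:Z * b ^+ 2) + (c ^+ 2 - m%:Z) * b ^+ 2 by ring.
  by rewrite !rpredD // ?dvdz_mulr.
exists (h%:~R + (a * b)%:~R * s); first exact: isO_mk.
rewrite expr2 int_mulE (_ : a * a + _ = h * 2); last by rewrite -hE; ring.
by rewrite !rmorphM !rmorphD !rmorphM /=; ring.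
Qed.

Lemma odd8_exp16 x : isO x -> ~ P2 x -> red (x ^+ 16) = (1, 0).
Proof.
move=> Ox nx; rewrite redX //; apply/eqP; move/allP: uc; apply.
by rewrite mem_filter mem_seq8 andbT; apply/negPn/negP => /(split_prime_red c Ox).
Qed.

Lemma ordinary W (j : nat) (sg : bool) (l : K) : isO_model W -> isO l -> ~ P2 (disc W) -> (j < 4)%N ->
  disc W = ((-1) ^+ sg * eps ^+ j * l ^+ 4) ^+ 3 -> ~ P2 (a1 W).
Proof.
move=> OW Ol nD j4 DE P1; have fP := P2_finite; have t2 := P2_2.
case: (OW) => O1 O2 O3 O4 O6.
have n3 : ~ P2 (a3 W).
  move=> P3; apply: nD; rewrite /disc.
  have Pb2 : P2 (b2 W).
    rewrite /b2 expr2 (_ : 4 = 2 * 2); last by rewrite -natrM.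
    apply: (fp_add fP); first exact: (fpM fP).
    by rewrite -mulrA mulrC; apply: (fpM fP) => //; isO_tac.
  have Pb6 : P2 (b6 W).
    rewrite /b6 expr2 (_ : 4 = 2 * 2); last by rewrite -natrM.
    apply: (fp_add fP); first exact: (fpM fP).
    by rewrite -mulrA mulrC; apply: (fpM fP) => //; isO_tac.
  have Ob2 := fpO fP Pb2; have Ob6 := fpO fP Pb6.
  have Ob4 : isO (b4 W) by rewrite /b4; isO_tac.
  have Ob8 : isO (b8 W) by rewrite /b8; isO_tac.
  have -> : - b2 W ^+ 2 * b8 W - 8 * b4 W ^+ 3 - 27 * b6 W ^+ 2 + 9 * b2 W * b4 W * b6 W =
     (9 * b4 W * b6 W - b2 W * b8 W) * b2 W - (4 * b4 W ^+ 3) * 2 - (27 * b6 W) * b6 W by ring.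
  by apply: (fpB fP); [apply: (fpB fP)|]; apply: (fpM fP) => //; isO_tac.
have nl : ~ P2 l.
  move=> Pl; apply: nD; have -> : disc W = ((-1) ^+ sg * eps ^+ j) ^+ 3 * l ^+ 11 * l by rewrite DE; ring.
  by apply: (fpM fP) => //; isO_tac.
(* Scaling by b = a3^5 turns a3 into a3 b^3 = a3^16, which is 1 modulo 8, and multiplies the
   discriminant by b^12, which amounts to replacing [l] by l b. *)
pose b := a3 W ^+ 5; have Ob : isO b by exact: isO_X.
have nb : ~ P2 b by apply: (fp_notX fP).
have nlb : ~ P2 (l * b ^+ 3) by apply: (fp_notM fP) => //; [isO_tac | exact: (fp_notX fP)].
have P1b : P2 (a1 W * b) by rewrite mulrC; exact: (fpM fP).
have [y Oy yE] := P2_half P1b.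
have O1b : isO (a1 W * b) by isO_tac.
have O2b : isO (a2 W * b ^+ 2) by isO_tac.
have O3b : isO (a3 W ^+ 16) by isO_tac.
have O4b : isO (a4 W * b ^+ 4) by isO_tac.
have O6b : isO (a6 W * b ^+ 6) by isO_tac.
have [x2 [x4 [B2 B4 RE]]] := disc_red O1b O2b O4b O6b Oy yE.
rewrite -(disc_a3_cong O1b O2b O3b O4b O6b (odd8_exp16 O3 n3)) in RE.
have Olb : isO (l * b) by isO_tac.
have olb : odd8 c%:~R (red (l * b)).
  by apply/negPn/negP => /(split_prime_red c Olb); apply: (fp_notM fP).
have := change_disc_values sg uc Oe Olb olb j4.
have -> : ((-1) ^+ sg * eps ^+ j * (l * b) ^+ 4) ^+ 3 =
    disc (Weierstrass (a1 W * b) (a2 W * b ^+ 2) (a3 W ^+ 16) (a4 W * b ^+ 4) (a6 W * b ^+ 6)).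
  transitivity (disc W * b ^+ 12); first by rewrite DE; ring.
  have -> : a3 W ^+ 16 = a3 W * b ^+ 3 by rewrite /b; ring.
  by rewrite /disc /b2 /b4 /b6 /b8 /=; ring.
rewrite RE; apply/negP; move/allP: sc => /(_ (red (a1 W * b))).
rewrite mem_filter mem_seq8 andbT => /(_ ((split_prime_red c O1b).1 P1b))/allP/(_ (red y)).
rewrite mem_filter mem_seq8 andbT => H; have := H _; rewrite -redM // -expr2 yE red_natM // eqxx.
by move=> /(_ isT)/allP/(_ x2 B2)/allP/(_ x4 B4).
Qed.

Lemma odd_norm x (N : int) : isO x -> ~ P2 x -> nm x = N%:~R -> ~~ (2 %| N)%Z.
Proof.
move=> /isOP[a [b ->]] nP; rewrite nm_int => /intr_inj <-; apply/negP => H; apply: nP.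
exists a, b; split=> //.
have : (2%N %| (a + b * c) * (a - b * c))%Z.
  have -> : (a + b * c) * (a - b * c) = a ^+ 2 - m%:Z * b ^+ 2 - (c ^+ 2 - m%:Z) * b ^+ 2 by ring.
  by rewrite rpredB // dvdz_mulr.
rewrite prime_dvdzM // => /orP[//|H'].
have -> : a + b * c = (a - b * c) + 2 * (b * c) by ring.
by rewrite rpredD // dvdz_mulr.
Qed.

Lemma isO_eps_inv : isO eps^-1.
Proof.
have e0 := eps0; suff -> : eps^-1 = conj eps by exact: isO_conj.
by apply: (mulfI e0); rewrite -nmE nme rmorph1 divff.
Qed.

Lemma isO_pow_eps x (sg : bool) (j n : nat) : (0 < n)%N ->
  isO ((-1) ^+ sg * eps ^+ j * x ^+ n) -> isO x.
Proof.
move=> n0 H; apply: (isO_root n0); have e0 := eps0; have Oei := isO_eps_inv.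
have -> : x ^+ n = (-1) ^+ sg * eps^-1 ^+ j * ((-1) ^+ sg * eps ^+ j * x ^+ n).
  by rewrite exprVn; case: (sg) => /=; field; rewrite expf_neq0.
by isO_tac.
Qed.

Lemma odd_norm_exponent (N : int) (sg : bool) (e : nat) (n : rat) : ~~ (2 %| N)%Z -> (e < 4)%N ->
  N%:~R = ((-1) ^+ sg * 2) ^+ e * n ^+ 4 -> e = 0%N.
Proof.
move=> oN; have oN' : ~~ (2%N %| (-1) ^+ sg * N)%Z by case: (sg); rewrite ?expr0 ?mul1r ?expr1 ?mulN1r ?rpredN.
case: e => [//|[|[|[|//]]]] _ E; exfalso.
- have := @rat_odd_valuation 2 _ (2 * n ^+ 2) 1 isT oN'; rewrite rmorphM rmorph_sign /= E.
  by move=> /(_ _)/eqP; rewrite oner_eq0 => H; apply/notF/H; case: (sg); rewrite /= ?expr0 ?expr1; ring.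
- have [z zE] : exists z : int, 2 * n ^+ 2 = z%:~R.
    by apply: (@rat_sqr_int _ N); rewrite E; case: (sg); rewrite /= ?expr0 ?expr1; ring.
  have oz : ~~ (2%N %| z)%Z.
    apply: contra oN => dz; have -> : N = z * z; last by rewrite dvdz_mulr.
    by apply: (@intr_inj rat); rewrite rmorphM /= -zE E; case: (sg); rewrite /= ?expr0 ?expr1; ring.
  have := @rat_odd_valuation 2 _ (2 * n) 1 isT oz; rewrite -zE.
  by move=> /(_ _)/eqP; rewrite oner_eq0 => H; apply/notF/H; ring.
have := @rat_odd_valuation 2 _ (4 * n ^+ 2) 1 isT oN'; rewrite rmorphM rmorph_sign /= E.
by move=> /(_ _)/eqP; rewrite oner_eq0 => H; apply/notF/H; case: (sg); rewrite /= ?expr0 ?expr1; ring.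
Qed.

Section Curve.

Variables (E : weierstrass K) (d : K).
Hypotheses (ell : elliptic E) (good : everywhere_good_reduction E) (dE : disc E = d ^+ 3).

Lemma d_neq0 : d != 0.
Proof. by move: ell; rewrite /elliptic dE expf_eq0. Qed.

Lemma local_model P : finite_prime P -> exists u,
  [/\ u != 0, locP P (c4 E / u ^+ 4), locP P (c6 E / u ^+ 6) & unitP P (d / u ^+ 4)].
Proof.
move=> fP; have [u [u0 H4 H6 Hd]] := good_invariants fP ell (good fP).
exists u; split=> //; apply: (@unitP_root P fP 3) => //.
by move: Hd; rewrite dE (_ : d ^+ 3 / u ^+ 12 = (d / u ^+ 4) ^+ 3) //; field.
Qed.

Lemma model_at_2 : exists u W (l : K) (sg : bool) (j : nat), let d' := d / u ^+ 4 in
  [/\ u != 0, isO_model W, c4 W = c4 E / u ^+ 4 & c6 W = c6 E / u ^+ 6] /\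
  [/\ isO d', ~ P2 d', isO l & d' = (-1) ^+ sg * eps ^+ j * l ^+ 4] /\ ~ P2 (a1 W).
Proof.
have fP := P2_finite; have e0 := eps0; have q0 := pi0; have d0 := d_neq0.
have [u [W [u0 OW nD [E4 E6 ED]]]] := integral_good_model fP ell (good fP).
pose d' := d / u ^+ 4.
have d'E : disc W = d' ^+ 3 by rewrite ED dE /d'; field.
have d'0 : d' != 0 by rewrite mulf_neq0 ?invr_eq0 ?expf_neq0.
have Od : isO d' by apply: (@isO_root 3) => //; rewrite -d'E; exact: isO_disc.
have nd : ~ P2 d'.
  by move=> Pd; apply: nD; rewrite d'E exprS mulrC; apply: (fpM fP) => //; isO_tac.
have loc P : finite_prime P -> exists2 v, v != 0 & unitP P (d' / v ^+ 4).
  move=> fQ; have [v [v0 _ _ H]] := local_model fQ; exists (v / u); first by rewrite mulf_neq0 ?invr_eq0.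
  by rewrite (_ : d' / _ = d / v ^+ 4) // /d'; field; rewrite u0 v0.
have [sg [i [k [mu [mu0 dE1]]]]] : exists (sg i k : bool) mu, mu != 0 /\ d' = (-1) ^+ sg * eps ^+ i * pi ^+ k * mu ^+ 2.
  apply: class_outside2 => // P fQ _; have [v v0 H] := loc P fQ.
  by exists (v ^+ 2); rewrite ?expf_neq0 // -exprM.
(* Everywhere d' is a fourth power up to units, and pi is a unit outside 2, so there mu is a square
   up to units and the classification applies a second time. *)
have [sg' [i' [k' [nu [nu0 muE]]]]] : exists (sg i k : bool) nu, nu != 0 /\ mu = (-1) ^+ sg * eps ^+ i * pi ^+ k * nu ^+ 2.
  apply: class_outside2 => // P fQ n2; have [v v0 H] := loc P fQ.
  exists v => //; apply: (@unitP_root P fQ 2) => //.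
  have -> : (mu / v ^+ 2) ^+ 2 = (-1) ^+ sg * (d' / v ^+ 4 * (eps ^+ i)^-1 * (pi ^+ k)^-1).
    have qk0 : pi ^+ k != 0 by rewrite expf_neq0.
    have ei0 : eps ^+ i != 0 by rewrite expf_neq0.
    rewrite dE1; move: qk0 ei0; move: (pi ^+ k) (eps ^+ i) => x y x0 y0.
    by case: (sg) => /=; rewrite ?expr0 ?expr1; field; rewrite ?v0 ?x0 ?y0.
  apply: (unitP_sign _ fQ); apply: (unitP_M fQ); first apply: (unitP_M fQ) => //.
    by apply: unitP_V; apply: (unitP_X fQ); exact: unit_eps.
  by apply: unitP_V; apply: (unitP_X fQ); exact: unit_pi.
have dE2 : d' = (-1) ^+ sg * eps ^+ (i + 2 * i') * pi ^+ (k + 2 * k') * nu ^+ 4.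
  rewrite dE1 muE [eps ^+ (_ + _)]exprD [pi ^+ (_ + _)]exprD.
  by case: (sg') (i') (k') => -[] []; rewrite [nat_of_bool _]/= ?muln0 ?muln1 ?expr0 ?expr1; ring.
have /intrP[N NE] := isO_nm Od.
(* The norm of d' is odd, while it equals (nm pi)^(k + 2 k') times a fourth power with exponent
   below 4. *)
have kk0 : (k + 2 * k')%N = 0%N.
  apply: (odd_norm_exponent (sg := sp) (n := nm nu) (odd_norm Od nd NE)); first by case: (k) (k') => -[].
  rewrite -NE dE2 !nmM !nmX nme nmpi expr1n mulr1.
  have -> : nm (-1) = 1 by rewrite -(rmorph1 iK) -rmorphN nm_inK; ring.
  by rewrite expr1n mul1r.
have dE3 : d' = (-1) ^+ sg * eps ^+ (i + 2 * i') * nu ^+ 4 by rewrite dE2 kk0 mulr1.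
have Onu : isO nu by apply: (@isO_pow_eps nu sg (i + 2 * i') 4) => //; rewrite -dE3.
exists u, W, nu, sg, (i + 2 * i')%N; split=> //; split=> //.
apply: (ordinary OW Onu nD); last by rewrite d'E dE3.
by case: (i) (i') => -[].
Qed.

Lemma minimal_data : exists (x4 x6 d' a z l : K) (sg : bool) (j : nat),
  [/\ isO x4, isO x6, isO d', isO a & isO z] /\
  [/\ ~ P2 d', ~ P2 a, x4 = a ^+ 4 + 8 * z & x4 ^+ 3 - x6 ^+ 2 = 1728 * d' ^+ 3] /\
  [/\ isO l, d' = (-1) ^+ sg * eps ^+ j * l ^+ 4 &
  forall P, finite_prime P -> exists t,
    [/\ t != 0, locP P (x4 / t ^+ 4), locP P (x6 / t ^+ 6) & unitP P (d' / t ^+ 4)]].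
Proof.
have [u [W [l [sg [j [[u0 [O1 O2 O3 O4 O6] E4 E6] [[Od nd Ol dE'] n1]]]]]]] := model_at_2.
(* The fifth witness is read off c4 = (a1^2 + 4 a2)^2 - 24 b4. *)
exists (c4 W), (c6 W), (d / u ^+ 4), (a1 W), (a1 W ^+ 2 * a2 W + 2 * a2 W ^+ 2 - 3 * (2 * a4 W + a1 W * a3 W)), l, sg, j.
split; first by split; rewrite // /c4 /c6 /b2 /b4 /b6; isO_tac.
split; first split=> //; first by rewrite /c4 /b2 /b4; ring.
  have H := c4_c6_disc E; rewrite dE in H; rewrite E4 E6.
  by transitivity ((1728 * d ^+ 3) / u ^+ 12); [rewrite -H; field | field].
split=> // P fP; have [v [v0 H4 H6 Hd]] := local_model fP.
exists (v / u); split; first by rewrite mulf_neq0 ?invr_eq0.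
- by rewrite E4 (_ : _ / _ = c4 E / v ^+ 4) //; field; rewrite ?v0 ?u0.
- by rewrite E6 (_ : _ / _ = c6 E / v ^+ 6) //; field; rewrite ?v0 ?u0.
by rewrite (_ : _ / _ = d / v ^+ 4) //; field; rewrite ?v0 ?u0.
Qed.

End Curve.

(** * The square class of c4 - 12 delta *)

(** The last condition makes a and b coprime at P, so that one of them is a unit there. *)
Lemma locally_square_factor P a b t r q : finite_prime P -> locP P a -> locP P b -> locP P t ->
  unitP P r -> q != 0 -> a * b = r * q ^+ 2 -> unitP P (b - a * t) -> locally_square P a.
Proof.
move=> fP [x [y [Ox Oy ny aE]]] [x' [y' [Ox' Oy' ny' bE]]] [x'' [y'' [Ox'' Oy'' ny'' tE]]] ur q0 ab ubt.
have y0 := fp_n0 fP ny; have y'0 := fp_n0 fP ny'; have y''0 := fp_n0 fP ny''.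
have [Px|nPx] := classic (P x); last first.
  by exists 1; rewrite ?oner_neq0 // expr1n divr1; exists x, y.
have ub : unitP P b.
  exists x', y'; split=> // Px'; case: ubt => [w [w' [Ow Ow' nw nw' E]]]; have w'0 := fp_n0 fP nw'.
  have : P (w * (y * y' * y'')).
    have -> : w * (y * y' * y'') = (w' * y * y'') * x' - (w' * y' * x'') * x.
      have -> : w = (b - a * t) * w' by rewrite E; field.
      by rewrite aE bE tE; field; rewrite y0 y'0 y''0.
    by apply: (fpB fP); apply: (fpM fP) => //; isO_tac.
  have Oyy : isO (y * y') by isO_tac.
  by apply: (fp_notM fP) => //; [isO_tac | apply: (fp_notM fP) => //; exact: (fp_notM fP)].
exists q => //; have b0 := unitP_n0 fP ub.
have -> : a / q ^+ 2 = r * b^-1.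
  by apply: (mulIf b0); rewrite mulrAC ab; field; rewrite ?q0 ?b0.
by apply: (unitP_M fP) => //; exact: unitP_V.
Qed.

Lemma re_sqr x : re (x ^+ 2) = re x ^+ 2 + m%:R * im x ^+ 2.
Proof. by rewrite expr2 reM; ring. Qed.

(** Twice [re] is the trace, which is nonnegative on squares because K is real; traces replace the
    real embeddings in sign arguments. *)
Lemma re_sqr_ge0 x : 0 <= re (x ^+ 2).
Proof. by rewrite re_sqr addr_ge0 ?sqr_ge0 // mulr_ge0 ?sqr_ge0 ?ler0n. Qed.

Lemma re_sqr_gt0 x : x != 0 -> 0 < re (x ^+ 2).
Proof.
move=> x0; rewrite lt_def re_sqr_ge0 andbT re_sqr; apply: contra x0 => /eqP H.
have m0 : (0 < m)%N by case: (m) m23 => [[]|].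
have [r0 i0] : re x ^+ 2 = 0 /\ im x ^+ 2 = 0.
  have A : 0 <= re x ^+ 2 by exact: sqr_ge0.
  have B : 0 <= im x ^+ 2 by exact: sqr_ge0.
  have C : 1 <= (m%:R : rat) by rewrite ler1n.
  by split; nra.
move/eqP: r0; move/eqP: i0; rewrite !sqrf_eq0 => /eqP i0 /eqP r0.
by rewrite (coord x) i0 r0 !rmorph0 mul0r addr0.
Qed.

Lemma re_scale (q : rat) x : re (q%:K * x) = q * re x.
Proof. by rewrite reM re_inK im_inK; ring. Qed.

Lemma im_scale (q : rat) x : im (q%:K * x) = q * im x.
Proof. by rewrite imM re_inK im_inK; ring. Qed.

(** Composition identity for the form X^2 + 3 Y^2: the norm is (nm x - 3 nm y)^2 + 3 (x conj y + y
    conj x)^2. *)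
Lemma nm_sum_ge0 x y : 0 <= nm (x ^+ 2 + 3 * y ^+ 2).
Proof.
rewrite /nm !expr2 reD imD -(rmorph_nat iK 3) re_scale im_scale !reM !imM.
set P := (X in 0 <= X).
have -> : P = (nm x - 3 * nm y) ^+ 2 + 3 * (2 * (re x * re y - m%:R * im x * im y)) ^+ 2.
  by rewrite /P /nm; ring.
by rewrite addr_ge0 ?sqr_ge0 // mulr_ge0 ?sqr_ge0 ?ler0n.
Qed.

Lemma norm_class3 x : isO x -> ~ P2 x ->
  (forall P, finite_prime P -> ~ P (2%:R : K) -> ~ P (3%:R : K) -> locally_square P x) ->
  exists (sg : bool) (k : nat) (n : rat), [/\ k \in [:: 1%N; 3%N], n != 0 & nm x = (-1) ^+ sg * k%:R * n ^+ 2].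
Proof.
move=> Ox nx loc; have x0 := fp_n0 P2_finite nx; have nx0 : nm x != 0 by rewrite nm_eq0.
have [k [sg [n [nxE k0 sk n0]]]] := rat_squarefree nx0.
exists sg, k, n; split=> //.
have k3 : (k %| 3)%N.
  have := @squarefree_primes k [:: 3%N] k0 sk; rewrite /= big_seq1; apply=> l pl lk.
  rewrite inE; apply: contraLR lk => l3; have [l2|l2] := eqVneq l 2%N; last first.
    apply: (@norm_prime l k sg n x pl l2 x0 sk n0) => // P fP Pl.
    by apply: loc => //; [exact: (@fp_not_coprime P l 2) | exact: (@fp_not_coprime P l 3)].
  rewrite l2; apply/negP => /dvdnP[k' kE].
  have /intrP[N NE] := isO_nm Ox; have oN := odd_norm Ox nx NE.
  have ok' : ~~ (2 %| k')%N.
    apply: contra (sk 2%N isT); rewrite kE => /dvdnP[k'' ->].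
    by rewrite -mulnA; exact: (dvdn_mull _ (dvdnn 4)).
  have ok : ~~ (2%N %| k'%:Z * ((-1) ^+ sg * N))%Z.
    by rewrite prime_dvdzM // negb_or ok'; case: (sg); rewrite ?expr0 ?mul1r ?expr1 ?mulN1r ?rpredN.
  have := @rat_odd_valuation 2 _ (2 * k'%:R * n) 1 isT ok; rewrite !rmorphM rmorph_sign /= -NE nxE kE natrM.
  move=> /(_ _)/eqP; rewrite oner_eq0 => H; apply/notF/H.
  by case: (sg); rewrite /= ?expr0 ?expr1; ring.
by have := (primeP (isT : prime 3)).2 k k3; rewrite !inE.
Qed.

Section ReducedModel.

Variables x4 x6 d a z : K.
Hypotheses (O4 : isO x4) (Od : isO d) (Oa : isO a) (Oz : isO z).
Hypotheses (nd : ~ P2 d) (na : ~ P2 a) (x4E : x4 = a ^+ 4 + 8 * z).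
Hypothesis rel : x4 ^+ 3 - x6 ^+ 2 = 1728 * d ^+ 3.
Hypothesis loc : forall P, finite_prime P -> exists t,
  [/\ t != 0, locP P (x4 / t ^+ 4), locP P (x6 / t ^+ 6) & unitP P (d / t ^+ 4)].

Let C := x4 - 12 * d.
(** The cofactor C^2 + 36 d C + 432 d^2 of [C] in c4^3 - 1728 d^3, in a form that shows it to be
    totally positive. *)
Let Q := (C + 18 * d) ^+ 2 + 3 * (6 * d) ^+ 2.

Lemma CQ : C * Q = x6 ^+ 2.
Proof.
have -> : x6 ^+ 2 = x4 ^+ 3 - 1728 * d ^+ 3 by rewrite -rel; ring.
by rewrite /Q /C; ring.
Qed.

Lemma OC : isO C.
Proof. by rewrite /C; isO_tac. Qed.

Lemma nP2_add8 w t : isO w -> ~ P2 w -> isO t -> ~ P2 (w + 2 * t).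
Proof.
move=> Ow nw Ot Pw; apply: nw; have fP := P2_finite.
have -> : w = (w + 2 * t) - t * 2 by ring.
by apply: (fpB fP) => //; apply: (fpM fP) => //; exact: P2_2.
Qed.

Lemma nC : ~ P2 C.
Proof.
have fP := P2_finite; have OC := OC.
have -> : C = a ^+ 4 + 2 * (4 * z - 6 * d) by rewrite /C x4E; ring.
by apply: nP2_add8; [isO_tac | exact: (fp_notX fP) | isO_tac].
Qed.

Lemma red_C : red C = exp8 m%:R (red a) 4 + red d *+ 4.
Proof.
have -> : C = a ^+ 4 + 4 * d + 8 * (z - 2 * d) by rewrite /C x4E; ring.
rewrite redD ?red_8 ?addr0; [|by isO_tac..].
by rewrite redD ?red_natM ?redX //; isO_tac.
Qed.

Lemma d_n0 : d != 0. Proof. exact: (fp_n0 P2_finite nd). Qed.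
Lemma C_n0 : C != 0. Proof. exact: (fp_n0 P2_finite nC). Qed.

Lemma re_Q_gt0 : 0 < re Q.
Proof.
rewrite /Q -[3 in X in _ + X](rmorph_nat iK) reD re_scale.
have d0 := d_n0; have six0 : 6 != 0 :> K by rewrite -(rmorph_nat iK) fmorph_eq0.
by rewrite addrC ltr_wpDr ?re_sqr_ge0 // mulr_gt0 // re_sqr_gt0 ?mulf_neq0.
Qed.

Lemma Q_n0 : Q != 0.
Proof. by apply: contraTneq re_Q_gt0 => ->; rewrite -(rmorph0 iK) re_inK ltxx. Qed.

Lemma x6_n0 : x6 != 0.
Proof. by rewrite -sqrf_eq0 -CQ mulf_neq0 ?C_n0 ?Q_n0. Qed.

Lemma nm_C_gt0 : 0 < nm C.
Proof.
have QQ : 0 < nm Q by rewrite lt_def nm_eq0 Q_n0 nm_sum_ge0.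
have : 0 < nm C * nm Q.
  by rewrite -nmM CQ nmX lt_def sqr_ge0 andbT expf_neq0 // nm_eq0 x6_n0.
by rewrite pmulr_lgt0.
Qed.

Lemma unit_6 P (i j : nat) : finite_prime P -> ~ P (2%:R : K) -> ~ P (3%:R : K) -> unitP P (2 ^+ i * 3 ^+ j).
Proof.
move=> fP n2 n3; apply: (unitP_M fP); apply: (unitP_X fP); apply: (unitP_O fP) => //; exact: isO_nat.
Qed.

(** Q - C (C + 36 d) = 2^4 3^3 d^2, so outside 2 and 3 the factors [C] and [Q] of the square c6^2
    are coprime on a model where [d] is a unit. *)
Lemma C_locally_square P : finite_prime P -> ~ P (2%:R : K) -> ~ P (3%:R : K) -> locally_square P C.
Proof.
move=> fP n2 n3; have [t [t0 H4 H6 Hd]] := loc fP; have x60 := x6_n0.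
have ld := unitP_loc Hd; have lC : locP P (C / t ^+ 4).
  have -> : C / t ^+ 4 = x4 / t ^+ 4 - 12 * (d / t ^+ 4) by rewrite /C; field.
  by locP_tac fP.
have lQ : locP P (Q / t ^+ 8).
  have -> : Q / t ^+ 8 = (C / t ^+ 4 + 18 * (d / t ^+ 4)) ^+ 2 + 3 * (6 * (d / t ^+ 4)) ^+ 2.
    by rewrite /Q; field.
  by locP_tac fP.
have [w w0 Hw] : locally_square P (C / t ^+ 4).
  apply: (@locally_square_factor P _ (Q / t ^+ 8) (C / t ^+ 4 + 36 * (d / t ^+ 4)) 1 (x6 / t ^+ 6)) => //.
  - by locP_tac fP.
  - by have := unit_6 0 0 fP n2 n3; rewrite mulr1.
  - by rewrite mulf_neq0 ?invr_eq0 ?expf_neq0.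
  - by rewrite mulrACA CQ; field.
  have -> : Q / t ^+ 8 - C / t ^+ 4 * (C / t ^+ 4 + 36 * (d / t ^+ 4)) = 2 ^+ 4 * 3 ^+ 3 * (d / t ^+ 4) ^+ 2.
    by rewrite /Q; field.
  by apply: (unitP_M fP); [exact: unit_6 | exact: (unitP_X fP)].
exists (t ^+ 2 * w); first by rewrite mulf_neq0 ?expf_neq0.
by rewrite (_ : C / _ = C / t ^+ 4 / w ^+ 2) //; field; rewrite ?t0 ?w0.
Qed.

Lemma C_class : (forall x n, nm x = 3 * n ^+ 2 -> n = 0) -> ~~ (3 %| m)%N -> p != 3%N ->
  exists (q : nat) (i : bool) (nu : K), [/\ q \in [:: 1%N; 3%N], nu != 0 & C = q%:R * eps ^+ i * nu ^+ 2].
Proof.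
move=> n3 m3 p3; have C0 := C_n0; have nC0 : nm C != 0 by rewrite nm_eq0.
have loc' l : prime l -> l != 2%N -> l != 3%N -> forall P, finite_prime P -> P (l%:R : K) -> locally_square P C.
  move=> pl l2 l3 P fP Pl; apply: C_locally_square => //.
    exact: (@fp_not_coprime P l 2).
  exact: (@fp_not_coprime P l 3).
have [sg [k [n [k13 n0 nxE]]]] := norm_class3 OC nC C_locally_square.
have n2 : 0 < n ^+ 2 by rewrite lt_def sqr_ge0 andbT expf_neq0.
have sg0 : sg = false.
  case: sg nxE => // E; have := nm_C_gt0; rewrite E expr1 mulN1r !mulNr oppr_gt0 ltNge.
  by rewrite mulr_ge0 // ?ler0n ?ltW.
rewrite sg0 mul1r in nxE.
have kE : k = 1%N.
  move: k13; rewrite !inE => /orP[/eqP //|/eqP kE].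
  by move: n0; rewrite (n3 C n) ?eqxx // nxE kE.
have {}nxE : nm C = n ^+ 2 by rewrite nxE kE mul1r.
have [sg' [k' [nu [CE sk' k'0 nu0]]]] := hilbert90_class C0 nxE.
have k'd : (k' %| 3 * (2 * p))%N.
  have := @squarefree_primes k' [:: 2%N; 3%N; p] k'0 sk'.
  have -> : undup [:: 2%N; 3%N; p] = [:: 2%N; 3%N; p].
    by rewrite /= !inE ![_ == p]eq_sym (negbTE p2) (negbTE p3).
  rewrite !big_cons big_nil muln1 mulnCA; apply=> l pl lk.
  rewrite !inE; have [//|l2 /=] := eqVneq l 2%N; have [//|l3 /=] := eqVneq l 3%N.
  apply: contraLR lk => lp; apply/negP => lk.
  have lm : ~~ (l %| m)%N.
    by case: mp => ->; rewrite ?Euclid_dvdM // ?dvdn_prime2 // (negbTE lp) ?(negbTE l2).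
  by apply: (class_prime pl l2 lm sk' lk nu0 CE); exact: loc'.
have [q [k'' [q13 k''d k'E]]] : exists q k'', [/\ q \in [:: 1%N; 3%N], (k'' %| 2 * p)%N & k' = (q * k'')%N].
  case: (boolP (3 %| k')%N) => [/dvdnP[k'' E]|H].
    by exists 3%N, k''; split=> //; [move: k'd; rewrite E mulnC dvdn_pmul2l | rewrite E mulnC].
  exists 1%N, k'; rewrite mul1n; split=> //; move: k'd; rewrite Gauss_dvdr //.
  by rewrite coprime_sym prime_coprime.
have [i [nu' [nu'0 k''E]]] := ramified_class k''d.
have q0 : q%:R != 0 :> K.
  by rewrite -(rmorph_nat iK) fmorph_eq0 pnatr_eq0; case/or3P: q13 => // /eqP->.
have e0 := eps0; have pi0 := pi0; have two0 := two0.
have {}CE : C = (-1) ^+ sg' * (q%:R * eps ^+ i * (nu' * nu) ^+ 2).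
  by rewrite CE k'E natrM k''E; ring.
have nn0 : nu' * nu != 0 by rewrite mulf_neq0.
exists q, i, (nu' * nu); split=> //; case: sg' CE => CE; last by rewrite CE mul1r.
exfalso; rewrite expr1 mulN1r in CE.
(* As eps = pi^2 / 2 and C Q is a square, a minus sign would make [Q] the opposite of a nonnegative
   rational times a square, against its positive trace. *)
have [r [y [r0 yE]]] : exists (r : rat) y, 0 <= r /\ Q = - (r%:K * y ^+ 2).
  exists (q%:R / (if i then 2 else 1)), (x6 * (if i then 2 / pi else 1) / (q%:R * (nu' * nu))); split.
    by rewrite divr_ge0 ?ler0n //; case: (i).
  apply: (mulfI C0); rewrite CQ {1}CE fmorph_div rmorph_nat.
  have epsE : eps = pi ^+ 2 / 2 by rewrite pi2; field.
  case: (i); rewrite /= ?rmorph_nat ?rmorph1; last by field; rewrite ?q0 ?nu0 ?nu'0 ?oner_neq0.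
  by rewrite epsE; field; rewrite ?q0 ?nu0 ?nu'0 ?pi0 ?two0 ?oner_neq0.
have := re_Q_gt0; rewrite yE reN re_scale oppr_gt0 ltNge.
by rewrite mulr_ge0 ?re_sqr_ge0.
Qed.

Lemma C_class_red : (forall x n, nm x = 3 * n ^+ 2 -> n = 0) -> ~~ (3 %| m)%N -> p != 3%N ->
  exists (q : nat) (i : bool) (g : K), [/\ q \in [:: 1%N; 3%N], isO g, eps ^+ i * g ^+ 2 = q%:R * C &
    ~~ ord_check m%:R c%:~R (red eps) q i].
Proof.
move=> H1 H2 H3; have [q [i [nu [q13 nu0 CE]]]] := C_class H1 H2 H3.
have OC := OC; have gE : eps ^+ i * (q%:R * nu) ^+ 2 = q%:R * C by rewrite CE; ring.
have Og : isO (q%:R * nu).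
  by apply: (@isO_pow_eps _ false i 2) => //; rewrite mul1r gE; isO_tac.
have od x : isO x -> ~ P2 x -> red x \in odds8 c%:~R.
  by move=> Ox nx; rewrite mem_filter mem_seq8 andbT; apply/negPn/negP => /(split_prime_red c Ox).
have Hf : exp8 m%:R (red a) 4 \in fourth8 m%:R c%:~R by rewrite mem_undup; apply: map_f; exact: od.
move: (q%:R * nu) gE Og => g gE Og; exists q, i, g; split=> //; apply/negP => /allP/(_ _ Hf)/allP/(_ (red d) (od _ Od nd)).
move/allP/(_ _ (mem_seq8 (red g))).
rewrite -red_C -red_natM // -gE expr2 redM ?redX; [|by isO_tac..].
by rewrite redM // eqxx.
Qed.

Lemma odd_Z8_sqr (x : 'Z_8) : odd x -> x * x = 1.
Proof. by case: x => -[|[|[|[|[|[|[|[|//]]]]]]]] i // _; apply/eqP. Qed.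

Lemma three_C_not_square g : (forall (sg : bool) x n, nm x = (-1) ^+ sg * 3 * n ^+ 2 -> n = 0) ->
  norm_check m%:R c%:~R -> isO g -> g ^+ 2 = 3 * C -> False.
Proof.
move=> n3 chk Og gE; have OC := OC; have C0 := C_n0; have fP := P2_finite; have nC := nC.
have three0 : 3 != 0 :> K by rewrite -(rmorph_nat iK) fmorph_eq0.
have g0 : g != 0 by rewrite -sqrf_eq0 gE mulf_neq0.
pose w := 3 * x6 / g.
have w2 : w ^+ 2 = 3 * Q.
  apply: (mulIf C0); transitivity (3 * (C * Q)); last by rewrite mulrCA mulrC.
  by rewrite CQ /w !exprMn exprVn gE; field; rewrite ?three0 ?C0.
have Ow : isO w by apply: (@isO_root 2) => //; rewrite w2 /Q; isO_tac.
have n3P : ~ P2 3 by move/P2_nat.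
have nw : ~ P2 w.
  move=> Pw; have : ~ P2 (3 * C ^+ 2) by apply: (fp_notM fP) => //; [isO_tac | isO_tac | exact: (fp_notX fP)].
  apply; have -> : 3 * C ^+ 2 = w * w - (54 * d * C + 648 * d ^+ 2) * 2.
    by rewrite -expr2 w2 /Q; ring.
  by apply: (fpB fP); apply: (fpM fP) => //; [isO_tac | exact: P2_2].
pose F := w - 18 * d; pose F' := w + 18 * d.
have OF : isO F by rewrite /F; isO_tac.
have nF : ~ P2 F.
  have -> : F = w + 2 * (- (9 * d)) by rewrite /F; ring.
  by apply: nP2_add8 => //; isO_tac.
have nF' : ~ P2 F'.
  have -> : F' = w + 2 * (9 * d) by rewrite /F'; ring.
  by apply: nP2_add8 => //; isO_tac.
have F0 := fp_n0 fP nF; have F'0 := fp_n0 fP nF'.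
have FF' : F * F' = 3 * (C + 18 * d) ^+ 2.
  by transitivity (w ^+ 2 - 324 * d ^+ 2); [rewrite /F /F' | rewrite w2 /Q]; ring.
have Cd0 : C + 18 * d != 0.
  by have := mulf_neq0 F0 F'0; rewrite FF' mulf_eq0 sqrf_eq0 negb_or => /andP[].
have locF P : finite_prime P -> ~ P (2%:R : K) -> ~ P (3%:R : K) -> locally_square P F.
  move=> fQ q2 q3; have [t [t0 H4 H6 Hd]] := loc fQ.
  have ld := unitP_loc Hd.
  have u3 : unitP P (3 : K) by have := unit_6 0 1 fQ q2 q3; rewrite mul1r.
  have lw : locP P (w / t ^+ 4).
    apply: (@locP_root P fQ 2) => //.
    have -> : (w / t ^+ 4) ^+ 2 =
        3 * ((x4 / t ^+ 4 + 6 * (d / t ^+ 4)) ^+ 2 + 3 * (6 * (d / t ^+ 4)) ^+ 2).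
      by rewrite exprMn w2 /Q /C; field.
    by locP_tac fQ.
  have [v v0 Hv] : locally_square P (F / t ^+ 4).
    apply: (@locally_square_factor P _ (F' / t ^+ 4) 1 3 ((C + 18 * d) / t ^+ 4)) => //.
    - have -> : F / t ^+ 4 = w / t ^+ 4 - 18 * (d / t ^+ 4) by rewrite /F; field.
      by locP_tac fQ.
    - have -> : F' / t ^+ 4 = w / t ^+ 4 + 18 * (d / t ^+ 4) by rewrite /F'; field.
      by locP_tac fQ.
    - exact: (locP_O fQ (isO_nat 1)).
    - by rewrite mulf_neq0 ?invr_eq0 ?expf_neq0.
    - by rewrite mulrACA FF'; field.
    have -> : F' / t ^+ 4 - F / t ^+ 4 * 1 = 2 ^+ 2 * 3 ^+ 2 * (d / t ^+ 4) by rewrite /F /F'; field.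
    by apply: (unitP_M fQ) => //; exact: unit_6.
  exists (t ^+ 2 * v); first by rewrite mulf_neq0 ?expf_neq0.
  by rewrite (_ : F / _ = F / t ^+ 4 / v ^+ 2) //; field; rewrite ?t0 ?v0.
have [sg [k [n [k13 n0 nFE]]]] := norm_class3 OF nF locF.
have kE : k = 1%N.
  move: k13; rewrite !inE => /orP[/eqP //|/eqP kE].
  by move: n0; rewrite (n3 sg F n) ?eqxx // nFE kE.
rewrite kE mulr1 in nFE; have /intrP[N NE] := isO_nm OF; have oN := odd_norm OF nF NE.
(* The norm of [F] is +-y^2 with [y] an odd integer, and odd squares are 1 modulo 8. *)
have [y yE] : exists y : int, n = y%:~R.
  apply: (@rat_sqr_int _ ((-1) ^+ sg * N)); rewrite rmorphM rmorph_sign /= -NE nFE.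
  by case: (sg); rewrite /= ?expr0 ?expr1; ring.
have NyE : N = (-1) ^+ sg * (y * y).
  by apply: (@intr_inj rat); rewrite !rmorphM rmorph_sign /= -NE nFE yE.
have oy : odd (y%:~R : 'Z_8).
  by rewrite odd_Z8; apply: contra oN => dy; rewrite NyE mulrA dvdz_mull.
have Hf : exp8 m%:R (red a) 4 \in fourth8 m%:R c%:~R.
  rewrite mem_undup; apply: map_f; rewrite mem_filter mem_seq8 andbT.
  by apply/negPn/negP => /(split_prime_red c Oa).
have Hd : red d \in odds8 c%:~R.
  by rewrite mem_filter mem_seq8 andbT; apply/negPn/negP => /(split_prime_red c Od).
have cond : mul8 m%:R (red w) (red w) == (mul8 m%:R (red C) (red C) + mul8 m%:R (red d) (red C) *+ 4) *+ 3.
  rewrite -redM // -expr2.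
  have -> : w ^+ 2 = 3 * (C * C + 4 * (d * C)) + 8 * (12 * d * C + 162 * d ^+ 2) by rewrite w2 /Q; ring.
  rewrite redD ?red_8 ?addr0; [|by isO_tac..].
  have OCC := isO_M OC OC; have OdC := isO_M Od OC; have OdC4 := isO_M (isO_nat 4) OdC.
  by rewrite (red_natM _ (isO_D OCC OdC4)) (redD OCC OdC4) (redM OC OC) (red_natM _ OdC) (redM Od OC).
rewrite red_C in cond.
move/allP: chk => /(_ _ Hf)/allP/(_ _ Hd)/allP/(_ _ (mem_seq8 (red w)))/implyP/(_ cond).
have -> : red w - red d *+ 2 = red F.
  have -> : F = w - 2 * d - 8 * (2 * d) by rewrite /F; ring.
  rewrite redD ?[red (- (8 * _))]redN ?red_8 ?oppr0 ?addr0; try by isO_tac.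
  by rewrite redD ?redN ?red_natM //; isO_tac.
rewrite /= -(red_nm OF NE) NyE !rmorphM rmorph_sign /= odd_Z8_sqr // mulr1.
by case: (sg); rewrite ?expr0 ?expr1 ?eqxx ?andbF.
Qed.

(** Since eps = 2 (pi / 2)^2, the discriminant root [d] is r times a square with r = +-1 or +-2,
    according to the parity of [j]; dividing the relation by d^3 gives the curve twisted by r. *)
Lemma reduced_point (l : K) (sg : bool) (j : nat) : d = (-1) ^+ sg * eps ^+ j * l ^+ 4 ->
  exists (x : K) (r : int) (y : K), [/\ isO x, ~ P2 x, r \in [:: 1; -1; 2; -2] & r%:~R * y ^+ 2 = x ^+ 3 - 1728].
Proof.
move=> dE; have d0 := d_n0; have fP := P2_finite; have e0 := eps0; have q0 := pi0; have t0 := two0.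
have Ox : isO (x4 / d).
  apply: locally_integral => P fQ; have [t [u0 H4 _ Hd]] := loc fQ.
  have -> : x4 / d = x4 / t ^+ 4 * (d / t ^+ 4)^-1 by field; rewrite ?u0 ?d0.
  by apply: (locP_M fQ) => //; apply: unitP_loc; exact: unitP_V.
have [r [y [r4 y0 dE']]] : exists (r : int) y, [/\ r \in [:: 1; -1; 2; -2], y != 0 & d = r%:~R * y ^+ 2].
  have l0 : l != 0 by apply: contraNneq d0 => l0; rewrite dE l0 expr0n mulr0.
  have epsE : eps = 2 * (pi / 2) ^+ 2 by rewrite exprMn pi2; field.
  exists ((-1) ^+ sg * 2 ^+ odd j), (eps ^+ j./2 * (pi / 2) ^+ odd j * l ^+ 2); split.
  - by case: (sg) (odd j) => -[].
  - by rewrite !mulf_neq0 ?expf_neq0 ?mulf_neq0 ?invr_eq0.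
  rewrite dE -{1}(odd_double_half j) exprD -muln2 exprM rmorphM rmorph_sign rmorphXn.
  by case: (odd j) => /=; [rewrite {1}epsE|]; ring.
have r0 : r%:~R != 0 :> K.
  by rewrite -(rmorph_int iK) fmorph_eq0 intr_eq0; apply: contraTneq r4 => ->.
exists (x4 / d), r, (x6 / (r%:~R ^+ 2 * y ^+ 3)); split=> //.
  move=> Px; have : ~ P2 (a ^+ 4) by apply: (fp_notX fP).
  apply; have -> : a ^+ 4 = d * (x4 / d) - (4 * z) * 2 by rewrite mulrC divfK // x4E; ring.
  by apply: (fpB fP); apply: (fpM fP) => //; [isO_tac | exact: P2_2].
have -> : (x4 / d) ^+ 3 - 1728 = x6 ^+ 2 / d ^+ 3.
  have -> : x6 ^+ 2 = x4 ^+ 3 - 1728 * d ^+ 3 by rewrite -rel; ring.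
  by field.
by rewrite dE'; field; rewrite ?r0 ?y0.
Qed.

End ReducedModel.

Lemma no_curve_by_mod8 (E : weierstrass K) d : elliptic E -> everywhere_good_reduction E -> disc E = d ^+ 3 ->
  (forall x n, nm x = 3 * n ^+ 2 -> n = 0) -> ~~ (3 %| m)%N -> p != 3%N ->
  (forall q i, q \in [:: 1%N; 3%N] -> ord_check m%:R c%:~R (red eps) q (i : bool) \/
    [/\ q = 3%N, i = false, norm_check m%:R c%:~R & forall (sg : bool) x n, nm x = (-1) ^+ sg * 3 * n ^+ 2 -> n = 0]) -> False.
Proof.
move=> ell good dE n3 m3 p3 chk.
have [x4 [x6 [d' [a [z [l [sg [j [[O4 O6 Od Oa Oz] [[nd na x4E rel] [Ol d'E loc]]]]]]]]]]] := minimal_data ell good dE.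
have [q [i [g [q13 Og gE]]]] := C_class_red O4 Od Oa Oz nd na x4E rel loc n3 m3 p3.
case: (chk q i q13) => [->//|[qE iE nc n3'] _].
rewrite qE iE mul1r in gE.
exact: (three_C_not_square O4 Od Oa Oz nd na x4E rel loc n3' nc Og gE).
Qed.

(** * The curve r y^2 = x^3 - 1728 *)

Section EvenDiscriminant.

Hypothesis m62 : m = 62%N.

Lemma P2_rational (n : int) : ~ P2 n%:~R -> ~~ (2 %| n)%Z.
Proof.
move=> nP; apply/negP => H; apply: nP; exists n, 0.
by rewrite mul0r addr0 mul0r addr0.
Qed.

Lemma point_half_rational (x y : K) (r : int) (k : nat) : isO x -> im x = 0 -> r%:~R * y ^+ 2 = x ^+ 3 - k%:R -> r != 0 ->
  exists (n : int) (q : rat), x = n%:~R /\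
  ((y = q%:K /\ r%:~R * q ^+ 2 = n%:~R ^+ 3 - k%:R) \/
   (y = q%:K * s /\ 62 * r%:~R * q ^+ 2 = n%:~R ^+ 3 - k%:R)).
Proof.
case/isOP=> n [b xE] ix E r0; have b0 : b = 0.
  by move: ix; rewrite xE -!(rmorph_int iK) imE => /eqP; rewrite intr_eq0 => /eqP.
rewrite {}b0 mul0r addr0 in xE; have r0' : r%:~R != 0 :> rat by rewrite intr_eq0.
have E' : (r%:~R)%:K * y ^+ 2 = (n%:~R ^+ 3 - k%:R)%:K.
  by rewrite rmorphB rmorphXn !rmorph_int rmorph_nat E xE.
have Er : r%:~R * re (y ^+ 2) = n%:~R ^+ 3 - k%:R by rewrite -re_scale E' re_inK.
have /eqP : r%:~R * im (y ^+ 2) = 0 by rewrite -im_scale E' im_inK.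
rewrite expr2 imM mulf_eq0 (negbTE r0') /= => /eqP H.
have /eqP : 2 * (re y * im y) = 0 by rewrite -[RHS]H; ring.
rewrite !mulf_eq0 /= => /orP[/eqP ry|/eqP iy].
  exists n, (im y); split=> //; right; split; first by rewrite {1}(coord y) ry rmorph0 add0r.
  by rewrite -Er re_sqr ry m62; ring.
exists n, (re y); split=> //; left; split; first by rewrite {1}(coord y) iy rmorph0 mul0r addr0.
by rewrite -Er re_sqr iy; ring.
Qed.

Lemma no_rational_x (x y : K) (r : int) : isO x -> ~ P2 x -> im x = 0 -> r%:~R * y ^+ 2 = x ^+ 3 - 1728 ->
  [\/ r = 1, r = -1 | r = -2] -> False.
Proof.
move=> Ox nx ix E r3; have r0 : r != 0 by case: r3 => ->.
have [n [q [xE [[yE H]|[yE H]]]]] := point_half_rational Ox ix E r0;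
  have on : ~~ (2 %| n)%Z by (apply: P2_rational; rewrite -xE).
- have rr : r%:~R ^+ 2 * r%:~R ^+ 2 != 0 :> rat by rewrite !mulf_neq0 ?intr_eq0.
  (* The substitution c = r (x - 12) / 4 takes r y^2 = x^3 - 1728 to w^2 = c (c^2 + 9 r c + 27 r^2)
     and (12, 0) to (0, 0). *)
  have /eqP : r%:~R * (n%:~R - 12) / 4 = 0 :> rat.
    apply: (@curve_no_point r _ (r%:~R ^+ 2 * q / 8) r3).
    transitivity (r%:~R ^+ 3 * (n%:~R ^+ 3 - 1728) / 64 : rat); first by field.
    by rewrite -H; field.
  rewrite !mulf_eq0 intr_eq0 (negbTE r0) /= orbF subr_eq0 (eqr_int _ n 12) => /eqP nE.
  by rewrite nE in on.
have [r2|r1] : r = -2 \/ r * r = 1 by case: r3 => ->; [right|right|left].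
  apply: (@no_integral_point_31 n (2 * q) on).
  by rewrite rmorphB rmorphXn /= -[RHS]opprB -H r2; ring.
(* For r = +-1 the number 62 r q^2 has odd valuation at 2 or vanishes, but n^3 - 1728 is odd. *)
have or : ~~ (2%N %| r)%Z by clear -r1; nia.
have on' : ~~ (2%N %| 31 * r * (n ^+ 3 - 1728))%Z by exact: odd_shifted_cube.
have := @rat_odd_valuation 2 _ (62 * q) 1 isT on'.
rewrite !rmorphM rmorphB rmorphXn /= -H; move=> /(_ _)/eqP; rewrite oner_eq0 => H'; apply/notF/H'.
transitivity (62 * 62 * (r * r)%:~R * q ^+ 2 : rat); first by rewrite r1; ring.
by rewrite rmorphM /=; ring.
Qed.

Lemma conj_nat (n : nat) : conj n%:R = n%:R.
Proof. exact: (conj_int n). Qed.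

Lemma conj_sub x y : conj (x - y) = conj x - conj y.
Proof. by rewrite conjD conjN. Qed.

Lemma conj_point (x y : K) (r k : int) : r%:~R * y ^+ 2 = x ^+ 3 - k%:~R ->
  r%:~R * conj y ^+ 2 = conj x ^+ 3 - k%:~R.
Proof.
move=> E; have := congr1 conj E; rewrite conjM conj_sub !conjX !conj_int; exact.
Qed.

Lemma im_neq0_conj x : im x != 0 -> x != conj x.
Proof. by apply: contra => /eqP E; have [q ->] := conj_fixed (esym E); rewrite im_inK. Qed.

Lemma rational_point (a b : rat) (r : int) (k : nat) :
  r%:~R * b%:K ^+ 2 = a%:K ^+ 3 - k%:R -> r%:~R * b ^+ 2 = a ^+ 3 - k%:R.
Proof.
by move=> E; apply: inK_inj; rewrite rmorphM rmorphB !rmorphXn rmorph_int rmorph_nat.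
Qed.

Lemma rational_point1 (a b : rat) (k : nat) : b%:K ^+ 2 = a%:K ^+ 3 - k%:R -> b ^+ 2 = a ^+ 3 - k%:R.
Proof. by move=> E; apply: inK_inj; rewrite rmorphB !rmorphXn rmorph_nat. Qed.

Lemma no_quadratic_x (x y : K) (r : int) : im x != 0 -> r%:~R * y ^+ 2 = x ^+ 3 - 1728 ->
  [\/ r = 1, r = -1 | r = -2] -> False.
Proof.
move=> ix E r3; have xx := im_neq0_conj ix; have E' := @conj_point x y r 1728 E.
have d0 : x - conj x != 0 by rewrite subr_eq0.
have d0' : conj x - x != 0 by rewrite subr_eq0 eq_sym.
have r0 : r != 0 by case: r3 => ->.
have r0' : r%:~R != 0 :> rat by rewrite intr_eq0.
pose l := (y - conj y) / (x - conj x).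
have lE : l * (x - conj x) = y - conj y by rewrite /l; field.
have [l' l'E] : exists q, l = q%:K.
  apply: conj_fixed; rewrite /l conjM conjV (conj_sub y (conj y)) (conj_sub x (conj x)) !conjK; field.
  by rewrite d0 d0'.
pose x3 := r%:~R * l ^+ 2 - x - conj x; pose y3 := y + l * (x3 - x).
have E3 : r%:~R * y3 ^+ 2 = x3 ^+ 3 - 1728 := chord xx E E'.
have [a aE] : exists q, x3 = q%:K.
  by apply: conj_fixed; rewrite /x3 (conj_sub _ (conj x)) (conj_sub _ x) conjK conjM conjX conj_int l'E conj_inK; ring.
have [b bE] : exists q, y3 = q%:K.
  apply: conj_fixed; rewrite /y3 (conjD y) conjM (conj_sub x3 x) aE l'E !conj_inK -aE -l'E.
  by apply/eqP; rewrite -subr_eq0; apply/eqP; transitivity (l * (x - conj x) - (y - conj y)); [ring | rewrite lE subrr].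
have H : r%:~R * b ^+ 2 = a ^+ 3 - 1728.
  by apply: rational_point; rewrite -aE -bE; exact: E3.
have rr : r%:~R ^+ 2 * r%:~R ^+ 2 != 0 :> rat by rewrite !mulf_neq0.
have /eqP : r%:~R * (a - 12) / 4 = 0 :> rat.
  apply: (@curve_no_point r _ (r%:~R ^+ 2 * b / 8) r3).
  transitivity (r%:~R ^+ 3 * (a ^+ 3 - 1728) / 64 : rat); first by field.
  by rewrite -H; field.
rewrite !mulf_eq0 intr_eq0 (negbTE r0) /= orbF subr_eq0 => /eqP a12.
have x12 : x3 = 12 by rewrite aE a12 rmorph_nat.
have b0 : b = 0.
  have /eqP : r%:~R * b ^+ 2 = 0 by rewrite H a12; ring.
  by rewrite mulf_eq0 (negbTE r0') sqrf_eq0 => /eqP.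
have yE : y = l * (x - 12).
  have : y3 = 0 by rewrite bE b0 rmorph0.
  by rewrite /y3 x12 => y0; transitivity (l * (x - 12) + (y + l * (12 - x))); [ring | rewrite y0 addr0].
have x0 : x - 12 != 0.
  apply: contra ix => /eqP x0; have -> : x = 12%:K by rewrite rmorph_nat -[x](subrK 12) x0 add0r.
  by rewrite im_inK.
(* The points (x, y), its conjugate and (12, 0) are collinear, so r l^2 = x + conj x + 12 and y = l
   (x - 12); comparing with r y^2 = x^3 - 1728 gives the norm 432 = 3 * 12^2. *)
have N : nm (x - 12) = 3%:R * 1%:~R * 12 ^+ 2.
  apply: inK_inj; rewrite nmE (conj_sub x) conj_nat.
  apply: (mulfI x0); have s1 : r%:~R * l ^+ 2 = 12 + x + conj x by rewrite -x12 /x3; ring.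
  have E2 : (12 + x + conj x) * (x - 12) ^+ 2 = (x - 12) * (x ^+ 2 + 12 * x + 144).
    by rewrite -s1; transitivity (r%:~R * y ^+ 2); [rewrite yE; ring | rewrite E; ring].
  transitivity ((12 + x + conj x) * (x - 12) ^+ 2 - (x - 12) ^+ 2 * (x + 24)); first by ring.
  by rewrite E2; ring.
have nr : nonresidue 3 (- 62) by apply: nonresidue_check.
have := @no_norm 3 (- 62) 1 (re (x - 12)) (im (x - 12)) 12 isT nr isT.
rewrite -N /nm m62 => /(_ _)[]; last by move=> _ _ /eqP.
by rewrite rmorphN /=; ring.
Qed.

Lemma natK_neq0 (n : nat) : (n.+1)%:R != 0 :> K.
Proof. by rewrite -(rmorph_nat iK) fmorph_eq0 pnatr_eq0. Qed.

(** * Descent by a 3-isogeny on z^2 = x^3 - 216 *)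

Local Notation L := (adjoin_sqrtN6 K).

Definition normj (t : L) : K := t.1 ^+ 2 + 6 * t.2 ^+ 2.

(** The form a^2 + 6 b^2 is anisotropic over K because traces of nonzero squares are positive; so
    K[j] is a field. *)
Lemma normj_eq0 (t : L) : normj t = 0 -> t = 0.
Proof.
case: t => a b; rewrite /normj /= => H.
have H' : re (a ^+ 2) + 6 * re (b ^+ 2) = 0.
  by have := congr1 re H; rewrite reD -{1}(rmorph_nat iK 6) re_scale -(rmorph0 iK) re_inK.
have A := re_sqr_ge0 a; have B := re_sqr_ge0 b; clear H.
have [a0|/re_sqr_gt0 a0] := eqVneq a 0; last by exfalso; lra.
have [b0|/re_sqr_gt0 b0] := eqVneq b 0; last by exfalso; lra.
by rewrite a0 b0.
Qed.

Definition is_cubej (t : L) := exists v, t = v ^+ 3.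

Lemma is_cubejM t u : is_cubej t -> is_cubej u -> is_cubej (t * u).
Proof. by case=> v -> [w ->]; exists (v * w); ring. Qed.

Lemma is_cubej_div t u : is_cubej (t * u) -> is_cubej u -> u != 0 -> is_cubej t.
Proof.
case=> v tuE [w uE]; rewrite {}uE in tuE * => w30.
have n0 : normj w != 0.
  by apply: contra w30 => /eqP/normj_eq0 ->; rewrite exprS mul0r.
pose w' : L := (w.1 / normj w, - (w.2 / normj w)).
have ww' : w * w' = 1.
  move: n0; rewrite /w' /normj; case: (w) => a b /= n0.
  by rewrite mkM -[RHS]/((1, 0) : L); congr (_, _); field.
exists (v * w'); transitivity (t * (w * w') ^+ 3); first by rewrite ww'; ring.
by transitivity ((t * w ^+ 3) * w' ^+ 3); [ring | rewrite tuE; ring].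
Qed.

(** As (z + 6 j) (z - 6 j) = x^3, the map z -> z + 6 j modulo cubes is the descent map of a
    3-isogeny, and this is its additivity on three collinear points. *)
Lemma chord_is_cubej x y z w : x != y -> z ^+ 2 = x ^+ 3 - 216 -> w ^+ 2 = y ^+ 3 - 216 ->
  let l := (z - w) / (x - y) in let x3 := l ^+ 2 - x - y in let z3 := z + l * (x3 - x) in
  is_cubej ((((z, 6) : L) * (w, 6)) * (z3, 6)).
Proof.
move=> xy E1 E2 l x3 z3; have [H1 H2] := chord_cube xy E1 E2.
exists (z - l * x, 6); move: H1 H2; rewrite -/l -/x3 -/z3; move: (z - l * x) z3 => b t H1 H2.
rewrite mkX3 !mkM; congr (_, _) => /=.
  by transitivity (z * w * t - 216 * (z + w + t)); [ring | rewrite H2; ring].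
by transitivity (6 * (z * w + z * t + w * t) - 1296); [ring | rewrite H1; ring].
Qed.

Lemma rational_is_cubej (a b : rat) : b ^+ 2 = a ^+ 3 - 216 -> is_cubej (b%:K, 6).
Proof.
move=> E; have [u [v [H1 H2]]] : cube_in 6%:R b 6%:R.
  by apply: (@curve_point_cube 6 a b); [left | rewrite E; ring].
exists (u%:K, v%:K); rewrite mkX3; congr (_, _).
  by rewrite H1; ring.
have := congr1 iK H2; rewrite rmorph_nat => H; rewrite [LHS]H; ring.
Qed.

(** Since 62 * 6 = 4 * 93, the element s j / 2 is a square root of -93, and (s / 2)^3 (b s + 6 j) =
    961 b / 2 + 93 (s j / 2), which [curve_point_cube] covers for D = 93. *)
Lemma antirational_is_cubej (a b : rat) : (b%:K * s) ^+ 2 = a%:K ^+ 3 - 216 -> is_cubej (b%:K * s, 6).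
Proof.
move=> E; have ss : s ^+ 2 = 62 by rewrite s2 m62.
have E' : 62 * b ^+ 2 = a ^+ 3 - 216.
  by apply: (@rational_point a b 62 216); rewrite -E exprMn ss; ring.
have [u [v [H1 H2]]] : cube_in 93%:R (961 * b / 2) 93%:R.
  apply: (@curve_point_cube 93 (31 * a / 2)); first by right.
  by transitivity (31 ^+ 3 / 8 * (62 * b ^+ 2) + 93 ^+ 3 : rat); [field | rewrite E'; field].
have s0 : s != 0 by rewrite -sqrf_eq0 ss -(rmorph_nat iK) fmorph_eq0.
have t0 := two0; have h4 := natK_neq0 3; have h8 := natK_neq0 7.
apply: (@is_cubej_div _ (((s / 2, 0) : L) ^+ 3)).
- exists (u%:K, v%:K * s / 2); rewrite !mkX3 mkM; congr (_, _) => /=.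
    transitivity (b%:K * (s ^+ 2) ^+ 2 / 8); first by field; rewrite ?t0 ?h4 ?h8.
    transitivity ((961 * b / 2)%:K); first by rewrite ss fmorph_div rmorphM !rmorph_nat; field; rewrite ?t0 ?h4 ?h8.
    rewrite H1; transitivity (u%:K ^+ 3 - 18 * u%:K * v%:K ^+ 2 * s ^+ 2 / 4); last by field; rewrite ?t0 ?h4 ?h8.
    by rewrite ss; field; rewrite ?t0 ?h4 ?h8.
  transitivity (6 * s * s ^+ 2 / 8); first by field; rewrite ?t0 ?h4 ?h8.
  transitivity (s / 2 * (93%:R : rat)%:K); first by rewrite ss; field; rewrite ?t0 ?h4 ?h8.
  rewrite H2; transitivity (s / 2 * (3 * u%:K ^+ 2 * v%:K - 6 / 4 * v%:K ^+ 3 * s ^+ 2)); last by field; rewrite ?t0 ?h4 ?h8.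
  by rewrite ss; field; rewrite ?t0 ?h4 ?h8.
- by exists (s / 2, 0).
rewrite mkX3 -pair_eqE /= /pair_eq /= negb_and; apply/orP; left.
rewrite expr0n mulr0 subr0; apply: expf_neq0; exact: mulf_neq0 s0 (invr_neq0 t0).
Qed.

Lemma sqrf_point_neq0 (z : K) : ((z, 6) : L) != 0.
Proof.
rewrite -pair_eqE /= /pair_eq /= negb_and; apply/orP; right.
by rewrite -(rmorph_nat iK) fmorph_eq0.
Qed.

(** Twice a point P is the sum of P + conj P, which is rational, and P - conj P, which has rational
    x and second coordinate in Q s. Both have trivial image under the descent map, so the image of P
    is killed by 2 in a group of exponent 3. *)
Lemma point_is_cubej (x y : K) : isO x -> ~ P2 x -> 2 * y ^+ 2 = x ^+ 3 - 1728 -> is_cubej (y / 2, 6).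
Proof.
move=> Ox nx E; have t0 := two0; have h8 := natK_neq0 7.
have E1 : (y / 2) ^+ 2 = (x / 2) ^+ 3 - 216.
  by transitivity ((2 * y ^+ 2) / 8); [|rewrite E]; field; rewrite ?t0 ?h8.
have [ix|ix] := eqVneq (im x) 0.
  have [n [q [xE [[yE H]|[yE _]]]]] := @point_half_rational x y 2 1728 Ox ix E isT.
    have on : ~~ (2 %| n)%Z by apply: P2_rational; rewrite -xE.
    have oN : ~~ (2%N %| n ^+ 3 - 1728)%Z.
      by apply: contra (@odd_shifted_cube n 1 1728 on isT isT) => H'; exact: dvdz_mull.
    have := @rat_odd_valuation 2 _ (2 * q) 1 isT oN.
    rewrite rmorphB rmorphXn /= -H; move=> /(_ _)/eqP; rewrite oner_eq0 => H'.
    by exfalso; apply/notF/H'; ring.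
  have yh : y / 2 = (q / 2)%:K * s by rewrite yE fmorph_div rmorph_nat mulrAC.
  have xh : x / 2 = (n%:~R / 2)%:K by rewrite xE fmorph_div rmorph_int rmorph_nat.
  by rewrite yh; apply: (@antirational_is_cubej (n%:~R / 2)); rewrite -yh -xh; exact: E1.
pose X := x / 2; pose Y := y / 2.
have cX : conj X = conj x / 2 by rewrite /X conjM conjV conj_nat.
have XX : X != conj X.
  by rewrite cX /X (inj_eq (mulIf _)) ?invr_eq0 // im_neq0_conj.
have d0 : X - conj X != 0 by rewrite subr_eq0.
have d0' : conj X - X != 0 by rewrite subr_eq0 eq_sym.
have E2 : conj Y ^+ 2 = conj X ^+ 3 - 216.
  by have := congr1 conj E1; rewrite (conj_sub (X ^+ 3)) !conjX conj_nat.
have E3 : (- conj Y) ^+ 2 = conj X ^+ 3 - 216 by rewrite sqrrN.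
have C1 : is_cubej ((((Y, 6) : L) * (conj Y, 6))).
  pose l := (Y - conj Y) / (X - conj X).
  pose x3 := l ^+ 2 - X - conj X; pose y3 := Y + l * (x3 - X).
  have lE : l * (X - conj X) = Y - conj Y by rewrite /l; field.
  have [l' l'E] : exists q, l = q%:K.
    apply: conj_fixed; rewrite /l conjM conjV (conj_sub Y (conj Y)) (conj_sub X (conj X)) !conjK; field.
    by rewrite d0 d0'.
  have [a aE] : exists q, x3 = q%:K.
    by apply: conj_fixed; rewrite /x3 (conj_sub _ (conj X)) (conj_sub _ X) conjK conjX l'E conj_inK; ring.
  have [b bE] : exists q, y3 = q%:K.
    apply: conj_fixed; rewrite /y3 (conjD Y) conjM (conj_sub x3 X) aE l'E !conj_inK -aE -l'E.
    by apply/eqP; rewrite -subr_eq0; apply/eqP; transitivity (l * (X - conj X) - (Y - conj Y)); [ring | rewrite lE subrr].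
  apply: is_cubej_div (chord_is_cubej XX E1 E2) _ (sqrf_point_neq0 _).
  rewrite -/Y -/l -/x3 -/y3 bE; apply: (@rational_is_cubej a).
  by apply: rational_point1; rewrite -aE -bE; exact: (chord1 XX E1 E2).
have C2 : is_cubej ((((Y, 6) : L) * (- conj Y, 6))).
  pose l := (Y - - conj Y) / (X - conj X).
  pose x3 := l ^+ 2 - X - conj X; pose y3 := Y + l * (x3 - X).
  have lE : l * (X - conj X) = Y + conj Y by rewrite /l; field.
  have [l' l'E] : exists q, l = q%:K * s.
    apply: conj_anti; rewrite /l conjM conjV (conj_sub Y (- conj Y)) conjN (conj_sub X (conj X)) !conjK; field.
    by rewrite d0 d0'.
  have [a aE] : exists q, x3 = q%:K.
    by apply: conj_fixed; rewrite /x3 (conj_sub _ (conj X)) (conj_sub _ X) conjK conjX l'E conjM conj_inK conj_s; ring.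
  have [b bE] : exists q, y3 = q%:K * s.
    apply: conj_anti; rewrite /y3 (conjD Y) conjM (conj_sub x3 X) aE l'E conjM conj_s !conj_inK -aE.
    have -> : l'%:K * - s = - l by rewrite l'E mulrN.
    by rewrite -l'E; apply/eqP; rewrite -subr_eq0; apply/eqP; transitivity (Y + conj Y - l * (X - conj X)); [ring | rewrite lE subrr].
  apply: is_cubej_div (chord_is_cubej XX E1 E3) _ (sqrf_point_neq0 _).
  rewrite -/Y -/l -/x3 -/y3 bE; apply: (@antirational_is_cubej a).
  by rewrite -aE -bE; exact: (chord1 XX E1 E3).
have n0 := sqrf_point_neq0 Y.
have X0 : conj X != 0.
  by rewrite conj_eq0; apply: contra ix => /eqP X0; rewrite -(divfK t0 x) -/X X0 mul0r -(rmorph0 iK) im_inK.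
have w0 : ((- conj X, 0) : L) != 0.
  by rewrite -pair_eqE /= /pair_eq /= negb_and oppr_eq0 X0.
have u0 : ((conj Y, 6) : L) * (- conj Y, 6) = ((- conj X, 0) : L) ^+ 3.
  rewrite mkX3 mkM; congr (_, _) => /=; last by ring.
  by transitivity (- (conj Y ^+ 2) - 216); [ring | rewrite E2; ring].
have C3 : is_cubej ((((Y, 6) : L) * (Y, 6))).
  apply: (@is_cubej_div _ (((- conj X, 0) : L) ^+ 3)).
  - by have := is_cubejM C1 C2; rewrite mulrACA u0.
  - by exists (- conj X, 0).
  apply: contra w0 => /eqP H.
  have : normj ((- conj X, 0) : L) ^+ 3 = 0.
    have := congr1 normj H; rewrite mkX3 /normj /= => H'.
    by transitivity (((- conj X) ^+ 3 - 18 * - conj X * 0 ^+ 2) ^+ 2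
                   + 6 * (3 * (- conj X) ^+ 2 * 0 - 6 * 0 ^+ 3) ^+ 2); [ring | rewrite H'; ring].
  by move/eqP; rewrite expf_eq0 /= => /eqP/normj_eq0/eqP.
apply: (@is_cubej_div _ (((Y, 6) : L) * (Y, 6))) => //.
  by exists (Y, 6); ring.
apply: contra n0 => /eqP H.
have : normj ((Y, 6) : L) ^+ 2 = 0.
  have := congr1 normj H; rewrite mkM /normj /= => H'.
  by transitivity ((Y * Y - 6 * (6 * 6)) ^+ 2 + 6 * (Y * 6 + 6 * Y) ^+ 2); [ring | rewrite H'; ring].
by move/eqP; rewrite expf_eq0 /= => /eqP/normj_eq0/eqP.
Qed.

(** * The cubic equation for b and the resulting unit equations *)

Lemma isO_cubic_root (u e f g : K) : isO e -> isO f -> isO g -> u ^+ 3 + e * u ^+ 2 + f * u + g = 0 -> isO u.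
Proof.
move=> /alg_integer_isO Oe' /alg_integer_isO Of /alg_integer_isO Og E; apply/alg_integer_isO.
pose P : {poly K} := Poly [:: g; f; e; 1].
have PE : P = [:: g; f; e; 1] :> seq K by rewrite /P (PolyK (c := 0)) ?oner_neq0.
apply: (@integral_root_monic _ _ _ _ P).
- by rewrite monicE lead_coefE PE.
- by apply/eqP; rewrite horner_Poly /= -[RHS]E; ring.
by rewrite PE => z; rewrite !inE => /or4P[] /eqP->//; exact: integral1.
Qed.

Lemma cubeK_inj (u v : K) : u ^+ 3 = v ^+ 3 -> u = v.
Proof.
move=> E; apply/eqP; rewrite -subr_eq0; apply/negPn/negP => d0.
have H : (2 * u + v) ^+ 2 + 3 * v ^+ 2 = 0.
  apply: (mulfI d0); rewrite mulr0; transitivity (4 * (u ^+ 3 - v ^+ 3)); first by ring.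
  by rewrite E subrr mulr0.
have H' : re ((2 * u + v) ^+ 2) + 3 * re (v ^+ 2) = 0.
  by have := congr1 re H; rewrite reD -{1}(rmorph_nat iK 3) re_scale -(rmorph0 iK) re_inK.
have A := re_sqr_ge0 (2 * u + v); have B := re_sqr_ge0 v; clear H E.
have [v0|/re_sqr_gt0 v0] := eqVneq v 0; last by exfalso; clear d0; lra.
have [u0|/re_sqr_gt0 u0] := eqVneq (2 * u + v) 0; last by exfalso; clear d0 v0; lra.
move: d0; rewrite v0 subr0; move: u0; rewrite v0 addr0 => /eqP.
by rewrite mulf_eq0 (negbTE two0) /= => ->.
Qed.

(** If y / 2 + 6 j = (A + B j)^3, the coefficient of j gives B (A^2 - 2 B^2) = 2 and the norm gives
    x / 2 = A^2 + 6 B^2. Eliminating A yields a cubic that is monic with integral coefficients in b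
    = 4 B; [al] is A. *)
Lemma cubic_solution (x y : K) : isO x -> ~ P2 x -> 2 * y ^+ 2 = x ^+ 3 - 1728 ->
  exists al be, [/\ isO be, be != 0, be ^+ 3 - x * be + 16 = 0 & 8 * al ^+ 2 * be = be ^+ 3 + 64].
Proof.
move=> Ox nx E; have [[A B]] := point_is_cubej Ox nx E; rewrite mkX3 => -[yE].
have h8 := natK_neq0 7; have h4 := natK_neq0 3; have h6 := natK_neq0 5; have t0 := two0.
have h3 := natK_neq0 2; move=> E6.
have E2 : B * (A ^+ 2 - 2 * B ^+ 2) = 2.
  by apply: (mulfI h3); transitivity (6 : K); [rewrite E6|]; ring.
have B0 : B != 0 by apply: contraNneq t0 => B0; rewrite -E2 B0 mul0r.
have AE : A ^+ 2 = 2 / B + 2 * B ^+ 2.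
  apply: (mulfI B0); transitivity (B * (A ^+ 2 - 2 * B ^+ 2) + 2 * B ^+ 3); first by ring.
  by rewrite [X in X + _]E2; field.
have xE : x / 2 = A ^+ 2 + 6 * B ^+ 2.
  apply: cubeK_inj; transitivity ((y / 2) ^+ 2 + 6 * 6 ^+ 2).
    by transitivity ((2 * y ^+ 2 + 1728) / 8); [rewrite E | ]; field; rewrite ?t0 ?h8.
  by rewrite yE [X in _ + 6 * X ^+ 2]E6; ring.
have xE' : x = 4 / B + 16 * B ^+ 2.
  by rewrite -[x](divfK t0) xE AE; field.
have cub : (4 * B) ^+ 3 - x * (4 * B) + 16 = 0 by rewrite xE'; field.
exists A, (4 * B); split=> //.
- have := @isO_cubic_root (4 * B) 0 (- x) 16 (isO_nat 0) (isO_N Ox) (isO_nat 16).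
  by apply; rewrite -[RHS]cub; ring.
- by rewrite mulf_neq0.
by rewrite AE; field.
Qed.

(** The norm of [u] is odd and divides 4^k, hence is +-1, and [norm_class] excludes -1. *)
Lemma unit_of_dvd (u v : K) (k : nat) : isO u -> isO v -> ~ P2 u -> u * v = 2 ^+ k -> nm u = 1.
Proof.
move=> Ou Ov nu E; have /intrP[N NE] := isO_nm Ou; have /intrP[M ME] := isO_nm Ov.
have oN := odd_norm Ou nu NE.
have NM : N * M = 2 ^+ (2 * k).
  apply: (@intr_inj rat); rewrite rmorphM /= -NE -ME -nmM E nmX rmorphXn exprM.
  by rewrite -(rmorph_nat iK 2) nm_inK.
have : (absz N %| 2 ^ (2 * k))%N.
  by have := congr1 absz NM; rewrite abszM abszX => <-; exact: dvdn_mulr.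
case/(dvdn_pfactor _ _ (isT : prime 2)) => -[|e] _ aN; last first.
  by move: oN; rewrite dvdzE aN expnS dvdn_mulr.
have NE' : nm u = (-1) ^+ (N < 0)%R * 1%:R * 1 ^+ 2.
  by rewrite NE {1}[N]intEsign aN expr1n !mulr1 rmorph_sign.
by have [[_ sg]|[//]] := norm_class (isT : (1 %| 2)%N) (oner_neq0 _) NE'; rewrite NE' sg expr1n !mulr1.
Qed.

Lemma unit_conj_inv u : nm u = 1 -> u * conj u = 1.
Proof. by move=> E; rewrite -nmE E rmorph1. Qed.

Lemma no_sqr_eq_2mod128 (h k : K) : isO k -> h ^+ 2 = 2 + 128 * k -> False.
Proof.
move=> Ok E; have Oh : isO h by apply: (@isO_root 2) => //; rewrite E; isO_tac.
case/isOP: Oh E => a [b ->]; case/isOP: Ok => e [f ->]; rewrite expr2 int_mulE m62.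
have -> : 2 + 128 * (e%:~R + f%:~R * s) = (2 + 128 * e)%:~R + (128 * f)%:~R * s.
  by rewrite !rmorphD !rmorphM /=; ring.
case/int_coord=> H1 H2; apply: (@no_sqr_2mod128 a b e f); [rewrite -H1 | rewrite -H2]; ring.
Qed.

Lemma no_sqr_eq_neg1mod64 (h k : K) : isO k -> h ^+ 2 = - 1 + 64 * k -> False.
Proof.
move=> Ok E; have Oh : isO h by apply: (@isO_root 2) => //; rewrite E; isO_tac.
case/isOP: Oh E => a [b ->]; case/isOP: Ok => e [f ->]; rewrite expr2 int_mulE m62.
have -> : - 1 + 64 * (e%:~R + f%:~R * s) = (- 1 + 64 * e)%:~R + (64 * f)%:~R * s.
  by rewrite !rmorphD !rmorphM /= rmorphN; ring.
case/int_coord=> H1 H2; apply: (@no_sqr_neg1mod64 a b e f); [rewrite -H1 | rewrite -H2]; ring.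
Qed.

Hypothesis sp0 : sp = false.

(** An odd power of pi would make the norm twice a square, and eps is 2 (pi / 2)^2. For i = 1 the
    element [l] is not integral. *)
Lemma unit_class u : isO u -> nm u = 1 ->
  exists (sg i : bool) (l : K), l != 0 /\ u = (-1) ^+ sg * 2 ^+ i * l ^+ 2.
Proof.
move=> Ou u1; have u0 : u != 0 by rewrite -nm_eq0 u1 oner_neq0.
have e0 := eps0; have q0 := pi0; have t0 := two0.
have [sg [i [k [nu [nu0 uE]]]]] : exists (sg i k : bool) nu, nu != 0 /\ u = (-1) ^+ sg * eps ^+ i * pi ^+ k * nu ^+ 2.
  apply: class_outside2 => // P fP _; exists 1; first exact: oner_neq0.
  rewrite expr1n divr1; apply: (unitP_O fP) => // Pu; apply: (fp_proper fP).
  by rewrite -(unit_conj_inv u1) mulrC; apply: (fpM fP) => //; exact: isO_conj.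
have k0 : k = false.
  case: k uE => // uE; exfalso.
  have := @rat_odd_valuation 2 1 (2 * nm nu) 1 isT isT.
  have : nm u = 2 * nm nu ^+ 2.
    rewrite uE !nmM !nmX nme nmpi sp0 expr1n.
    have -> : nm (-1) = 1 by rewrite -(rmorph1 iK) -rmorphN nm_inK; ring.
    by rewrite expr1n; ring.
  rewrite u1 => H1 /(_ _)/eqP; rewrite oner_eq0 => H; apply/notF/H.
  by transitivity (2 * (2 * nm nu ^+ 2)); [ring | rewrite -H1; ring].
rewrite k0 mulr1 in uE; have epsE : eps = 2 * (pi / 2) ^+ 2 by rewrite exprMn pi2; field.
exists sg, i, ((pi / 2) ^+ i * nu); split; first by rewrite mulf_neq0 ?expf_neq0 ?mulf_neq0 ?invr_eq0.
by rewrite uE; case: (i) => /=; [rewrite epsE|]; ring.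
Qed.

(** The inverse of the unit [t] is conj t, so t' = 256 conj t; taking norms in eta^3 = t + 256 conj
    t - 32 leads to [no_unit_trace]. *)
Lemma no_unit_root (eta t t' : K) : nm eta = 1 -> isO t -> isO t' -> ~ P2 t ->
  t * t' = 2 ^+ 8 -> t + t' = eta ^+ 3 + 32 -> False.
Proof.
move=> e1 Ot Ot' nt tt' tE; have t1 := unit_of_dvd Ot Ot' nt tt'; have tc := unit_conj_inv t1.
have t'E : t' = 256 * conj t.
  by transitivity (t' * (t * conj t)); [rewrite tc mulr1 | rewrite mulrA [t' * t]mulrC tt'; ring].
have [e [f tef]] := isOP Ot.
have H1 : e ^+ 2 - 62 * f ^+ 2 = 1.
  by apply: (@intr_inj rat); move: t1; rewrite tef nm_int m62.
have E3 : eta ^+ 3 = (257 * e - 32)%:~R + (- (255 * f))%:~R * s.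
  have -> : eta ^+ 3 = t + t' - 32 by rewrite tE; ring.
  rewrite t'E tef conjD conjM !conj_int conj_s rmorphB rmorphN !rmorphM /=; ring.
have := congr1 nm E3; rewrite nmX e1 expr1n nm_int m62 => H2.
by apply: (no_unit_trace H1); apply: (@intr_inj rat); rewrite sqrrN in H2; rewrite -H2.
Qed.

Lemma no_unit_cubic (eta b : K) : isO eta -> nm eta = 1 -> 2 * b ^+ 2 = 64 + eta ^+ 3 -> False.
Proof.
move=> Oe' e1 E; have ec := unit_conj_inv e1; have fP := P2_finite.
have e0 : eta != 0 by rewrite -nm_eq0 e1 oner_neq0.
have t0 := two0; have h4 := natK_neq0 3; have h8 := natK_neq0 7.
have Oc := isO_conj Oe'; have cE : conj eta = eta^-1 by apply: (mulfI e0); rewrite ec divff.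
have Ok : isO (conj eta ^+ 3) by exact: isO_X.
have [sg [i [l [l0 eE]]]] := unit_class Oe' e1.
case: sg i eE => -[] /=; rewrite ?expr0 ?expr1 ?mul1r => eE.
(* eta = -2 l^2: the square of b / (2 l^3) is -1 - 64 / eta^3. *)
- apply: (@no_sqr_eq_neg1mod64 (b / (2 * l ^+ 3)) (- conj eta ^+ 3)); first exact: isO_N.
  have l6 : 8 * l ^+ 6 = - eta ^+ 3 by rewrite eE; ring.
  have -> : (b / (2 * l ^+ 3)) ^+ 2 = (2 * b ^+ 2) / (8 * l ^+ 6) by field; rewrite ?h8 ?t0 ?l0.
  by rewrite E l6 cE; field; rewrite e0 oppr_eq0 expf_neq0.
(* eta = -l^2: the squares in (2 b)^2 + 2 l^6 = 128 are totally nonnegative, which bounds the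
   coordinates. *)
- have Ol : isO l by apply: (@isO_root 2) => //; have -> : l ^+ 2 = - eta; [rewrite eE; ring | exact: isO_N].
  have b2 : (2 * b) ^+ 2 + 2 * (l ^+ 3) ^+ 2 = 128.
    by transitivity (2 * (2 * b ^+ 2) + 2 * (l ^+ 2) ^+ 3); [ring | rewrite E eE; ring].
  have Ob : isO (2 * b).
    apply: (@isO_root 2) => //; have -> : (2 * b) ^+ 2 = 128 - 2 * (l ^+ 3) ^+ 2 by rewrite -b2; ring.
    by isO_tac.
  have nl : nm (l ^+ 3) ^+ 2 = 1.
    have : nm (l ^+ 2) = 1.
      have -> : l ^+ 2 = (- 1%:K) * eta by rewrite eE rmorph1; ring.
      by rewrite nmM e1 -rmorphN nm_inK; ring.
    by rewrite !nmX => H; transitivity ((nm l ^+ 2) ^+ 3); [ring | rewrite H expr1n].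
  have [e [f lE]] := isOP (isO_X 3 Ol); have [u [v bE]] := isOP Ob.
  move: b2 nl; rewrite lE bE nm_int m62 => H1 H2.
  have : (u ^+ 2 + 62 * v ^+ 2 + 2 * (e ^+ 2 + 62 * f ^+ 2))%:~R + (2 * (u * v) + 4 * (e * f))%:~R * s = 128%:~R + 0%:~R * s.
    rewrite mul0r addr0 -[RHS]H1 !expr2 !int_mulE m62 !rmorphD !rmorphM /=; ring.
  case/int_coord=> H3 H4; apply: (no_sum_128 H3 H4).
  by apply: (@intr_inj rat); rewrite rmorphXn.
(* eta = 2 l^2: the numbers 2 (b / 2 +- l^3)^2 are integral with product 2^8 and sum eta^3 + 32; not
   both lie above 2, since eta is a unit. *)
- have B2 : (b / 2) ^+ 2 = l ^+ 6 + 8.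
    by transitivity ((2 * b ^+ 2) / 8); [|rewrite E eE]; field; rewrite ?t0 ?h8.
  pose u := 2 * (b / 2 + l ^+ 3) ^+ 2; pose v := 2 * (b / 2 - l ^+ 3) ^+ 2.
  have uv : u * v = 2 ^+ 8.
    by transitivity (4 * ((b / 2) ^+ 2 - l ^+ 6) ^+ 2); [rewrite /u /v | rewrite B2]; ring.
  have u_v : u + v = eta ^+ 3 + 32.
    by transitivity (4 * ((b / 2) ^+ 2 + l ^+ 6)); [rewrite /u /v | rewrite B2 eE]; ring.
  have isOr w w' : w * w' = 2 ^+ 8 -> w + w' = eta ^+ 3 + 32 -> isO w.
    move=> ww' w_w'; have O1 : isO (- (eta ^+ 3 + 32)) by isO_tac.
    apply: (isO_cubic_root O1 (isO_nat 256) (isO_nat 0)).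
    by rewrite -w_w'; transitivity (w * (256 - w * w')); [ring | rewrite ww'; ring].
  have Ou := isOr _ _ uv u_v; have Ov := isOr v u (etrans (mulrC _ _) uv) (etrans (addrC _ _) u_v).
  have [Pu|nu] := classic (P2 u); last exact: (no_unit_root e1 Ou Ov nu uv u_v).
  have [Pv|nv] := classic (P2 v).
    have : P2 (eta ^+ 3).
      have -> : eta ^+ 3 = u + v - 16 * 2 by rewrite u_v; ring.
      by apply: (fpB fP); [exact: (fp_add fP) | apply: (fpM fP); [exact: isO_nat | exact: P2_2]].
    move/(fp_primeX fP Oe') => Pe; apply: (fp_proper fP); rewrite -ec mulrC.
    exact: (fpM fP).
  exact: (no_unit_root e1 Ov Ou nv (etrans (mulrC _ _) uv) (etrans (addrC _ _) u_v)).
(* eta = l^2: the square of 2 b / l^3 is 2 + 128 / eta^3. *)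
apply: (@no_sqr_eq_2mod128 (2 * b / l ^+ 3) (conj eta ^+ 3)) => //.
have l6 : l ^+ 6 = eta ^+ 3 by rewrite eE; ring.
have -> : (2 * b / l ^+ 3) ^+ 2 = 2 * (2 * b ^+ 2) / l ^+ 6 by field.
by rewrite E l6 cE; field.
Qed.

Lemma no_point_twist2 (x y : K) : isO x -> ~ P2 x -> 2 * y ^+ 2 = x ^+ 3 - 1728 -> False.
Proof.
move=> Ox nx E; have fP := P2_finite; have [a [b [Ob b0 H1 H2]]] := cubic_solution Ox nx E.
have t0 := two0; pose eta := x - b ^+ 2; have Oeta : isO eta by rewrite /eta; isO_tac.
have be : b * eta = 2 ^+ 4.
  by transitivity (16 - (b ^+ 3 - x * b + 16)); [rewrite /eta | rewrite H1]; ring.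
have [Pb|nb] := classic (P2 b); last first.
  have b1 := unit_of_dvd Ob Oeta nb be; have bc := unit_conj_inv b1.
  have cE : conj b = b^-1 by apply: (mulfI b0); rewrite bc divff.
  (* If [b] is a unit, (4 a / b)^2 = 2 (b^3 + 64) / b^3 = 2 + 128 / b^3. *)
  apply: (@no_sqr_eq_2mod128 (4 * a / b) (conj b ^+ 3)); first by apply/isO_X/isO_conj.
  have -> : (4 * a / b) ^+ 2 = 2 * (8 * a ^+ 2 * b) / b ^+ 3 by field.
  by rewrite H2 cE; field.
have ne : ~ P2 eta.
  move=> Pe; apply: nx; have -> : x = eta + b * b by rewrite /eta; ring.
  by apply: (fp_add fP) => //; exact: (fpM fP).
have e1 := unit_of_dvd Oeta Ob ne (etrans (mulrC _ _) be).
have e0 : eta != 0 by rewrite -nm_eq0 e1 oner_neq0.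
have bE : b = 16 / eta by apply: (mulIf e0); rewrite be; field.
(* Substituting b = 16 / eta turns 8 a^2 b = b^3 + 64 into 2 (a eta)^2 = 64 + eta^3. *)
apply: (@no_unit_cubic eta (a * eta) Oeta e1).
have h64 := natK_neq0 63.
transitivity ((8 * a ^+ 2 * b) * eta ^+ 3 / 64); first by rewrite bE; field; rewrite ?e0 ?h64.
by rewrite H2 bE; field; rewrite ?e0 ?h64.
Qed.

Lemma no_curve_even (E : weierstrass K) (d : K) : elliptic E -> everywhere_good_reduction E -> disc E = d ^+ 3 -> False.
Proof.
move=> ell good dE.
have [x4 [x6 [d' [a [z [l [sg [j [[O4 O6 Od Oa Oz] [[nd na x4E rel] [Ol d'E loc]]]]]]]]]]] := minimal_data ell good dE.
have [x [r [y [Ox nx r4 H]]]] := reduced_point Od Oa Oz nd na x4E rel loc d'E.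
have [r3|r2] : [\/ r = 1, r = -1 | r = -2] \/ r = 2.
  case/or4P: r4 => [/eqP->|/eqP->|/eqP->|]; [left; exact: Or31|left; exact: Or32|by right|].
  by rewrite orbF => /eqP->; left; exact: Or33.
  have [ix|ix] := eqVneq (im x) 0; first exact: (no_rational_x Ox nx ix H r3).
  exact: (no_quadratic_x ix H r3).
by apply: (no_point_twist2 Ox nx); rewrite -H r2.
Qed.

End EvenDiscriminant.

End UnitClasses.

End QuadraticField.

(** * The fields with m = 62, 67, 71 *)
Lemma squarefree_check k : (0 < k)%N -> all (fun p => ~~ (p ^ 2 %| k)%N) (iota 2 k) -> squarefree k.
Proof.
move=> k0 /allP H p pp; have [pk|pk] := leqP p k.
  by apply: H; rewrite mem_iota prime_gt1 //= ltnS (leq_trans pk).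
apply/negP => /dvdn_leq - /(_ k0) pk2; move: pk; rewrite ltnNge (leq_trans _ pk2) //.
by rewrite -[X in (X <= _)%N]expn1 leq_exp2l ?prime_gt1.
Qed.

Section Discriminants.

Variables (K : fieldExtType rat) (iK : {rmorphism rat -> K}) (s : K) (re im : K -> rat).
Hypothesis coord : forall x, x = iK (re x) + iK (im x) * s.
Variables (E : weierstrass K) (d : K).
Hypotheses (ell : elliptic E) (good : everywhere_good_reduction E) (dE : disc E = d ^+ 3).

Lemma no_curve_62 : s ^+ 2 = 62%:R -> False.
Proof.
move=> s2.
have sf : squarefree 62 by apply: squarefree_check.
have m23 : (62 %% 4 = 2 \/ 62 %% 4 = 3)%N by left.
(* 8^2 - 62 = 2, so pi generates the prime above 2; eps is pi^2 / 2. *)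
pose eps : K := 63%:~R + 8%:~R * s; pose pi : K := 8%:~R + 1%:~R * s.
apply: (@no_curve_even 62 K iK s re im s2 coord sf m23 31 eps pi false isT isT (or_intror erefl)
  _ _ _ _ _ _ 0 _ _ _ erefl erefl E d ell good dE).
- exact: (isO_mk s2 coord m23).
- by rewrite /pi /eps; ring: s2.
- by rewrite /eps (nm_int s2 coord m23).
- by rewrite /pi (nm_int s2 coord m23).
- by apply: nonresidue_check.
- by apply: nonresidue_check.
- by [].
- by vm_compute.
by rewrite /eps (red_mk s2 coord m23); vm_compute.
Qed.

Lemma no_curve_67 : s ^+ 2 = 67%:R -> False.
Proof.
move=> s2.
have sf : squarefree 67 by apply: squarefree_check.
have m23 : (67 %% 4 = 2 \/ 67 %% 4 = 3)%N by right.
(* 221^2 - 67 * 27^2 = -2, so pi^2 / 2 has rational part 221^2 + 1. *)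
pose eps : K := (221 ^+ 2 + 1)%:~R + (221 * 27)%:~R * s; pose pi : K := 221%:~R + 27%:~R * s.
have redE : red re im eps = (2%:R, 7%:R).
  by rewrite /eps (red_mk s2 coord m23) rmorphD rmorphXn rmorphM; apply/eqP.
apply: (@no_curve_by_mod8 67 K iK s re im s2 coord sf m23 67 eps pi true isT isT (or_introl erefl)
  _ _ _ _ _ _ 1 _ _ _ E d ell good dE _ isT isT _).
- exact: (isO_mk s2 coord m23).
- by rewrite /pi /eps; ring: s2.
- by rewrite /eps (nm_int s2 coord m23); ring.
- by rewrite /pi (nm_int s2 coord m23).
- by apply: nonresidue_check.
- by apply: nonresidue_check.
- by [].
- by vm_compute.
- by rewrite redE; vm_compute.
(* The equation is re^2 - 3 n^2 = 67 im^2, and 3 is not a square modulo 67. *)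
- move=> x n H; have nr : nonresidue 67 (- 3) by apply: nonresidue_check.
  have := @no_norm 67 (- 3) 1 (re x) n (im x) isT nr isT.
  move: H; rewrite /nm => H /(_ _)[] //; rewrite rmorphN /=.
  by transitivity ((re x ^+ 2 - 67 * im x ^+ 2) + 67 * im x ^+ 2 - 3 * n ^+ 2); [ring | rewrite H; ring].
move=> q i q13; left; rewrite redE.
by move: q13; rewrite !inE => /orP[] /eqP->; case: i; vm_compute.
Qed.

Lemma no_curve_71 : s ^+ 2 = 71%:R -> False.
Proof.
move=> s2.
have sf : squarefree 71 by apply: squarefree_check.
have m23 : (71 %% 4 = 2 \/ 71 %% 4 = 3)%N by right.
(* 59^2 - 71 * 7^2 = 2, so pi^2 / 2 has rational part 59^2 - 1. *)
pose eps : K := (59 ^+ 2 - 1)%:~R + (59 * 7)%:~R * s; pose pi : K := 59%:~R + 7%:~R * s.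
have redE : red re im eps = (0, 5%:R).
  by rewrite /eps (red_mk s2 coord m23) rmorphB rmorphXn rmorphM; apply/eqP.
have n3 (sg : bool) (x : K) (n : rat) : nm 71 re im x = (-1) ^+ sg * 3 * n ^+ 2 -> n = 0.
  have nr : nonresidue 3 (- 71) by apply: nonresidue_check.
  have c3 : ~~ (3 %| (-1) ^+ sg)%Z by case: sg.
  have := @no_norm 3 (- 71) ((-1) ^+ sg) (re x) (im x) n isT nr c3.
  rewrite /nm => H H'; move: H; rewrite rmorph_sign rmorphN /= => H.
  by have [] := H _ => //; rewrite mulNr [3%:R * _]mulrC -H'.
apply: (@no_curve_by_mod8 71 K iK s re im s2 coord sf m23 71 eps pi false isT isT (or_introl erefl)
  _ _ _ _ _ _ 1 _ _ _ E d ell good dE _ isT isT _).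
- exact: (isO_mk s2 coord m23).
- by rewrite /pi /eps; ring: s2.
- by rewrite /eps (nm_int s2 coord m23); ring.
- by rewrite /pi (nm_int s2 coord m23).
- by apply: nonresidue_check.
- by apply: nonresidue_check.
- by [].
- by vm_compute.
- by rewrite redE; vm_compute.
- by move=> x n H; apply: (n3 false x); rewrite mul1r.
move=> q i; rewrite redE !inE => /orP[/eqP->|/eqP->]; case: i;
  [left; by vm_compute | left; by vm_compute | left; by vm_compute | right; split=> //; by vm_compute].
Qed.

End Discriminants.

Close Scope ring_scope.

Theorem theorem1p3 (m : nat) (hm : m \in [:: 62; 67; 71])
    (K : fieldExtType rat) (hK : is_Q_sqrt m K) :
  ~ exists E : weierstrass K,
      [/\ elliptic E,
          everywhere_good_reduction E &
          exists d : K, disc E = (d ^+ 3)%R].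
Proof.
case=> E [ell good [d dE]]; have [s [re [im [s2 coord]]]] := Q_sqrt_coord hK.
case/or4P: hm => // /eqP mE; rewrite mE in s2.
- exact: (@no_curve_62 K (in_alg K) s re im coord E d ell good dE s2).
- exact: (@no_curve_67 K (in_alg K) s re im coord E d ell good dE s2).
exact: (@no_curve_71 K (in_alg K) s re im coord E d ell good dE s2).
Qed.
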